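(* Let $n\ge 1$, let $\boldsymbol N=(N_1,\dots,N_n)$ be nonnegative integers, let $a,b,c,d,e,f,x_1,\dots,x_n$ be complex parameters and let $\lambda = qa^2/(bcd)$. Then \begin{align*} &\sum_{\substack{0\le k_r\le N_r\\ r=1,\dots,n}}\Bigg(\prod_{1\le r<s\le n}\frac{\theta(q^{k_r-k_s}x_r/x_s;p)}{\theta(x_r/x_s;p)}\prod_{r,s=1}^n\frac{(q^{-N_s}x_r/x_s;q,p)_{k_r}}{(qx_r/x_s;q,p)_{k_r}}\\ &\quad\times\prod_{r=1}^n\frac{\theta(ax_rq^{k_r+|\boldsymbol k|};p)}{\theta(ax_r;p)}\prod_{r=1}^n\frac{(ax_r;q,p)_{|\boldsymbol k|}}{(ax_rq^{1+N_r};q,p)_{|\boldsymbol k|}}\\ &\quad\times\prod_{r=1}^n\frac{(cx_r,\,dx_r,\,\lambda ax_rq^{|\boldsymbol N|+1}/(ef);q,p)_{k_r}}{(ax_rq/b,\,ax_rq/e,\,ax_rq/f;q,p)_{k_r}}\cdot\frac{(b,e,f;q,p)_{|\boldsymbol k|}}{(aq/c,\,aq/d,\,efq^{-|\boldsymbol N|}/\lambda;q,p)_{|\boldsymbol k|}}\,q^{\sum_{r=1}^n rk_r}\Bigg)\\ &=\frac{(\lambda q/e,\lambda q/f;q,p)_{|\boldsymbol N|}}{(\lambda q,\lambda q/(ef);q,p)_{|\boldsymbol N|}}\prod_{r=1}^n\frac{(ax_rq,\,ax_rq/(ef);q,p)_{N_r}}{(ax_rq/e,\,ax_rq/f;q,p)_{N_r}}\\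 &\quad\times\sum_{\substack{0\le k_r\le N_r\\ r=1,\dots,n}}\Bigg(\prod_{1\le r<s\le n}\frac{\theta(q^{k_r-k_s}x_r/x_s;p)}{\theta(x_r/x_s;p)}\prod_{r,s=1}^n\frac{(q^{-N_s}x_r/x_s;q,p)_{k_r}}{(qx_r/x_s;q,p)_{k_r}}\\ &\qquad\times\frac{\theta(\lambda q^{2|\boldsymbol k|};p)}{\theta(\lambda;p)}\frac{(\lambda,\lambda c/a,\lambda d/a,e,f;q,p)_{|\boldsymbol k|}}{(\lambda q^{|\boldsymbol N|+1},aq/c,aq/d,\lambda q/e,\lambda q/f;q,p)_{|\boldsymbol k|}}\\ &\qquad\times\prod_{r=1}^n\frac{(\lambda b/(ax_r);q,p)_{|\boldsymbol k|}\,(\lambda ax_rq^{|\boldsymbol N|+1}/(ef);q,p)_{k_r}}{(efq^{-N_r}/(ax_r);q,p)_{|\boldsymbol k|}\,(ax_rq/b;q,p)_{k_r}}\prod_{r=1}^n\frac{(ef/(ax_r);q,p)_{|\boldsymbol k|-k_r}}{(\lambda b/(ax_r);q,p)_{|\boldsymbol k|-k_r}}\cdot q^{\sum_{r=1}^n rk_r}\Bigg). \end{align*}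
   Context: Let $q,p$ be complex numbers with $q\neq 0$ and $|p|<1$. For $a\ne 0$ put $\theta(a;p)=\prod_{j\ge 0}(1-ap^j)(1-p^{j+1}/a)$. For an integer $k$ the $q,p$-shifted factorial is $(a;q,p)_k=\prod_{j=0}^{k-1}\theta(aq^j;p)$ if $k\ge 0$ (empty product $=1$), and $(a;q,p)_{k}=\big(\prod_{j=k}^{-1}\theta(aq^{j};p)\big)^{-1}$ if $k<0$. Write $(a_1,\dots,a_m;q,p)_k=(a_1;q,p)_k\cdots(a_m;q,p)_k$. For an $n$-tuple $\boldsymbol k=(k_1,\dots,k_n)$, $|\boldsymbol k|=k_1+\cdots+k_n$. All parameters are nonzero and generic in the sense that no denominators in the formula vanish. *)

(* Defs.v *)
(* The complex numbers are R[i] for R : realType. *)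
From HB Require Import structures.
From mathcomp Require Export all_boot all_order all_algebra.
From mathcomp Require Export complex.
From mathcomp Require Export classical_sets reals topology normedtype sequences.
Export Order.TTheory GRing.Theory Num.Theory numFieldNormedType.Exports.

Set Implicit Arguments.
Unset Strict Implicit.
Unset Printing Implicit Defensive.

Local Open Scope ring_scope.

(* theta p z is usually written θ(z; p). The partial products are viewed in
   R[i]^o because that is where the library puts the norm topology. *)
Definition theta (R : realType) (p z : R[i]) : R[i] :=
  limn (fun m : nat =>
    \prod_(0 <= j < m) ((1 - z * p ^+ j) * (1 - p ^+ j.+1 / z)) : R[i]^o).

(* sfac q p z k is usually written (z; q, p)_k. Since Negz m = - (m + 1), the
   product over k <= j <= -1 is the product over j = - (i + 1), 0 <= i <= m. *)
Definition sfac (R : realType) (q p z : R[i]) (k : int) : R[i] :=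
  match k with
  | Posz m => \prod_(0 <= j < m) theta p (z * q ^+ j)
  | Negz m => (\prod_(0 <= i < m.+1) theta p (z * q ^- i.+1))^-1
  end.

Definition sfacs (R : realType) (q p : R[i]) (zs : seq R[i]) (k : int) : R[i] :=
  \prod_(z <- zs) sfac q p z k.

Definition msum (n : nat) (k : 'I_n -> nat) : nat := (\sum_(r < n) k r)%N.

(* Main.v *)
Require Import Defs.
From mathcomp Require Import boolp classical_sets ring zify.
From mathcomp Require Import fintype finset bigop.

(** The theorem is one case of an identity between sums over all subsets of a finite set of
    nodes. Attach to the box [0 <= k r <= N r] the nodes [a * x r * q ^+ j.+1] for [j < N r],
    which form one geometric string for each [r]. A sum over subsets [S] of nodes with weight
    $\prod_{i\in S, j\notin S}\theta(U_i/(qU_j))/\theta(U_i/U_j)$ only sees the sets that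
    are initial segments of every string, since otherwise some [U i] in [S] equals [q * U j]
    with [j] outside [S], and $\theta(1)=0$. Recording the lengths of the segments turns the
    sum over subsets into the sum over the box ([sum_segments], [swt_segment]), and products
    of theta functions along a string telescope to the factors of the theorem
    ([lterm_segment], [rterm_segment]).

    For arbitrary nodes the transformation ([subset_transformation]) follows the pattern of
    the Bailey transform. If [M] and [C] are inverse matrices, [M b = b'] and [a C = a'], then
    $\sum ab=\sum a'b'$. Here the matrices are indexed by subsets, and the three facts that
    are needed, namely that [M] and [C] are inverse ([kerMC]) and the two summations
    ([kerM_b], [kerC_a]), are instances of a single one: an elliptic Jackson sum over the
    subsets of [Y] ([jackson_sum]).

    The Jackson sum is proved by interpolation and induction on [#|Y|]. With the odd function
    [br] written additively and [e + f = s] fixed, the functions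
    $e\mapsto[e-x][s-e-x]$ all lie in a two-dimensional space, by the three-term relation. So
    sums of products of [n] of them behave like polynomials of degree [n] and vanish as soon as
    they do at [n.+1] points ([span_vanish]). At [e = 0] only the empty set contributes, and
    at [e = u i] only the sets that contain [i], which gives the Jackson sum of [Y :\ i].

    The three-term relation ([thk_plucker]) comes from the Jacobi triple product. Multiplying
    two triple products and separating indices by parity writes $\theta(xy)\theta(x/y)$ as
    $\alpha(x)\beta(y)-\gamma(x)\delta(y)$. A kernel of rank two has vanishing minors of
    order three, and for an antisymmetric kernel these minors contain the Pluecker relation.

    The proof for subsets divides by theta functions that do not occur in the theorem. Replacing
    [x r] by [t * x r] leaves every ratio [x r / x s] unchanged and makes all of these
    divisors nonzero for [t] close to but different from [1], because zeros of theta are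
    isolated. Both sides are continuous at [t = 1], and the theorem is the limit. *)

Set Implicit Arguments.
Unset Strict Implicit.
Unset Printing Implicit Defensive.
Local Open Scope ring_scope.

(** * Infinite products with geometrically small factors *)

Section CompleteField.
Local Open Scope classical_set_scope.
Variable K : numFieldType.
Implicit Types (v w u : nat -> K) (r B l z p : K).

(** Completeness, tested on sequences whose increments decay geometrically. All limits
    below are of this kind, and this form passes easily from the real to the complex numbers. *)
Definition geometrically_complete := forall v B r,
  0 <= r -> r < 1 -> (forall m, `|v m.+1 - v m| <= B * r ^+ m) ->
  exists l, v @ \oo --> l.

Lemma cvgn_uniq v l l' : v @ \oo --> l -> v @ \oo --> l' -> l = l'.
Proof. exact: cvg_unique. Qed.
Arguments cvgn_uniq {v l l'}.

Lemma cvgn_dist_le v l a b J : v @ \oo --> l ->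
  (forall m, (J <= m)%N -> `|v m - a| <= b) -> `|l - a| <= b.
Proof.
move=> vl vb.
have b0 : 0 <= b by apply: le_trans (vb J _).
rewrite real_leNgt ?ger0_real //; apply/negP => lt.
have e0 : 0 < `|l - a| - b by rewrite subr_gt0.
have /cvgrPdist_lt/(_ _ e0) [J' _ H] := vl.
have := H (maxn J J') (leq_maxr _ _); rewrite /= ltrBrDr => H1.
have := le_lt_trans (lerD (lexx _) (vb (maxn J J') (leq_maxl _ _))) H1.
by move=> /(le_lt_trans (ler_normD _ _)); rewrite addrA subrK ltxx.
Qed.
Arguments cvgn_dist_le {v l a b} J.

Lemma cvgn_dominated v w l : w @ \oo --> 0 -> (forall m, `|v m - l| <= w m) ->
  v @ \oo --> l.
Proof.
move=> w0 vw; apply/cvgrPdist_lt => e e0.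
have /cvgrPdist_lt/(_ _ e0) := w0; apply: filterS => m; rewrite sub0r normrN.
rewrite distrC; apply: le_lt_trans; apply: le_trans (vw m) _.
by rewrite ger0_norm // (le_trans _ (vw m)).
Qed.
Arguments cvgn_dominated {v w l}.

Lemma half2 : 2^-1 + 2^-1 = 1 :> K.
Proof. by have := splitr (1 : K); rewrite div1r => <-. Qed.

Hypothesis K_complete : geometrically_complete.

(** The limit exists by completeness, and multiplication by [r] fixes it. *)
Lemma cvgn_exp r : 0 <= r -> r < 1 -> (fun m => r ^+ m) @ \oo --> (0 : K).
Proof.
move=> r0 r1.
have [m|l vl] := @K_complete (fun m => r ^+ m) (1 - r) r r0 r1.
  by rewrite exprS -{2}[r ^+ m]mul1r -mulrBl normrM distrC !ger0_norm ?exprn_ge0 ?subr_ge0 // ltW.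
suff -> : (0 : K) = l by [].
have : (fun m => r * r ^+ m) @ \oo --> r * l by apply: cvgMr.
have -> : (fun m => r * r ^+ m) = (fun m => r ^+ (m + 1)%N).
  by apply/funext => m; rewrite addn1 exprS.
move=> h1; have h2 : (fun m => r ^+ (m + 1)%N) @ \oo --> l.
  exact: cvg_comp (cvg_addnr 1) vl.
have /esym/eqP := cvgn_uniq h1 h2.
by rewrite -subr_eq0 -{1}[l]mul1r -mulrBl mulf_eq0 subr_eq0 (gt_eqF r1) /= => /eqP.
Qed.

Lemma sum_geom_le r a m : 0 <= r -> r < 1 ->
  \sum_(a <= j < a + m) r ^+ j <= r ^+ a / (1 - r).
Proof.
move=> r0 r1; have r1' : 0 < 1 - r by rewrite subr_gt0.
rewrite ler_pdivlMr //; have -> : (\sum_(a <= j < a + m) r ^+ j) * (1 - r) = r ^+ a - r ^+ (a + m).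
  elim: m => [|m IH]; first by rewrite addn0 big_geq // mul0r subrr.
  by rewrite addnS big_nat_recr ?leq_addr //= mulrDl IH exprS; ring.
by rewrite lerBlDr lerDl exprn_ge0.
Qed.

Lemma geometric_limit_dist v l B r : 0 <= B -> 0 <= r -> r < 1 ->
  (forall m, `|v m.+1 - v m| <= B * r ^+ m) -> v @ \oo --> l ->
  forall m, `|v m - l| <= B / (1 - r) * r ^+ m.
Proof.
move=> B0 r0 r1 vB vl m; rewrite distrC; apply: (cvgn_dist_le m vl) => k /subnKC <-.
set d := (k - m)%N.
have : `|v (m + d)%N - v m| <= B * \sum_(m <= j < m + d) r ^+ j.
  elim: d => [|d IH]; first by rewrite addn0 subrr normr0 big_geq // mulr0.
  rewrite addnS big_nat_recr ?leq_addr //= mulrDr.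
  have -> : v (m + d).+1 - v m = (v (m + d)%N - v m) + (v (m + d).+1 - v (m + d)%N) by ring.
  exact: le_trans (ler_normD _ _) (lerD IH (vB _)).
move=> /le_trans; apply; rewrite -mulrA; apply: ler_wpM2l => //.
by rewrite [_^-1 * _]mulrC sum_geom_le.
Qed.

Lemma geom_tail_small B r : 0 <= B -> 0 <= r -> r < 1 ->
  exists J, B * (r ^+ J / (1 - r)) <= 2^-1.
Proof.
move=> B0 r0 r1.
have : (fun m => B / (1 - r) * r ^+ m) @ \oo --> (B / (1 - r) * 0 : K).
  by apply: cvgMr; exact: cvgn_exp.
rewrite mulr0 => /cvgrPdist_lt /(_ 2^-1).
rewrite invr_gt0 ltr0n => /(_ isT) [J _ /(_ J (leqnn _))] /=.
rewrite sub0r normrN ger0_norm => [/ltW h|]; last first.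
  by rewrite !mulr_ge0 ?exprn_ge0 // invr_ge0 subr_ge0 ltW.
by exists J; rewrite [_ / _]mulrC mulrA.
Qed.

(** By induction on the number of factors, the product times one minus the sum stays at most [1]. *)
Lemma prod1D_le2 (x : nat -> K) a m : (forall j, 0 <= x j) ->
  \sum_(a <= j < a + m) x j <= 2^-1 -> \prod_(a <= j < a + m) (1 + x j) <= 2.
Proof.
move=> x0 xs.
have s0 k : 0 <= \sum_(a <= j < a + k) x j by apply: sumr_ge0.
have H k : \prod_(a <= j < a + k) (1 + x j) * (1 - \sum_(a <= j < a + k) x j) <= 1.
  elim: k => [|k IH]; first by rewrite addn0 !big_geq // subr0 mulr1.
  rewrite addnS !big_nat_recr ?leq_addr //=; apply: le_trans IH.
  rewrite -mulrA ler_wpM2l //.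
    by apply: prodr_ge0 => i _; rewrite addr_ge0.
  rewrite -subr_ge0; set S := \sum_(_ <= _ < _) _.
  have -> : 1 - S - (1 + x (a + k)%N) * (1 - (S + x (a + k)%N)) = x (a + k)%N * (S + x (a + k)%N) by ring.
  by rewrite mulr_ge0 ?addr_ge0 // s0.
have h2 : 2^-1 <= 1 - \sum_(a <= j < a + m) x j.
  by rewrite lerBrDr -[leRHS]half2 lerD2l.
have P0 : 0 <= \prod_(a <= j < a + m) (1 + x j) by apply: prodr_ge0 => i _; rewrite addr_ge0.
have := le_trans (ler_wpM2l P0 h2) (H m).
by rewrite ler_pdivrMr ?ltr0n // mul1r.
Qed.

(** The norm of the product is at least one minus the sum of the norms. *)
Lemma prod1D_ge (u : nat -> K) a m : \sum_(a <= j < a + m) `|u j| <= 2^-1 ->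
  2^-1 <= `|\prod_(a <= j < a + m) (1 + u j)|.
Proof.
move=> xs.
have H k : (k <= m)%N -> 1 - \sum_(a <= j < a + k) `|u j| <= `|\prod_(a <= j < a + k) (1 + u j)|.
  elim: k => [|k IH] km; first by rewrite addn0 !big_geq // subr0 normr1.
  have {}IH := IH (ltnW km).
  rewrite addnS !big_nat_recr ?leq_addr //= normrM.
  have S1 : \sum_(a <= j < a + k) `|u j| + `|u (a + k)%N| <= 2^-1.
    apply: le_trans xs; rewrite -(subnKC km) addnA [(a + k.+1)%N]addnS.
    rewrite [leRHS](big_cat_nat (n := (a + k).+1)) /= ?leq_addr ?(leqW (leq_addr k a)) //.
    by rewrite big_nat_recr ?leq_addr //= lerDl sumr_ge0.
  set S := \sum_(_ <= _ < _) _ in IH S1 *; set x := `|u _| in S1 *.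
  have S0 : 0 <= S by apply: sumr_ge0.
  have x0 : 0 <= x by rewrite /x.
  have h1 : (2^-1 : K) <= 1 by rewrite invf_le1 ?ler1n.
  have x1 : x <= 1 by apply: le_trans h1; apply: le_trans S1; rewrite lerDr.
  have S1' : S <= 1 by apply: le_trans h1; apply: le_trans S1; rewrite lerDl.
  have hx : 1 - x <= `|1 + u (a + k)%N|.
    by have := lerB_normD (1 : K) (u (a + k)%N); rewrite normr1.
  apply: (@le_trans _ _ ((1 - S) * (1 - x))).
    rewrite -subr_ge0 (_ : _ - _ = S * x); last by ring.
    exact: mulr_ge0.
  by apply: ler_pM => //; rewrite subr_ge0.
have := H m (leqnn _); apply: le_trans.
by rewrite lerBrDr -[leRHS]half2 lerD2l.
Qed.

(** Beyond some index the terms sum to at most [1/2], so the later factors together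
    contribute at most a factor [2]. The bound depends only on [B] and [r]. *)
Lemma prod1D_bounded B r : 0 <= B -> 0 <= r -> r < 1 -> exists2 M, 0 <= M &
  forall u, (forall j, `|u j| <= B * r ^+ j) ->
  forall m, `|\prod_(0 <= j < m) (1 + u j)| <= M.
Proof.
move=> B0 r0 r1; have [J HJ] := geom_tail_small B0 r0 r1.
pose x j := B * r ^+ j; have x0 j : 0 <= x j by rewrite mulr_ge0 ?exprn_ge0.
have P0 a b : 0 <= \prod_(a <= j < b) (1 + x j) by apply: prodr_ge0 => j _; rewrite addr_ge0.
exists (\prod_(0 <= j < J) (1 + x j) * 2); first by rewrite mulr_ge0.
move=> u uB m.
apply: (@le_trans _ _ (\prod_(0 <= j < m) (1 + x j))).
  rewrite normr_prod; apply: ler_prod => j _; rewrite normr_ge0 /=.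
  by apply: le_trans (ler_normD _ _) _; rewrite normr1 lerD2l.
apply: (@le_trans _ _ (\prod_(0 <= j < J + m) (1 + x j))).
  rewrite [leRHS](big_cat_nat (n := m)) ?leq_addl //= ler_peMr //.
  have : \prod_(m <= j < J + m) 1 <= \prod_(m <= j < J + m) (1 + x j).
    by apply: ler_prod => j _; rewrite ler01 /= lerDl x0.
  by rewrite big1.
rewrite (big_cat_nat (n := J)) ?leq_addr //= ler_wpM2l // prod1D_le2 //.
rewrite -mulr_sumr; apply: le_trans HJ; exact: ler_wpM2l (sum_geom_le _ _ r0 r1).
Qed.

(** The constant [M] is the same for all [u] under the bound: this uniformity is what
    makes theta continuous. *)
Lemma prod1D_cvg B r : 0 <= B -> 0 <= r -> r < 1 -> exists2 M, 0 <= M &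
  forall u, (forall j, `|u j| <= B * r ^+ j) ->
  exists l, (fun m => \prod_(0 <= j < m) (1 + u j)) @ \oo --> l /\
   forall m, `|\prod_(0 <= j < m) (1 + u j) - l| <= M * r ^+ m.
Proof.
move=> B0 r0 r1; have [M M0 HM] := prod1D_bounded B0 r0 r1.
exists (M * B / (1 - r)); first by rewrite !mulr_ge0 // invr_ge0 subr_ge0 ltW.
move=> u uB.
have H m : `|\prod_(0 <= j < m.+1) (1 + u j) - \prod_(0 <= j < m) (1 + u j)| <= M * B * r ^+ m.
  rewrite big_nat_recr //= mulrDr mulr1 addrAC subrr add0r normrM -mulrA.
  by apply: ler_pM => //; exact: HM.
have [l vl] := @K_complete _ _ _ r0 r1 H; exists l; split=> // m.
by apply: geometric_limit_dist vl m => //; rewrite mulr_ge0.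
Qed.

(** Past some index the tails have norm at least [1/2]. *)
Lemma prod1D_neq0 B r u l : 0 <= B -> 0 <= r -> r < 1 ->
  (forall j, `|u j| <= B * r ^+ j) -> (forall j, 1 + u j != 0) ->
  (fun m => \prod_(0 <= j < m) (1 + u j)) @ \oo --> l -> l != 0.
Proof.
move=> B0 r0 r1 uB u1 ul; have [J HJ] := geom_tail_small B0 r0 r1.
pose b := `|\prod_(0 <= j < J) (1 + u j)| / 2.
have b0 : 0 < b by rewrite divr_gt0 ?normr_gt0 ?ltr0n // prodf_seq_neq0; apply/allP => j _; exact: u1.
apply/eqP => l0; have := ul; rewrite l0 => /cvgrPdist_lt /(_ _ b0) [J' _ H].
have := H (J + J')%N (leq_addl _ _); rewrite /= sub0r normrN.
rewrite (big_cat_nat (n := J)) ?leq_addr //= normrM => /lt_le_trans/(_ (lexx _)).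
rewrite ltr_pM2l; last by rewrite normr_gt0 prodf_seq_neq0; apply/allP => j _; exact: u1.
apply/negP; rewrite -real_leNgt ?normr_real ?realV ?realn //.
apply: prod1D_ge; apply: le_trans HJ.
apply: (@le_trans _ _ (\sum_(J <= j < J + J') B * r ^+ j)); first exact: ler_sum.
by rewrite -mulr_sumr ler_wpM2l // sum_geom_le.
Qed.

End CompleteField.

Arguments cvgn_uniq {K v l l'}.
Arguments cvgn_dist_le {K v l a b} J.
Arguments cvgn_dominated {K v w l}.

(** * Completeness of the complex numbers *)

Section ComplexNumbers.
Local Open Scope classical_set_scope.

(** The increments form a series dominated by a geometric one. *)
Lemma real_geometric_cvg (R : realType) (u : nat -> R) (B r : R) : 0 <= r -> r < 1 ->
  (forall m, `|u m.+1 - u m| <= B * r ^+ m) -> exists l : R, u @ \oo --> l.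
Proof.
move=> r0 r1 uB.
have c : cvgn [normed series (telescope u)].
  apply: (series_le_cvg (v_ := geometric B r)) => [n|n|n|].
  - exact: normr_ge0.
  - exact: le_trans (uB n).
  - exact: uB.
  by apply: is_cvg_geometric_series; rewrite ger0_norm.
have /cvg_ex[l ul] := normed_cvg c.
exists (u 0%N + l).
have uE : u = fun n => u 0%N + series (telescope u) n.
  by apply/funext => n; exact: eq_sum_telescope.
have : (fun n => u 0%N + series (telescope u) n) @ \oo --> u 0%N + l.
  by apply: cvgD => //; exact: cvg_cst.
by rewrite -uE.
Qed.

Lemma complex_cvg (R : realType) (v : nat -> R[i]) (x y : R) :
  (fun n => complex.Re (v n)) @ \oo --> x -> (fun n => complex.Im (v n)) @ \oo --> y ->
  (v : nat -> R[i]^o) @ \oo --> (Complex x y : R[i]^o).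
Proof.
move=> vx vy; apply/cvgrPdist_lt => e e0.
have eE : e = (complex.Re e)%:C%C by rewrite RRe_real // gtr0_real.
have e0' : 0 < complex.Re e / 2 by rewrite divr_gt0 // -ltcR -eE.
move/cvgrPdist_lt/(_ _ e0') : vx => vx; move/cvgrPdist_lt/(_ _ e0') : vy => vy.
apply: filterS2 vx vy => n xn yn.
rewrite eE; set z := _ - _.
have -> : z = (complex.Re z)%:C%C + 'i%C * (complex.Im z)%:C%C by exact: complexE.
apply: le_lt_trans (ler_normD _ _) _; rewrite normrM.
have -> : `|'i%C : R[i]| = 1 by rewrite normc_def /= expr0n expr1n add0r sqrtr1.
have nC (t : R) : `|t%:C%C| = (`|t|)%:C%C by rewrite normc_def /= expr0n addr0 sqrtr_sqr.
rewrite mul1r !nC -rmorphD /= ltcR [ltRHS]splitr.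
by apply: ltrD; rewrite /z /=; case: (v n) xn yn.
Qed.

Lemma complex_complete (R : realType) : geometrically_complete R[i].
Proof.
move=> v B r r0 r1 vB.
have rE : r = (complex.Re r)%:C%C by rewrite RRe_real // ger0_real.
have r0' : 0 <= complex.Re r by rewrite -lecR -rE.
have r1' : complex.Re r < 1 by rewrite -ltcR -rE.
have B0 : 0 <= B by have := vB 0%N; rewrite expr0 mulr1; exact: le_trans (normr_ge0 _).
have BE : B = (complex.Re B)%:C%C by rewrite RRe_real // ger0_real.
have nE (z : R[i]) (b : R) : `|z| <= b%:C%C -> `|complex.Re z| <= b /\ `|complex.Im z| <= b.
  rewrite normc_def lecR => zb; split; apply: le_trans zb; rewrite -sqrtr_sqr ler_wsqrtr //.
    by rewrite lerDl sqr_ge0.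
  by rewrite lerDr sqr_ge0.
have H m : `|complex.Re (v m.+1) - complex.Re (v m)| <= complex.Re B * complex.Re r ^+ m /\
   `|complex.Im (v m.+1) - complex.Im (v m)| <= complex.Re B * complex.Re r ^+ m.
  have := vB m; rewrite rE BE -rmorphXn -rmorphM /= => /nE.
  by case: (v m.+1) => ? ?; case: (v m).
have [x vx] := real_geometric_cvg r0' r1' (fun m => proj1 (H m)).
have [y vy] := real_geometric_cvg r0' r1' (fun m => proj2 (H m)).
exists (Complex x y); exact: complex_cvg.
Qed.

End ComplexNumbers.

(** * Theta functions over a complete field *)

Section ThetaField.
Local Open Scope classical_set_scope.
Variable K : numFieldType.
Hypothesis K_complete : geometrically_complete K.
Variable p : K.
Hypothesis p1 : `|p| < 1.

Definition thetan (z : K) (m : nat) : K :=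
  \prod_(0 <= j < m) ((1 - z * p ^+ j) * (1 - p ^+ j.+1 / z)).
Definition th (z : K) : K := limn (thetan z : nat -> K).

Let r0 : 0 <= `|p| := normr_ge0 p.

Lemma theta_factor_bound B z j : `|z| <= B -> `|z^-1| <= B ->
  `|(1 - z * p ^+ j) * (1 - p ^+ j.+1 / z) - 1| <= (B + B + 1) * `|p| ^+ j.
Proof.
move=> zB zVB.
have -> : (1 - z * p ^+ j) * (1 - p ^+ j.+1 / z) - 1 =
    - (z * p ^+ j) - (z^-1 * p * p ^+ j) + z * z^-1 * p ^+ j.+1 * p ^+ j.
  by rewrite exprS; ring.
have pj : `|p ^+ j.+1| <= 1 by rewrite normrX exprn_ile1 // ltW.
have zz : `|z * z^-1| <= 1.
  by have [->|/mulfV->] := eqVneq z 0; rewrite ?mul0r ?normr0 ?normr1.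
have h (w C : K) : `|w| <= C -> `|w * p ^+ j| <= C * `|p| ^+ j.
  by move=> wC; rewrite normrM normrX ler_wpM2r // exprn_ge0.
apply: le_trans (ler_normD _ _) _; rewrite mulrDl lerD //.
  apply: le_trans (ler_normD _ _) _; rewrite !normrN mulrDl lerD ?h //.
  by rewrite normrM -[leRHS]mulr1 ler_pM // ltW.
by apply: h; rewrite normrM -[leRHS]mulr1 ler_pM.
Qed.

Lemma thetanE z : thetan z = fun m =>
  \prod_(0 <= j < m) (1 + ((1 - z * p ^+ j) * (1 - p ^+ j.+1 / z) - 1)).
Proof.
by apply/funext => m; apply: eq_bigr => j _; rewrite [1 + (_ - 1)]addrC subrK.
Qed.

(** Locally uniform convergence on the punctured plane: [z] and its inverse are both
    bounded, as the factors involve both. *)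
Lemma thetan_uniform (B : K) : 0 <= B -> exists2 M, 0 <= M &
  forall z, `|z| <= B -> `|z^-1| <= B ->
  thetan z @ \oo --> th z /\ forall m, `|thetan z m - th z| <= M * `|p| ^+ m.
Proof.
move=> B0; have BB : 0 <= B + B + 1 by rewrite !addr_ge0.
have [M M0 HM] := prod1D_cvg K_complete BB r0 p1; exists M => // z zB zVB.
have [j|l []] := HM (fun j => (1 - z * p ^+ j) * (1 - p ^+ j.+1 / z) - 1).
  exact: theta_factor_bound.
rewrite -/(thetan _ _) -(thetanE z) => ul Hl.
have thE : th z = l.
  by rewrite /th; apply: (cvg_lim (@norm_hausdorff _ _)).
by rewrite thE; split=> // m; move: (Hl m); rewrite thetanE.
Qed.

Lemma thetan_cvg z : thetan z @ \oo --> th z.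
Proof.
have [//|M _ /(_ z)] := @thetan_uniform (`|z| + `|z^-1|); first by rewrite addr_ge0.
by rewrite lerDl lerDr !normr_ge0 => /(_ isT isT) [].
Qed.

Arguments thetan_cvg z : clear implicits.

Lemma pexp_cvg0 : (fun m => p ^+ m) @ \oo --> (0 : K).
Proof.
apply: (@cvgn_dominated _ _ (fun m => `|p| ^+ m)); first exact: cvgn_exp.
by move=> m; rewrite subr0 normrX.
Qed.

Lemma cvg1Bpexp (z : K) : (fun m => 1 - p ^+ m * z) @ \oo --> (1 : K).
Proof.
rewrite -[X in _ --> X]subr0 -[X in _ - X](mul0r z).
apply: cvgB; first exact: cvg_cst.
by apply: cvgMl; exact: pexp_cvg0.
Qed.

Lemma th1 : th 1 = 0.
Proof.
apply: cvgn_uniq (thetan_cvg 1) _; apply: (@cvgn_dominated _ _ (fun m => `|p| ^+ m)).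
  exact: cvgn_exp.
move=> [|m]; rewrite subr0 /thetan; first by rewrite big_geq // normr1.
by rewrite big_nat_recl // expr0 mulr1 subrr !mul0r normr0 exprn_ge0.
Qed.

(** The partial products at [z] and at its inverse differ only by their end factors, which
    tend to [1]. *)
Lemma th_inv z : z != 0 -> th z^-1 = - th z / z.
Proof.
move=> z0; have [->|z1] := eqVneq z 1; first by rewrite invr1 th1 oppr0 mul0r.
have H m : (1 - z) * thetan z^-1 m * (1 - p ^+ m * z^-1) = (1 - z^-1) * thetan z m * (1 - p ^+ m * z).
  elim: m => [|m IH]; first by rewrite /thetan !big_geq // expr0 !mulr1 !mul1r mulrC.
  have tS w : thetan w m.+1 = thetan w m * ((1 - w * p ^+ m) * (1 - p ^+ m.+1 / w)).
    by rewrite /thetan big_nat_recr.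
  rewrite !tS invrK; move: IH; set a := thetan _ _; set b := thetan _ _ => IH.
  have -> : (1 - z) * (a * ((1 - z^-1 * p ^+ m) * (1 - p ^+ m.+1 * z))) * (1 - p ^+ m.+1 * z^-1)
     = ((1 - z) * a * (1 - p ^+ m * z^-1)) * ((1 - p ^+ m.+1 * z) * (1 - p ^+ m.+1 * z^-1)) by ring.
  by rewrite IH; ring.
have h1 : (fun m => (1 - z) * thetan z^-1 m * (1 - p ^+ m * z^-1)) @ \oo --> (1 - z) * th z^-1 * 1.
  by apply: cvgM; [apply: cvgMr; exact: thetan_cvg | exact: cvg1Bpexp].
have h2 : (fun m => (1 - z^-1) * thetan z m * (1 - p ^+ m * z)) @ \oo --> (1 - z^-1) * th z * 1.
  by apply: cvgM; [apply: cvgMr; exact: thetan_cvg | exact: cvg1Bpexp].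
have := cvgn_uniq h1; rewrite (funext H) => /(_ _ h2); rewrite !mulr1 => E.
have z1' : 1 - z != 0 by rewrite subr_eq0 eq_sym.
by apply: (mulfI z1'); rewrite E; field.
Qed.

(** Passing from [z] to [p * z] shifts the factors by one place, so again only the end
    factors of the partial products change. *)
Lemma th_period z : p != 0 -> z != 0 -> th (p * z) = - th z / z.
Proof.
move=> p0 z0; have [->|z1] := eqVneq z 1.
  rewrite mulr1 th1 oppr0 mul0r; apply: cvgn_uniq (thetan_cvg p) _.
  apply: (@cvgn_dominated _ _ (fun m => `|p| ^+ m)); first exact: cvgn_exp.
  move=> [|m]; rewrite subr0 /thetan; first by rewrite big_geq // normr1.
  by rewrite big_nat_recl // expr1 divff // subrr mulr0 !mul0r normr0 exprn_ge0.
have H m : (1 - z) * thetan (p * z) m * (1 - p ^+ m * z^-1) = (1 - z^-1) * thetan z m * (1 - p ^+ m * z).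
  elim: m => [|m IH]; first by rewrite /thetan !big_geq // expr0 !mulr1 !mul1r mulrC.
  have tS w : thetan w m.+1 = thetan w m * ((1 - w * p ^+ m) * (1 - p ^+ m.+1 / w)).
    by rewrite /thetan big_nat_recr.
  rewrite !tS invfM exprS.
  have -> : p * p ^+ m * (p^-1 * z^-1) = p ^+ m * z^-1 by field; rewrite z0.
  move: IH; set a := thetan _ _; set b := thetan _ _ => IH.
  have -> : (1 - z) * (a * ((1 - p * z * p ^+ m) * (1 - p ^+ m * z^-1))) * (1 - p * p ^+ m * z^-1)
     = ((1 - z) * a * (1 - p ^+ m * z^-1)) * ((1 - p * p ^+ m * z) * (1 - p * p ^+ m * z^-1)) by ring.
  by rewrite IH; ring.
have h1 : (fun m => (1 - z) * thetan (p * z) m * (1 - p ^+ m * z^-1)) @ \oo --> (1 - z) * th (p * z) * 1.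
  by apply: cvgM; [apply: cvgMr; exact: thetan_cvg | exact: cvg1Bpexp].
have h2 : (fun m => (1 - z^-1) * thetan z m * (1 - p ^+ m * z)) @ \oo --> (1 - z^-1) * th z * 1.
  by apply: cvgM; [apply: cvgMr; exact: thetan_cvg | exact: cvg1Bpexp].
have := cvgn_uniq h1; rewrite (funext H) => /(_ _ h2); rewrite !mulr1 => E.
have z1' : 1 - z != 0 by rewrite subr_eq0 eq_sym.
by apply: (mulfI z1'); rewrite E; field.
Qed.

Lemma th_period_eq0 z j : p != 0 -> z != 0 -> (th (p ^+ j * z) == 0) = (th z == 0).
Proof.
move=> p0 z0; elim: j => [|j IH]; first by rewrite mul1r.
have w0 : p ^+ j * z != 0 by rewrite mulf_neq0 ?expf_neq0.
by rewrite exprS -mulrA th_period // mulf_eq0 invr_eq0 (negPf w0) orbF oppr_eq0.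
Qed.

(** A convergent product of nonzero factors is nonzero, so one of the factors vanishes. *)
Lemma th_eq0 z : z != 0 -> th z = 0 -> exists j, z * p ^+ j = 1 \/ z = p ^+ j.+1.
Proof.
move=> z0 thz; apply: contrapT => /forallNP nz.
have B0 : 0 <= `|z| + `|z^-1| by rewrite addr_ge0.
have : th z != 0; last by rewrite thz eqxx.
pose u j := (1 - z * p ^+ j) * (1 - p ^+ j.+1 / z) - 1.
apply: (@prod1D_neq0 _ K_complete (`|z| + `|z^-1| + (`|z| + `|z^-1|) + 1) `|p| u) => //.
- by rewrite !addr_ge0.
- by move=> j; apply: theta_factor_bound; rewrite ?lerDl ?lerDr.
- move=> j; rewrite [1 + u j]addrC subrK mulf_neq0 // subr_eq0.
    by apply/eqP => /esym h; case: (nz j); left.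
  by apply/eqP => /(congr1 ( *%R^~ z)); rewrite mul1r divfK // => h; case: (nz j); right.
- by rewrite -thetanE; exact: thetan_cvg.
Qed.

Lemma thetan_continuous (T : Type) (F : set_system T) (FF : Filter F) (f : T -> K)
    (z : K) m : z != 0 -> f @ F --> z -> (fun t => thetan (f t) m) @ F --> thetan z m.
Proof.
move=> z0 fz; elim: m => [|m IH].
  have -> : (fun w => thetan (f w) 0) = fun=> thetan z 0.
    by apply/funext => w; rewrite /thetan !big_geq.
  exact: cvg_cst.
have -> : (fun w => thetan (f w) m.+1) =
    fun w => thetan (f w) m * ((1 - f w * p ^+ m) * (1 - p ^+ m.+1 / f w)).
  by apply/funext => w; rewrite /thetan big_nat_recr.
have -> : thetan z m.+1 = thetan z m * ((1 - z * p ^+ m) * (1 - p ^+ m.+1 / z)).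
  by rewrite /thetan big_nat_recr.
apply: cvgM => //; apply: cvgM; (apply: cvgB; first exact: cvg_cst).
  exact: cvgMl.
by apply: cvgMr; apply: cvgV.
Qed.

Lemma th_continuous (T : Type) (F : set_system T) (FF : Filter F) (f : T -> K)
    (z : K) : z != 0 -> f @ F --> z -> (fun t => th (f t)) @ F --> th z.
Proof.
move=> z0 fz; pose B := `|z| + `|z^-1| + 1.
have [M M0 HM] := @thetan_uniform B ltac:(by rewrite !addr_ge0).
(* Near z the partial products converge uniformly, so one of them settles the question. *)
have nearB : \forall t \near F, `|f t| <= B /\ `|(f t)^-1| <= B.
  have near1 : \forall t \near F, `|z - f t| <= 1.
    by have /cvgrPdist_le/(_ 1 ltr01) := fz.
  have near2 : \forall t \near F, `|z^-1 - (f t)^-1| <= 1.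
    by have /cvgrPdist_le/(_ 1 ltr01) : (fun t => (f t)^-1) @ F --> z^-1 by exact: cvgV.
  have h (x y : K) : `|x - y| <= 1 -> `|y| <= `|x| + 1.
    move=> xy; rewrite -lerBlDl; apply: le_trans xy; rewrite distrC.
    by apply: le_trans (lerB_dist _ _).
  apply: filterS2 near1 near2 => w /h wz /h wz'; split.
    by apply: le_trans wz _; rewrite lerD2r lerDl.
  by apply: le_trans wz' _; rewrite lerD2r lerDr.
apply/cvgrPdist_lt => e e0.
have e3 : 0 < e / 3 by rewrite divr_gt0.
have [m Hm] : exists m, M * `|p| ^+ m < e / 3.
  have : (fun m => M * `|p| ^+ m) @ \oo --> (M * 0 : K).
    by apply: cvgMr; exact: cvgn_exp.
  rewrite mulr0 => /cvgrPdist_lt/(_ _ e3) [m _ /(_ m (leqnn m))] /=.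
  by rewrite sub0r normrN ger0_norm ?mulr_ge0 ?exprn_ge0 // => h; exists m.
have nearz : \forall t \near F, `|thetan z m - thetan (f t) m| < e / 3.
  by have /cvgrPdist_lt/(_ _ e3) := @thetan_continuous _ _ FF f z m z0 fz.
have [zB zVB] : `|z| <= B /\ `|z^-1| <= B.
  by split; rewrite /B; [|rewrite [X in X + 1]addrC]; rewrite -addrA lerDl addr_ge0.
apply: filterS2 nearB nearz => t [wB wVB] wz.
set w := f t in wB wVB wz *.
have -> : th z - th w = (th z - thetan z m) + (thetan z m - thetan w m) + (thetan w m - th w) by ring.
have -> : e = e / 3 + e / 3 + e / 3.
  have n3 : (3 : K) != 0 by rewrite pnatr_eq0.
  by apply: (mulIf n3); rewrite !mulrDl !divfK //; ring.
apply: le_lt_trans (ler_normD _ _) _; apply: ltrD.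
  apply: le_lt_trans (ler_normD _ _) _; apply: ltrD => //.
  by rewrite distrC; apply: le_lt_trans Hm; have [_] := HM z zB zVB.
by apply: le_lt_trans Hm; have [_] := HM w wB wVB.
Qed.

(** Quasi-periodicity moves any zero to [1], where the explicit zeros show isolation. *)
Lemma th_isolated (z : K) : z != 0 -> \forall w \near (1 : K)^', th (z * w) != 0.
Proof.
move=> z0; have [thz|thz] := eqVneq (th z) 0; last first.
  have c : (fun w => th (z * w)) @ (1 : K)^' --> th z.
    apply: th_continuous => //; rewrite -[X in _ --> X]mulr1.
    by apply: cvgMr; apply: cvg_within.
  have t0 : 0 < `|th z| by rewrite normr_gt0.
  have /cvgrPdist_lt/(_ _ t0) := c; apply: filterS => w; apply: contraTneq => ->.
  by rewrite subr0 ltxx.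
(* The zeros 1 / p^j and p^(j+1) other than 1 keep away from 1. *)
have near1 : \forall w \near (1 : K)^', th w != 0 /\ w != 0.
  have h (f : K -> K) : f @ (1 : K)^' --> (1 : K) -> \forall w \near (1 : K)^', `|p| < `|f w|.
    move=> f1; have q0 : 0 < 1 - `|p| by rewrite subr_gt0.
    have /cvgrPdist_lt/(_ _ q0) := f1; apply: filterS => w.
    rewrite ltrBrDr -ltrBrDl => /lt_le_trans; apply.
    by rewrite lerBlDl -{1}[1]normr1 -lerBlDr; exact: lerB_dist.
  have h1 : \forall w \near (1 : K)^', `|p| < `|w| by apply: (h id); exact: cvg_within.
  have h2 : \forall w \near (1 : K)^', `|p| < `|w^-1|.
    by apply: h; rewrite -{2}[1]invr1; apply: cvgV; [exact: oner_neq0|exact: cvg_within].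
  have h3 : \forall w \near (1 : K)^', w != 1 by exact: nbhs_dnbhs_neq.
  apply: filterS3 h1 h2 h3 => w w1 w2 w3.
  have w0 : w != 0 by rewrite -normr_gt0 (le_lt_trans _ w1).
  split=> //; apply/eqP => /(th_eq0 w0) [j [E|E]].
    case: j E => [|j E]; first by rewrite mulr1 => /eqP; rewrite (negPf w3).
    have E' : w^-1 = p ^+ j.+1 by rewrite -[LHS]mulr1 -E mulKf.
    by move: (lt_geF w2); rewrite E' normrX exprS ler_piMr // exprn_ile1 // ltW.
  by move: (lt_geF w1); rewrite E normrX exprS ler_piMr // exprn_ile1 // ltW.
case: (th_eq0 z0 thz) => j [E|E].
  have [p0|p0] := eqVneq p 0.
    case: j E => [|j]; last by rewrite p0 exprS mul0r mulr0 => /eqP; rewrite eq_sym oner_eq0.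
    by rewrite mulr1 => ->; apply: filterS near1 => w [w1 _]; rewrite mul1r.
  apply: filterS near1 => w [w1 w0].
  by rewrite -(@th_period_eq0 _ j) ?mulf_neq0 // mulrA [_ * z]mulrC E mul1r.
have p0 : p != 0 by apply: contraNneq z0 => p0; rewrite E p0 exprS mul0r.
by apply: filterS near1 => w [w1 w0]; rewrite E th_period_eq0.
Qed.

End ThetaField.
Arguments thetan_cvg {K} _ {p} _ z.

(** * The Jacobi triple product *)

Section GaussBinomial.
Variable F : fieldType.
Variable p : F.

(** The shifted factorial $(p;p)_n$. *)
Definition pfac (n : nat) : F := \prod_(0 <= j < n) (1 - p ^+ j.+1).

(** The Gaussian binomial coefficient. The Pascal rule makes sense for every [p], also
    when [pfac] vanishes. *)
Fixpoint gbin (n i : nat) : F :=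
  match n, i with
  | _, 0 => 1
  | 0, _.+1 => 0
  | n'.+1, i'.+1 => gbin n' i + p ^+ (n' - i') * gbin n' i'
  end.

Lemma gbin0 n : gbin n 0 = 1. Proof. by case: n. Qed.

Lemma gbin_small n i : (n < i)%N -> gbin n i = 0.
Proof.
elim: n i => [|n IH] [|i] //= ni.
by rewrite !IH ?mulr0 ?addr0 //; lia.
Qed.

Lemma pfacS n : pfac n.+1 = pfac n * (1 - p ^+ n.+1).
Proof. by rewrite /pfac big_nat_recr. Qed.

Lemma gbin_pfac n i : (i <= n)%N -> gbin n i * pfac i * pfac (n - i) = pfac n.
Proof.
elim: n i => [|n IH] [|i] //=.
- by rewrite /pfac big_geq // !mulr1.
- by rewrite subn0 /pfac big_geq // !mul1r.
move=> ni.
rewrite subSS !mulrDl; case: (ltnP i n) => [lt|ge]; last first.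
  have -> : i = n by lia.
  rewrite gbin_small // !mul0r add0r subnn expr0 mul1r pfacS.
  by have := IH n (leqnn n); rewrite subnn => {2}<-; ring.
have E1 := IH i.+1 lt; have E2 := IH i (ltnW lt).
have nE : (n - i = (n - i.+1).+1)%N by lia.
have -> : gbin n i.+1 * pfac i.+1 * pfac (n - i) = pfac n * (1 - p ^+ (n - i)).
  by rewrite {1}nE (pfacS (n - i.+1)) -nE -E1; ring.
have -> : p ^+ (n - i) * gbin n i * pfac i.+1 * pfac (n - i) = pfac n * (p ^+ (n - i) * (1 - p ^+ i.+1)).
  by rewrite pfacS -E2; ring.
by rewrite -mulrDr pfacS mulrBr mulr1 -exprD (_ : (n - i + i.+1 = n.+1)%N) ?addrA ?subrK //; lia.
Qed.

(** The q-binomial theorem, by induction with the Pascal rule. *)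
Lemma gbin_theorem n (w : F) :
  \prod_(0 <= j < n) (1 + w * p ^+ j) = \sum_(0 <= i < n.+1) gbin n i * p ^+ 'C(i, 2) * w ^+ i.
Proof.
elim: n => [|n IH]; first by rewrite big_geq // big_nat1 /= bin0n !mulr1.
rewrite big_nat_recr //= IH [RHS]big_nat_recl //=.
rewrite [X in _ = _ + X](eq_big_nat _ _ (F2 := fun i => gbin n i.+1 * p ^+ 'C(i.+1, 2) * w ^+ i.+1 +
   gbin n i * p ^+ 'C(i, 2) * w ^+ i * (w * p ^+ n))); last first.
  move=> i /andP[_ ilt]; rewrite !mulrDl binS bin1; congr (_ + _).
  have -> : p ^+ n = p ^+ (n - i) * p ^+ i by rewrite -exprD; congr (_ ^+ _); lia.
  by rewrite exprD exprSr; ring.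
rewrite big_split /= -mulr_suml mulrDr mulr1; rewrite addrA; congr (_ + _).
rewrite [in RHS]big_nat_recr //= [X in _ + (_ + X * _ * _)]gbin_small // !mul0r addr0.
by rewrite big_nat_recl //= gbin0.
Qed.

End GaussBinomial.

(** The binomial coefficient [n] over [2] for an integer [n]; the division is exact. *)
Definition tri (n : int) : int := (n * (n - 1) %/ 2)%Z.
(** The integers of absolute value at most [M]; locked because the sums over it are handled
    through membership. *)
Definition zbox (M : nat) : seq int :=
  locked [seq i%:Z - M%:Z | i <- iota 0 M.*2.+1].

Lemma tri2 n : 2 * tri n = n * (n - 1).
Proof.
rewrite /tri mulrC divzK //.
have [m [->| ->]] : exists m, n = 2 * m \/ n = 2 * m + 1.
- by exists (n %/ 2)%Z; lia.
- by rewrite -mulrA dvdz_mulr.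
- by rewrite addrK [_ * (2 * m)]mulrC -mulrA dvdz_mulr.
Qed.

Lemma bin2Z k : 2 * ('C(k, 2))%:Z = k%:Z * (k%:Z - 1).
Proof.
case: k => [|k]; first by rewrite bin0n; lia.
by have := mul_bin_diag k.+1 1; rewrite bin1 => H; nia.
Qed.

Lemma tri_bin k : tri k%:Z = 'C(k, 2)%:Z.
Proof. by have := tri2 k%:Z; have := bin2Z k; lia. Qed.

Lemma tri_binN k : tri (- k%:Z) = ('C(k, 2) + k)%N%:Z.
Proof. by have := tri2 (- k%:Z); have := bin2Z k; lia. Qed.

Lemma zbox_uniq M : uniq (zbox M).
Proof. by rewrite /zbox -lock map_inj_uniq ?iota_uniq // => i j; lia. Qed.

Lemma mem_zbox M (n : int) : (n \in zbox M) = (`|n| <= M)%N.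
Proof.
rewrite /zbox -lock; apply/mapP/idP => [[k]|nM]; first by rewrite mem_iota => ? ->; lia.
exists (absz (n + M%:Z)); first by rewrite mem_iota; lia.
by lia.
Qed.

Lemma tri_split k l : tri (k + l) + tri (k - l) = (k * k - k) + l * l.
Proof. by have := tri2 (k + l); have := tri2 (k - l); lia. Qed.

Lemma tri_split1 k l : tri (k + l + 1) + tri (k - l) = k * k + (l * l + l).
Proof. by have := tri2 (k + l + 1); have := tri2 (k - l); lia. Qed.

Section TripleProductSeries.
Local Open Scope classical_set_scope.
Variable K : numFieldType.
Hypothesis K_complete : geometrically_complete K.
Variable p : K.
Hypothesis p1 : `|p| < 1.
Hypothesis p0 : p != 0.

(** The coefficient of $z^n$ in the triple product. *)
Definition jacobi_coef (n : int) : K := (-1) ^ n * p ^ (tri n).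

(** A finite form of the triple product: the [m.*2] factors of [thetan], after
    normalization, are in geometric progression, and the q-binomial theorem expands them. *)
Lemma thetan_zbox (z : K) m : z != 0 ->
  thetan p z m = \sum_(n <- zbox m) gbin p m.*2 (absz (n + m%:Z)) * (jacobi_coef n * z ^ n).
Proof.
move=> z0; rewrite /zbox -lock big_map -/(index_iota 0 _).
have := gbin_theorem p m.*2 (- z * p ^- m).
rewrite -addnn (big_cat_nat (n := m)) ?leq_addr //=.
have -> : \prod_(m <= j < m + m) (1 + - z * p ^- m * p ^+ j) =
    \prod_(0 <= j < m) (1 + - z * p ^- m * p ^+ (j + m)).
  by rewrite -{1}[m]add0n big_addn addnK.
rewrite big_nat_rev /= add0n.
have -> : \prod_(0 <= j < m) (1 + - z * p ^- m * p ^+ (m - j.+1)) =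
    (\prod_(0 <= j < m) (1 - p ^+ j.+1 / z)) * \prod_(0 <= j < m) (- z * p ^- j.+1).
  rewrite -big_split /=; apply: eq_big_nat => j /andP[_ jm].
  have -> : p ^+ m = p ^+ j.+1 * p ^+ (m - j.+1) by rewrite -exprD; congr (_ ^+ _); lia.
  by field; rewrite !expf_neq0 // z0.
have -> : \prod_(0 <= j < m) (1 + - z * p ^- m * p ^+ (j + m)) = \prod_(0 <= j < m) (1 - z * p ^+ j).
  by apply: eq_big_nat => j _; rewrite exprD; field; rewrite expf_neq0.
set X := \prod_(0 <= j < m) (- z * _); set Y := \prod_(0 <= j < m) _; set Z := \prod_(0 <= j < m) _ => E.
(* The monomial by which the lower half of the factors is normalized. *)
have XE : X = (-1) ^ m%:Z * z ^ m%:Z * p ^ (- tri (m%:Z + 1)).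
  rewrite /X; elim: (m) => [|k IH]; first by rewrite big_geq // !expr0z !mul1r.
  rewrite big_nat_recr //= IH.
  have -> : tri (k.+1%:Z + 1) = tri (k%:Z + 1) + k.+1%:Z.
    by have := tri2 (k.+1%:Z + 1); have := tri2 (k%:Z + 1); lia.
  rewrite opprD !(expfzDr _ _ p0) exprnN intS addrC !exprzDr ?unitfE ?oppr_eq0 ?oner_eq0 //.
  by rewrite !expr1z; ring.
have X0 : X != 0 by rewrite XE !mulf_neq0 ?expfz_neq0 // oppr_eq0 oner_eq0.
have -> : thetan p z m = Y * Z by rewrite /thetan big_split mulrC.
apply: (mulIf X0); rewrite mulrAC E mulr_suml; apply: eq_big_nat => i _.
rewrite addrNK absz_nat -!mulrA; congr (_ * _); rewrite XE /jacobi_coef.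
have -> : (- z * p ^- m) ^+ i = (-1) ^ i%:Z * z ^ i%:Z * p ^ (- (m%:Z * i%:Z)).
  have -> : - z = (-1) * z by rewrite mulN1r.
  by rewrite !exprMn exprVn -exprM -PoszM exprnN.
have N1 : (-1 : K) != 0 by rewrite oppr_eq0 oner_eq0.
have hS (w : K) : w != 0 -> w ^ i%:Z = w ^ (i%:Z - m%:Z) * w ^ m%:Z.
  by move=> w0; rewrite -expfzDr // subrK.
rewrite (hS _ N1) (hS _ z0).
have -> : p ^+ 'C(i, 2) = p ^ (tri (i%:Z - m%:Z)) * p ^ (- tri (m%:Z + 1)) * p ^ (m%:Z * i%:Z).
  rewrite -!expfzDr // exprnP; congr (_ ^ _).
  by have := bin2Z i; have := tri2 (i%:Z - m%:Z); have := tri2 (m%:Z + 1); lia.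
have -> : p ^ (- (m%:Z * i%:Z)) = (p ^ (m%:Z * i%:Z))^-1 by rewrite invr_expz.
by field; rewrite expfz_neq0.
Qed.

Lemma sum_sub_uniq (T : eqType) (s L : seq T) (H : T -> K) :
  uniq s -> uniq L -> {subset s <= L} ->
  \sum_(t <- L) H t - \sum_(t <- s) H t = \sum_(t <- L | t \notin s) H t.
Proof.
move=> us uL sL; rewrite (bigID (mem s)) /= -[X in X + _ - _]big_filter.
rewrite (perm_big s) /=; first by rewrite addrC addKr.
apply: uniq_perm; rewrite ?filter_uniq // => t; rewrite mem_filter.
by apply: andb_idr; exact: sL.
Qed.

(** Changing the region of summation costs at most the absolute mass outside [s]. *)
Lemma sum_incl_dist (T : eqType) (s D s' : seq T) (G : T -> K) :
  uniq s -> uniq D -> uniq s' -> {subset s <= D} -> {subset D <= s'} ->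
  `|\sum_(t <- D) G t - \sum_(t <- s) G t| <= \sum_(t <- s') `|G t| - \sum_(t <- s) `|G t|.
Proof.
move=> us uD us' sD Ds'.
rewrite !sum_sub_uniq //; last by move=> t /sD /Ds'.
apply: le_trans (ler_norm_sum _ _ _) _.
rewrite -big_filter -[leRHS]big_filter.
set A := [seq t <- D | t \notin s]; set B := [seq t <- s' | t \notin s].
have uA : uniq A by rewrite filter_uniq.
have AB : {subset A <= B} by move=> t; rewrite !mem_filter => /andP[-> /Ds' ->].
have : \sum_(t <- A) `|G t| + \sum_(t <- B | t \notin A) `|G t| = \sum_(t <- B) `|G t|.
  rewrite [RHS](bigID (mem A)) /= -[X in _ = X + _]big_filter; congr (_ + _).
  apply: perm_big; apply: uniq_perm; rewrite ?filter_uniq // => t; rewrite mem_filter.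
  by apply/esym; apply: andb_idr; exact: AB.
by move=> <-; rewrite lerDl sumr_ge0.
Qed.

(** Once [r ^+ J * (2 * w) <= 1], the ratios of consecutive terms are at most [1/2]. *)
Lemma gauss_bound (r w : K) : 0 <= r -> r < 1 -> 0 <= w ->
  exists2 A, 0 <= A & forall k, r ^+ 'C(k, 2) * w ^+ k <= A * 2^-1 ^+ k.
Proof.
move=> r0 r1 w0.
have [J HJ] : exists J, r ^+ J * (2 * w) <= 1.
  have : (fun m => r ^+ m * (2 * w)) @ \oo --> (0 * (2 * w) : K).
    by apply: cvgMl; exact: cvgn_exp.
  rewrite mul0r => /cvgrPdist_lt/(_ 1 ltr01) [J _ /(_ J (leqnn J))] /=.
  by rewrite sub0r normrN ger0_norm ?mulr_ge0 ?exprn_ge0 // => /ltW h; exists J.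
pose g k := r ^+ 'C(k, 2) * (2 * w) ^+ k.
have g0 k : 0 <= g k by rewrite mulr_ge0 ?exprn_ge0 ?mulr_ge0.
exists (\sum_(0 <= k < J.+1) g k); first exact: sumr_ge0.
have n2 : (2 : K) != 0 by rewrite pnatr_eq0.
suff H k : g k <= \sum_(0 <= k < J.+1) g k.
  move=> k; apply: le_trans (ler_wpM2r _ (H k)); last by rewrite exprn_ge0 // invr_ge0.
  by rewrite /g exprMn -!mulrA [_ ^+ k * _]mulrC -mulrA -exprMn mulVf // expr1n mulr1 lexx.
case: (leqP k J) => [kJ|].
  rewrite (bigD1_seq k) ?iota_uniq ?mem_index_iota //= lerDl; exact: sumr_ge0.
move=> /ltnW /subnKC <-; elim: (k - J)%N => [|d IH].
  by rewrite addn0 (bigD1_seq J) ?iota_uniq ?mem_index_iota //= lerDl; exact: sumr_ge0.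
apply: le_trans IH; rewrite addnS /g binS bin1 exprD exprSr -!mulrA ler_wpM2l ?exprn_ge0 //.
rewrite mulrCA ler_piMr ?exprn_ge0 ?mulr_ge0 //; apply: le_trans HJ.
by rewrite ler_wpM2r ?mulr_ge0 // ler_wiXn2l ?leq_addr // ltW.
Qed.

Lemma jacobi_coef_bound (z : K) : z != 0 -> exists2 A, 0 <= A &
  forall n, `|jacobi_coef n * z ^ n| <= A * 2^-1 ^+ `|n|%N.
Proof.
move=> z0; pose w := `|z| + `|z^-1|.
have w0 : 0 <= w by rewrite addr_ge0.
have [A A0 HA] := gauss_bound (normr_ge0 p) p1 w0; exists A => // n.
apply: le_trans (HA _).
have jcN : `|jacobi_coef n * z ^ n| = `|p| ^ (tri n) * `|z| ^ n.
  have normXz (a : K) m : `|a ^ m| = `|a| ^ m.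
    by case: m => m; rewrite ?NegzE -?exprnN -?exprnP ?normfV normrX.
  by rewrite /jacobi_coef !normrM !normXz normrN1 exp1rz mul1r.
rewrite jcN; case: n {jcN} => k /=.
  rewrite tri_bin.
  rewrite -!exprnP ler_wpM2l ?exprn_ge0 // lerXn2r ?nnegrE // /w lerDl normr_ge0 //.
rewrite NegzE tri_binN -exprnN -exprnP exprD -mulrA ler_wpM2l ?exprn_ge0 //.
apply: (@le_trans _ _ (1 * `|z^-1| ^+ k.+1)).
  rewrite normfV exprVn ler_wpM2r ?invr_ge0 ?exprn_ge0 //.
  by rewrite exprn_ile1 // ltW.
by rewrite mul1r lerXn2r ?nnegrE // /w lerDr.
Qed.

Definition jacobi_abs (z : K) M : K := \sum_(n <- zbox M) `|jacobi_coef n * z ^ n|.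

Lemma jacobi_absS (z : K) M : jacobi_abs z M.+1 =
  jacobi_abs z M + (`|jacobi_coef M.+1%:Z * z ^ M.+1%:Z| + `|jacobi_coef (- M.+1%:Z) * z ^ (- M.+1%:Z)|).
Proof.
transitivity (\sum_(n <- M.+1%:Z :: - M.+1%:Z :: zbox M) `|jacobi_coef n * z ^ n|).
  apply: perm_big; apply: uniq_perm; rewrite ?zbox_uniq //.
    by rewrite 2!cons_uniq zbox_uniq in_cons !mem_zbox; lia.
  by move=> n; rewrite [in LHS]mem_zbox 2!in_cons mem_zbox; lia.
by rewrite 2!big_cons addrA addrC.
Qed.

Lemma jacobi_abs_tail (z : K) : z != 0 -> exists2 C, 0 <= C & (forall M, jacobi_abs z M <= C) /\
  forall M M', (M <= M')%N -> jacobi_abs z M' - jacobi_abs z M <= C * 2^-1 ^+ M.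
Proof.
move=> z0; have [A A0 HA] := jacobi_coef_bound z0.
have h0 : 0 <= 2^-1 :> K by rewrite invr_ge0.
have h1 : 2^-1 < 1 :> K by rewrite invf_lt1 ?ltr1n.
have HD M : `|jacobi_abs z M.+1 - jacobi_abs z M| <= A * 2^-1 ^+ M.
  rewrite jacobi_absS addrAC subrr add0r ger0_norm ?addr_ge0 //.
  apply: le_trans (lerD (HA _) (HA _)) _; rewrite abszN !absz_nat -mulrDr.
  by rewrite exprS -mulrDl half2 mul1r.
have [l Sl] := K_complete h0 h1 HD.
have HL := geometric_limit_dist A0 h0 h1 HD Sl.
pose C := A / (1 - 2^-1); have C0 : 0 <= C by rewrite divr_ge0 // subr_ge0 ltW.
have s0 M : 0 <= jacobi_abs z M by apply: sumr_ge0.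
exists (C + C + `|l|); first by rewrite !addr_ge0.
split=> [M|M M' MM'].
  rewrite -[jacobi_abs z M]ger0_norm // -[jacobi_abs z M](subrK l).
  apply: le_trans (ler_normD _ _) _; rewrite lerD2r; apply: le_trans (HL M) _.
  by rewrite (le_trans (_ : _ <= C)) ?lerDl // ler_piMr // exprn_ile1 // ltW.
have -> : jacobi_abs z M' - jacobi_abs z M = (jacobi_abs z M' - l) - (jacobi_abs z M - l) by ring.
have hr : 0 <= jacobi_abs z M' - jacobi_abs z M.
  rewrite -(subnKC MM'); elim: (M' - M)%N => [|d IH]; first by rewrite addn0 subrr.
  by apply: le_trans IH _; rewrite addnS lerD2r jacobi_absS lerDl addr_ge0.
rewrite -[leLHS]ger0_norm; last by rewrite (_ : _ - _ = jacobi_abs z M' - jacobi_abs z M) //; ring.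
apply: le_trans (ler_normB _ _) _; rewrite !mulrDl -[leLHS]addr0.
apply: lerD; last by rewrite mulr_ge0 ?exprn_ge0.
apply: lerD; last exact: HL.
apply: le_trans (HL M') _; rewrite ler_wpM2l //.
by rewrite ler_wiXn2l // ltW.
Qed.

(** Both $(p;p)_m$ and its inverse converge at a geometric rate. The inverse is
    handled as a product of its own, with factors close to [1]. *)
Lemma pfac_limits : exists P Q : K, P * Q = 1 /\ exists2 B : K, 0 <= B &
  forall m, [/\ pfac p m * (pfac p m)^-1 = 1, `|pfac p m| <= B, `|(pfac p m)^-1| <= B,
    `|pfac p m - P| <= B * `|p| ^+ m & `|(pfac p m)^-1 - Q| <= B * `|p| ^+ m].
Proof.
have q0 : 0 < 1 - `|p| by rewrite subr_gt0.
have pj j : `|p| ^+ j.+1 <= `|p| by rewrite exprS ler_piMr // exprn_ile1 // ltW.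
have f0 j : 1 - p ^+ j.+1 != 0.
  rewrite subr_eq0; apply/eqP => /(congr1 Num.norm); rewrite normr1 normrX => E.
  by have := le_lt_trans (pj j) p1; rewrite -E ltxx.
have fn j : 1 - `|p| <= `|1 - p ^+ j.+1|.
  have := lerB_dist 1 (p ^+ j.+1); rewrite normr1 normrX; apply: le_trans.
  by rewrite lerD2l lerN2.
have B0 : 0 <= (1 - `|p|)^-1 by rewrite invr_ge0 ltW.
have B1 : 1 <= (1 - `|p|)^-1 by rewrite invf_ge1 // lerBlDr lerDl.
have [M1 M10 H1] := prod1D_cvg K_complete B0 (normr_ge0 p) p1.
have [M2 M20 H2] := prod1D_bounded K_complete B0 (normr_ge0 p) p1.
pose u j := - p ^+ j.+1; pose v j := (1 - p ^+ j.+1)^-1 - 1.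
have uE m : pfac p m = \prod_(0 <= j < m) (1 + u j) by [].
have vE m : (pfac p m)^-1 = \prod_(0 <= j < m) (1 + v j).
  by rewrite /pfac -prodfV; apply: eq_bigr => j _; rewrite /v [1 + (_ - 1)]addrC subrK.
have ub j : `|u j| <= (1 - `|p|)^-1 * `|p| ^+ j.
  rewrite /u normrN normrX exprS ler_wpM2r ?exprn_ge0 //.
  exact: le_trans (ltW p1) B1.
have vb j : `|v j| <= (1 - `|p|)^-1 * `|p| ^+ j.
  have -> : v j = p ^+ j.+1 * (1 - p ^+ j.+1)^-1 by rewrite /v; field; exact: f0.
  rewrite mulrC normrM normfV normrX; apply: ler_pM; rewrite ?invr_ge0 ?exprn_ge0 //.
    by rewrite lef_pV2 // posrE // normr_gt0.
  by rewrite exprS ler_piMl ?exprn_ge0 // ltW.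
have [P [Pl HP]] := H1 u ub; have [Q [Ql HQ]] := H1 v vb.
exists P, Q; split.
  have : (fun m => \prod_(0 <= j < m) (1 + u j) * \prod_(0 <= j < m) (1 + v j)) @ \oo --> P * Q.
    exact: cvgM.
  have -> : (fun m => \prod_(0 <= j < m) (1 + u j) * \prod_(0 <= j < m) (1 + v j)) = fun=> 1.
    apply/funext => m; rewrite -uE -vE mulfV // /pfac prodf_seq_neq0.
    by apply/allP => j _; exact: f0.
  move=> h; apply: cvgn_uniq h _; exact: cvg_cst.
exists (M1 + M2) => [|m]; first by rewrite addr_ge0.
split.
- by rewrite mulfV // /pfac prodf_seq_neq0; apply/allP => j _; exact: f0.
- by rewrite uE; apply: le_trans (H2 u ub m) _; rewrite lerDr.
- by rewrite vE; apply: le_trans (H2 v vb m) _; rewrite lerDr.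
- by rewrite uE; apply: le_trans (HP m) _; rewrite mulrDl lerDl mulr_ge0 ?exprn_ge0.
- by rewrite vE; apply: le_trans (HQ m) _; rewrite mulrDl lerDl mulr_ge0 ?exprn_ge0.
Qed.

End TripleProductSeries.

(** * The three-term relation *)

Section ThreeTermRelation.
Local Open Scope classical_set_scope.
Variable K : numFieldType.
Hypothesis K_complete : geometrically_complete K.
Variable p : K.
Hypothesis p1 : `|p| < 1.

Section PNonzero.
Hypothesis p0 : p != 0.

Local Notation jc := (jacobi_coef p).
Local Notation sabs := (jacobi_abs p).

Lemma subset_zbox M M' : (M <= M')%N -> {subset zbox M <= zbox M'}.
Proof. by move=> le n; rewrite !mem_zbox => /leq_trans; apply. Qed.

(** The Jacobi triple product, along the even truncations. In its finite form the
    Gaussian binomials tend to the inverse of $P=(p;p)_\infty$, uniformly in the central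
    half of the range, while the outer half is controlled by absolute convergence. *)
Lemma triple_product : exists2 P : K, P != 0 & forall z : K, z != 0 ->
  (fun h => \sum_(n <- zbox h.*2) jc n * z ^ n) @ \oo --> P * th p z.
Proof.
have [P [Q [PQ [B B0 HB]]]] := pfac_limits K_complete p1.
exists P => [|z z0]; first by apply/eqP => P0; move/eqP: PQ; rewrite P0 mul0r eq_sym oner_eq0.
have [C C0 [SC ST]] := jacobi_abs_tail K_complete p1 p0 z0.
pose D := B + B.
have D0 : 0 <= D by rewrite addr_ge0.
have BD : B <= D by rewrite lerDl.
have [PD QD] : `|P| <= D /\ `|Q| <= D.
  have [_ h1 h2 h3 h4] := HB 0%N; rewrite expr0 mulr1 in h3 h4.
  have h (x y : K) : `|x| <= B -> `|x - y| <= B -> `|y| <= D.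
    move=> xB xyB; rewrite -[y](subKr x); apply: le_trans (ler_normB _ _) _.
    exact: lerD.
  by split; [exact: h h3 | exact: h h4].
have XD m : `|pfac p m| <= D by have [_ h _ _ _] := HB m; exact: le_trans BD.
have YD m : `|(pfac p m)^-1| <= D by have [_ _ h _ _] := HB m; exact: le_trans BD.
pose E := D * (B * D * D + D * B * D + D * D * B).
pose E' := 1 + D * (D * D * D).
have E0 : 0 <= E by rewrite /E !(mulr_ge0, addr_ge0).
have E'0 : 0 <= E' by rewrite /E' !(mulr_ge0, addr_ge0).
(* The truncations at h of the series and of P times the theta product differ by the
   errors e h n. These are small for n in zbox h, and bounded for the remaining n, whose
   terms have small total size. *)
pose e h n := 1 - P * gbin p (h.*2.*2) (absz (n + h.*2%:Z)).
have normM3 (a b c A' B' C' : K) : `|a| <= A' -> `|b| <= B' -> `|c| <= C' -> `|a * b * c| <= A' * B' * C'.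
  by move=> ha hb hc; rewrite !normrM; apply: ler_pM; rewrite ?mulr_ge0 //; apply: ler_pM.
have gbE h (n : int) : n \in zbox h.*2 -> exists a b,
    [/\ a = absz (n + h.*2%:Z), (a + b = h.*2.*2)%N &
    gbin p (h.*2.*2) a = pfac p (h.*2.*2) * (pfac p a)^-1 * (pfac p b)^-1].
  rewrite mem_zbox => nh; exists (absz (n + h.*2%:Z)), (absz (h.*2%:Z - n)).
  set a := absz (n + h.*2%:Z); set b := absz (h.*2%:Z - n).
  have ab : (a + b = h.*2.*2)%N by move: nh; rewrite /a /b; clear; lia.
  split=> //; have ale : (a <= h.*2.*2)%N by rewrite -ab leq_addr.
  rewrite -(gbin_pfac p ale) (_ : (h.*2.*2 - a = b)%N); last by rewrite -ab addKn.
  have f0 m : pfac p m != 0.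
    by apply/eqP => f0; have [/eqP] := HB m; rewrite f0 mul0r eq_sym oner_eq0.
  by field; rewrite !f0.
have eE' h n : n \in zbox h.*2 -> `|e h n| <= E'.
  move=> /gbE [a [b [aE ab gE]]]; rewrite /e -aE gE; apply: le_trans (ler_normB _ _) _.
  rewrite normr1 lerD2l normrM; apply: ler_pM => //; exact: normM3.
have eE h n : n \in zbox h -> `|e h n| <= E * `|p| ^+ h.
  move=> nh; have hh : (h <= h.*2)%N by rewrite -addnn leq_addr.
  have [a [b [aE ab gE]]] := gbE h n (subset_zbox hh nh); rewrite /e -aE gE.
  rewrite mem_zbox in nh.
  have [ha hb] : (h <= a)%N /\ (h <= b)%N by move: nh aE ab; clear; lia.
  have pr m : (h <= m)%N -> B * `|p| ^+ m <= B * `|p| ^+ h.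
    by move=> hm; rewrite ler_wpM2l // ler_wiXn2l // ltW.
  have hX : `|P - pfac p h.*2.*2| <= B * `|p| ^+ h.
    by have [_ _ _ h1 _] := HB h.*2.*2; rewrite distrC; apply: le_trans h1 _; apply: pr; clear; lia.
  have hY : `|Q - (pfac p a)^-1| <= B * `|p| ^+ h.
    by have [_ _ _ _ h1] := HB a; rewrite distrC; apply: le_trans h1 _; apply: pr.
  have hZ : `|Q - (pfac p b)^-1| <= B * `|p| ^+ h.
    by have [_ _ _ _ h1] := HB b; rewrite distrC; apply: le_trans h1 _; apply: pr.
  move: (XD h.*2.*2) (YD a) (YD b) hX hY hZ.
  set X := pfac _ _; set Y := (pfac p a)^-1; set Z := (pfac p b)^-1 => XD' YD' ZD' hX hY hZ.
  have -> : 1 - P * (X * Y * Z) = P * ((P - X) * Q * Q + X * (Q - Y) * Q + X * Y * (Q - Z)).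
    rewrite -[1 in LHS](mulr1 1) -{1}PQ -PQ; ring.
  have H : `|(P - X) * Q * Q + X * (Q - Y) * Q + X * Y * (Q - Z)| <=
      (B * D * D + D * B * D + D * D * B) * `|p| ^+ h.
    have -> : (B * D * D + D * B * D + D * D * B) * `|p| ^+ h =
      B * `|p| ^+ h * D * D + D * (B * `|p| ^+ h) * D + D * D * (B * `|p| ^+ h) by ring.
    apply: le_trans (ler_normD _ _) _; apply: lerD; last exact: normM3.
    by apply: le_trans (ler_normD _ _) _; apply: lerD; exact: normM3.
  by rewrite normrM /E -[leRHS]mulrA; apply: ler_pM.
have T : (fun h => P * thetan p z h.*2) @ \oo --> P * th p z.
  apply: cvgMr.
  have c2 : (fun h : nat => h.*2) @ \oo --> \oo.
    by move=> A [N _ HN]; exists N => // m Nm; apply: HN => /=; apply: leq_trans Nm _; rewrite -addnn leq_addr.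
  exact: cvg_comp c2 (thetan_cvg K_complete p1 z).
have W : (fun h => E * `|p| ^+ h * C + E' * (C * 2^-1 ^+ h)) @ \oo --> (0 : K).
  have -> : (0 : K) = E * 0 * C + E' * (C * 0) by rewrite !mulr0 !mul0r addr0.
  apply: cvgD.
    by apply: cvgMl; apply: cvgMr; exact: cvgn_exp.
  apply: cvgMr; apply: cvgMr; apply: cvgn_exp => //; first by rewrite invr_ge0.
  by rewrite invf_lt1 ?ltr1n.
have -> : (fun h => \sum_(n <- zbox h.*2) jc n * z ^ n) =
   fun h => P * thetan p z h.*2 + \sum_(n <- zbox h.*2) e h n * (jc n * z ^ n).
  apply/funext => h; rewrite (thetan_zbox p1 p0) // mulr_sumr -big_split /=.
  by apply: eq_bigr => n _; rewrite /e; ring.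
rewrite -[X in _ --> X]addr0; apply: cvgD => //.
apply: (cvgn_dominated W) => h; rewrite subr0.
apply: le_trans (ler_norm_sum _ _ _) _.
have hh : (h <= h.*2)%N by rewrite -addnn leq_addr.
apply: (@le_trans _ _ (\sum_(n <- zbox h.*2) E * `|p| ^+ h * `|jc n * z ^ n|
   + \sum_(n <- zbox h.*2 | n \notin zbox h) E' * `|jc n * z ^ n|)).
  rewrite [X in _ + X]big_mkcond -big_split /= big_seq [leRHS]big_seq.
  apply: ler_sum => n nh; rewrite normrM.
  case: ifPn => [nn|/negPn nn].
    rewrite -mulrDl ler_wpM2r //; apply: le_trans (eE' _ _ nh) _.
    by rewrite lerDr mulr_ge0 ?exprn_ge0.
  by rewrite addr0 ler_wpM2r // eE.
rewrite -!mulr_sumr -sum_sub_uniq ?zbox_uniq //; last exact: subset_zbox.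
apply: lerD; first by rewrite ler_wpM2l ?SC // mulr_ge0 ?exprn_ge0.
by rewrite ler_wpM2l // ST.
Qed.

(** In the product of the triple products at [x * y] and [x / y], the pairs of indices of
    equal parity give a product of a series in [x] and a series in [y], and so do the other
    pairs. Truncations to a diamond and to a square have the same limit because the diamond
    lies between two squares. *)
Lemma th_rank2_neq0 : exists al be ga de : nat -> K -> K, exists2 c : K, c != 0 &
  forall x y : K, x != 0 -> y != 0 ->
  (fun h => al h x * be h y - ga h x * de h y) @ \oo --> c * (th p (x * y) * th p (x / y)).
Proof.
have [P P0 HP] := triple_product.
exists (fun h x => \sum_(k <- zbox h.*2) p ^ (k * k - k) * x ^ (2 * k)).
exists (fun h y => \sum_(l <- zbox h.*2) p ^ (l * l) * y ^ (2 * l)).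
exists (fun h x => \sum_(k <- zbox h.*2) p ^ (k * k) * x ^ (2 * k + 1)).
exists (fun h y => \sum_(l <- zbox h.*2) p ^ (l * l + l) * y ^ (2 * l + 1)).
exists (P * P) => [|x y x0 y0]; first by rewrite mulf_neq0.
have xy0 : x * y != 0 by rewrite mulf_neq0.
have xVy0 : x / y != 0 by rewrite mulf_neq0 ?invr_eq0.
pose A n := jc n * (x * y) ^ n; pose B n := jc n * (x / y) ^ n.
pose G (t : int * int) := A t.1 * B t.2.
pose sq M := [seq (i, j) | i <- zbox M, j <- zbox M].
(* The pairs (i, j) of equal parity are (k + l, k - l), the others (k + l + 1, k - l). *)
pose dm M := [seq (t.1 + t.2, t.1 - t.2) | t <- sq M] ++ [seq (t.1 + t.2 + 1, t.1 - t.2) | t <- sq M].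
have sqE (H H' : int -> K) M :
    \sum_(t <- sq M) H t.1 * H' t.2 = (\sum_(n <- zbox M) H n) * \sum_(n <- zbox M) H' n.
  by rewrite big_allpairs /= big_distrlr.
have sq_uniq M : uniq (sq M) by apply: allpairs_uniq; rewrite ?zbox_uniq // => -[? ?] [? ?].
have mem_sq M t : (t \in sq M) = (t.1 \in zbox M) && (t.2 \in zbox M).
  case: t => i j; apply/allpairsP/andP => [[[a b] /= [ha hb [-> ->]]] | [h1 h2]] //.
  by exists (i, j).
have dm_uniq M : uniq (dm M).
  rewrite cat_uniq !map_inj_uniq ?sq_uniq /=; try by move=> [? ?] [? ?] /= [? ?]; congr pair; lia.
  rewrite andbT; apply/hasPn => _ /mapP[[i j] _ ->]; apply/mapP => -[[k l] _ /= [? ?]]; lia.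
have sub1 M : {subset sq M <= dm M}.
  case=> i j; rewrite mem_sq /= mem_cat !mem_zbox => /andP[ib jb]; apply/orP.
  have [m [E | E]] : exists m : int, i - j = 2 * m \/ i - j = 2 * m + 1.
  - by exists ((i - j) %/ 2)%Z; lia.
  - left; apply/mapP; exists (j + m, m); first by rewrite mem_sq /= !mem_zbox; lia.
    by rewrite /=; congr pair; lia.
  right; apply/mapP; exists (j + m, m); first by rewrite mem_sq /= !mem_zbox; lia.
  by rewrite /=; congr pair; lia.
have sub2 M : {subset dm M <= sq M.*2.+1}.
  case=> i j; rewrite mem_cat => /orP[] /mapP[[k l]]; rewrite mem_sq /= !mem_zbox => /andP[kb lb] [-> ->];
    rewrite mem_sq /= !mem_zbox; lia.
have dmE M : \sum_(t <- dm M) G t =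
    (\sum_(k <- zbox M) p ^ (k * k - k) * x ^ (2 * k)) * (\sum_(l <- zbox M) p ^ (l * l) * y ^ (2 * l))
  - (\sum_(k <- zbox M) p ^ (k * k) * x ^ (2 * k + 1)) * (\sum_(l <- zbox M) p ^ (l * l + l) * y ^ (2 * l + 1)).
  have N1 : (-1 : K) != 0 by rewrite oppr_eq0 oner_eq0.
  have N2 m : (-1 : K) ^ (2 * m) = 1 by rewrite -exprz_exp -exprnP sqrrN expr1n exp1rz.
  have xyz (z w : K) m : z != 0 -> w != 0 -> (z * w) ^ m = z ^ m * w ^ m.
    by move=> z0 w0; rewrite exprMz_comm ?unitfE //; exact: mulrC.
  have GE (i j : int) : G (i, j) = (-1) ^ (i + j) * p ^ (tri i + tri j) * x ^ (i + j) * y ^ (i - j).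
    rewrite /G /A /B /= /jacobi_coef !xyz ?invr_eq0 // !(expfzDr _ _ x0) !(expfzDr _ _ y0) !(expfzDr _ _ p0) !(expfzDr _ _ N1).
    by rewrite exprz_inv; ring.
  rewrite big_cat !big_map /= -!sqE -sumrN; congr (_ + _); apply: eq_bigr => -[k l] _; rewrite GE /=.
    have -> : k + l + (k - l) = 2 * k by lia.
    have -> : k + l - (k - l) = 2 * l by lia.
    by rewrite N2 tri_split !(expfzDr _ _ p0); ring.
  have -> : k + l + 1 + (k - l) = 2 * k + 1 by lia.
  have -> : k + l + 1 - (k - l) = 2 * l + 1 by lia.
  by rewrite (expfzDr _ _ N1) N2 expr1z tri_split1 !(expfzDr _ _ p0); ring.
have [C1 C10 [SC1 ST1]] := jacobi_abs_tail K_complete p1 p0 xy0.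
have [C2 C20 [SC2 ST2]] := jacobi_abs_tail K_complete p1 p0 xVy0.
have W : (fun h => C1 * 2^-1 ^+ h * C2 + C1 * (C2 * 2^-1 ^+ h)) @ \oo --> (0 : K).
  have -> : (0 : K) = C1 * 0 * C2 + C1 * (C2 * 0) by rewrite !mulr0 !mul0r addr0.
  have g : (fun h => 2^-1 ^+ h) @ \oo --> (0 : K).
    by apply: cvgn_exp => //; rewrite ?invr_ge0 // invf_lt1 ?ltr1n.
  by apply: cvgD; [apply: cvgMl; apply: cvgMr|apply: cvgMr; apply: cvgMr].
have L : (fun h => (\sum_(n <- zbox h.*2) A n) * \sum_(n <- zbox h.*2) B n) @ \oo -->
    P * P * (th p (x * y) * th p (x / y)).
  rewrite (_ : P * P * _ = P * th p (x * y) * (P * th p (x / y))); last by ring.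
  by apply: cvgM; apply: HP.
set lhs := (X in X @ _ --> _).
have -> : lhs = fun h => (\sum_(n <- zbox h.*2) A n) * (\sum_(n <- zbox h.*2) B n)
   + (\sum_(t <- dm h.*2) G t - \sum_(t <- sq h.*2) G t).
  by apply/funext => h; rewrite sqE dmE /lhs; ring.
rewrite -[X in _ --> X]addr0; apply: cvgD => //.
apply: (cvgn_dominated W) => h; rewrite subr0.
have Su := sq_uniq; have Du := dm_uniq.
apply: le_trans (sum_incl_dist G (Su _) (Du _) (Su h.*2.*2.+1) (@sub1 _) (@sub2 _)) _.
have nE M : \sum_(t <- sq M) `|G t| = sabs (x * y) M * sabs (x / y) M.
  by rewrite -sqE; apply: eq_bigr => t _; rewrite normrM.
rewrite !nE; set m := h.*2; set m' := m.*2.+1.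
have mm : (m <= m')%N by rewrite /m' -addnn leqW ?leq_addr.
have hm : (h <= m)%N by rewrite /m -addnn leq_addr.
have -> : sabs (x * y) m' * sabs (x / y) m' - sabs (x * y) m * sabs (x / y) m =
  (sabs (x * y) m' - sabs (x * y) m) * sabs (x / y) m' + sabs (x * y) m * (sabs (x / y) m' - sabs (x / y) m) by ring.
have g : (2^-1 : K) ^+ m <= 2^-1 ^+ h.
  by rewrite ler_wiXn2l ?invr_ge0 // invf_le1 ?ler1n.
have s0 z M : 0 <= sabs z M by apply: sumr_ge0.
have ler (a b c d : K) : a <= c -> b <= d -> 0 <= b -> 0 <= c -> a * b <= c * d.
  by move=> ac bd b0 c0; apply: le_trans (ler_wpM2r b0 ac) (ler_wpM2l c0 bd).
have pw0 M : 0 <= (2^-1 : K) ^+ M by rewrite exprn_ge0 // invr_ge0.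
apply: lerD.
  apply: ler; rewrite ?SC2 ?s0 ?mulr_ge0 //.
  by apply: le_trans (ST1 _ _ mm) _; rewrite ler_wpM2l.
apply: le_trans (ler_wpM2l (s0 _ _) (ST2 _ _ mm)) _.
apply: ler; rewrite ?SC1 ?mulr_ge0 //.
by rewrite ler_wpM2l.
Qed.

End PNonzero.

(** For [p = 0] theta is [1 - z], and the kernel has rank two by inspection. *)
Lemma th_rank2 : exists al be ga de : nat -> K -> K, exists2 c : K, c != 0 &
  forall x y : K, x != 0 -> y != 0 ->
  (fun h => al h x * be h y - ga h x * de h y) @ \oo --> c * (th p (x * y) * th p (x / y)).
Proof.
have [pE|] := eqVneq p 0; last exact: th_rank2_neq0.
have thE z : th p z = 1 - z.
  apply: cvgn_uniq (thetan_cvg K_complete p1 z) _.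
  have -> : thetan p z = fun m => if m is 0 then 1 else 1 - z.
    apply/funext => -[|m]; first by rewrite /thetan big_geq.
    rewrite /thetan big_nat_recl //= big1 ?mulr1 => [|j _].
      by rewrite ?expr0 ?expr1 pE mul0r subr0 !mulr1.
    by rewrite pE !expr0n /= mulr0 mul0r !subr0 mulr1.
  by move=> U nU; exists 1%N => // -[|m] //= _; exact: nbhs_singleton nU.
exists (fun _ x => 1 + x * x), (fun _ _ => 1), (fun _ x => x), (fun _ y => y + y^-1).
exists 1 => [|x y x0 y0]; first exact: oner_neq0.
rewrite !thE; have -> : 1 * ((1 - x * y) * (1 - x / y)) = (1 + x * x) * 1 - x * (y + y^-1).
  by field.
exact: cvg_cst.
Qed.

(** The normalization by [x] makes the kernel antisymmetric. *)
Definition thk (x y : K) : K := th p (x * y) * th p (x / y) / x.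

Lemma thkC (x y : K) : x != 0 -> y != 0 -> thk x y = - thk y x.
Proof.
move=> x0 y0; rewrite /thk -[y / x]invf_div th_inv ?mulf_neq0 ?invr_eq0 //.
by rewrite [y * x]mulrC; field; rewrite ?x0 ?y0.
Qed.

Lemma thkxx (x : K) : x != 0 -> thk x x = 0.
Proof. by move=> x0; rewrite /thk divff // th1 // mulr0 mul0r. Qed.

(** A minor of order three of the rank-two kernel is zero. Antisymmetry and the
    zero diagonal factor it as one entry times the Pluecker expression. *)
Lemma thk_plucker0 (x y u v : K) : x != 0 -> y != 0 -> u != 0 -> v != 0 ->
  thk x y * (thk x y * thk u v - thk x u * thk y v + thk x v * thk y u) = 0.
Proof.
move=> x0 y0 u0 v0; have [al [be [ga [de [c c0 H]]]]] := th_rank2.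
pose a s t h := al h s * be h t - ga h s * de h t.
pose l s t := c * (th p (s * t) * th p (s / t)).
(* The determinant of order three with rows x, y, u and columns x, y, v. *)
have det h : a x x h * (a y y h * a u v h - a y v h * a u y h)
  - a x y h * (a y x h * a u v h - a y v h * a u x h)
  + a x v h * (a y x h * a u y h - a y y h * a u x h) = 0 by rewrite /a; ring.
have L : (fun h => a x x h * (a y y h * a u v h - a y v h * a u y h)
  - a x y h * (a y x h * a u v h - a y v h * a u x h)
  + a x v h * (a y x h * a u y h - a y y h * a u x h)) @ \oo -->
   l x x * (l y y * l u v - l y v * l u y) - l x y * (l y x * l u v - l y v * l u x)
  + l x v * (l y x * l u y - l y y * l u x).
  have La s t : s != 0 -> t != 0 -> (fun h => a s t h) @ \oo --> l s t by exact: H.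
  have L2 (f1 f2 f3 f4 f5 : nat -> K) (l1 l2 l3 l4 l5 : K) :
      f1 @ \oo --> l1 -> f2 @ \oo --> l2 -> f3 @ \oo --> l3 -> f4 @ \oo --> l4 ->
      f5 @ \oo --> l5 ->
      (fun h => f1 h * (f2 h * f3 h - f4 h * f5 h)) @ \oo --> l1 * (l2 * l3 - l4 * l5).
    by move=> h1 h2 h3 h4 h5; apply: cvgM => //; apply: cvgB; apply: cvgM.
  by apply: cvgD; [apply: cvgB|]; apply: L2; exact: La.
have L0 : (fun=> 0 : K) @ \oo --> (0 : K) by exact: cvg_cst.
rewrite (funext det) in L; have {L L0} := cvgn_uniq L L0.
have lE s t : s != 0 -> l s t = c * s * thk s t.
  by move=> s0; rewrite /l /thk; field.
rewrite !lE // !thkxx // (thkC y0 x0) (thkC u0 x0) (thkC u0 y0).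
move=> /eqP; rewrite (_ : _ + _ = c ^+ 3 * (x * y * u) *
  (thk x y * (thk x y * thk u v - thk x u * thk y v + thk x v * thk y u))); last by ring.
have cc : c ^+ 3 * (x * y * u) != 0 by rewrite !mulf_neq0 ?expf_neq0.
by rewrite mulf_eq0 (negPf cc) /= => /eqP.
Qed.

(** The three-term theta relation of Weierstrass. If the entry factored out by the previous
    lemma is zero, another pairing is used; if all three are, the relation is trivial. *)
Lemma thk_plucker (x y u v : K) : x != 0 -> y != 0 -> u != 0 -> v != 0 ->
  thk x y * thk u v - thk x u * thk y v + thk x v * thk y u = 0.
Proof.
move=> x0 y0 u0 v0.
have [Exy|nz] := eqVneq (thk x y) 0; last by apply: (mulfI nz); rewrite thk_plucker0 // mulr0.
have [Exu|nz] := eqVneq (thk x u) 0; last first.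
  apply: (mulfI nz); rewrite mulr0; apply: oppr_inj; rewrite oppr0 -(thk_plucker0 x0 u0 y0 v0).
  by rewrite (thkC u0 y0); ring.
have [Exv|nz] := eqVneq (thk x v) 0; last first.
  apply: (mulfI nz); rewrite mulr0 -(thk_plucker0 x0 v0 y0 u0).
  by rewrite (thkC v0 y0) (thkC v0 u0); ring.
by rewrite Exy Exu Exv !mul0r subrr addr0.
Qed.

End ThreeTermRelation.

(** * Interpolation and the elliptic Jackson sum over subsets *)

Section Bracket.
Variables (A : comNzRingType) (F : fieldType) (br : A -> F).

(** Antisymmetric in [x] and [y]. As a function of [x] with [y] fixed it is invariant under
    [x -> s - x], and it plays the part of a linear polynomial with root [y]. *)
Definition pairbr (s x y : A) : F := br (x - y) * br (s - x - y).

Hypothesis brN : forall x, br (- x) = - br x.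
Hypothesis br0 : br 0 = 0.
Hypothesis plucker : forall s x y u v,
  pairbr s x y * pairbr s u v - pairbr s x u * pairbr s y v
  + pairbr s x v * pairbr s y u = 0.

Variable h : A.

Lemma brB x y : br (x - y) = - br (y - x).
Proof. by rewrite -brN opprB. Qed.

Section Interpolation.
Variable s : A.
Local Notation phi := (pairbr s).

Lemma phiC x y : phi x y = - phi y x.
Proof. by rewrite /pairbr brB mulNr; congr (- (_ * br _)); ring. Qed.

Lemma phixx x : phi x x = 0.
Proof. by rewrite /pairbr subrr br0 mul0r. Qed.

(** The analogue of polynomials of degree at most [n]: sums of products of [n] elementary
    functions. The last constructor avoids appeals to functional extensionality. *)
Inductive span : nat -> (A -> F) -> Prop :=
| SpanC c : span 0 (fun=> c)
| SpanM n a f : span n f -> span n.+1 (fun e => phi e a * f e)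
| SpanD n f g : span n f -> span n g -> span n (fun e => f e + g e)
| SpanE n f g : f =1 g -> span n f -> span n g.

Lemma span0 n : span n (fun=> 0).
Proof.
elim: n => [|n IH]; first exact: SpanC.
by apply: SpanE (SpanM s IH) => e; rewrite mulr0.
Qed.

Lemma spanZ n c f : span n f -> span n (fun e => c * f e).
Proof.
elim=> [d|m a g _ IH|m f1 f2 _ IH1 _ IH2|m f1 f2 E _ IH].
- exact: SpanC.
- by apply: SpanE (SpanM a IH) => e; rewrite mulrCA.
- by apply: SpanE (SpanD IH1 IH2) => e; rewrite mulrDr.
- by apply: SpanE IH => e; rewrite E.
Qed.

Lemma spanMM m n f g : span m f -> span n g -> span (m + n) (fun e => f e * g e).
Proof.
move=> sf sg; elim: sf => {m f} [c|m a f _ IH|m f1 f2 _ IH1 _ IH2|m f1 f2 E _ IH].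
- exact: spanZ.
- by apply: SpanE (SpanM a IH) => e; rewrite mulrA.
- by apply: SpanE (SpanD IH1 IH2) => e; rewrite mulrDl.
- by apply: SpanE IH => e; rewrite E.
Qed.

Lemma span_sum n (I : Type) (r : seq I) (P : pred I) (G : I -> A -> F) :
  (forall i, P i -> span n (G i)) -> span n (fun e => \sum_(i <- r | P i) G i e).
Proof.
move=> H; elim: r => [|i r IH].
  by apply: SpanE (span0 n) => e; rewrite big_nil.
case Pi : (P i); last by apply: SpanE IH => e; rewrite big_cons Pi.
by apply: SpanE (SpanD (H i Pi) IH) => e; rewrite big_cons Pi.
Qed.

Lemma span_prod (I : finType) (Y : {set I}) (al : I -> A) :
  span #|Y| (fun e => \prod_(i in Y) phi e (al i)).
Proof.
rewrite cardE; have H (r : seq I) : span (size r) (fun e => \prod_(i <- r) phi e (al i)).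
  elim: r => [|i r IH]; first by apply: SpanE (SpanC 1) => e; rewrite big_nil.
  by apply: SpanE (SpanM (al i) IH) => e; rewrite big_cons.
by apply: SpanE (H _) => e; rewrite -big_enum.
Qed.

Lemma span_prod_nat n (al : nat -> A) : span n (fun e => \prod_(0 <= j < n) phi e (al j)).
Proof.
elim: n => [|n IH]; first by apply: SpanE (SpanC 1) => e; rewrite big_geq.
by apply: SpanE (SpanM (al n) IH) => e; rewrite big_nat_recr //= mulrC.
Qed.

(** The three-term relation, read as linear dependence: the functions $\phi(\cdot,a)$ lie
    in a space of dimension two. *)
Lemma phi_pencil x y a e : phi x y != 0 ->
  phi e a = (phi a y / phi x y) * phi e x + (- (phi a x / phi x y)) * phi e y.
Proof.
move=> xy0; have := plucker s e a x y => /eqP; rewrite addrC addr_eq0 => /eqP E.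
have E2 : phi e a * phi x y = phi e x * phi a y - phi e y * phi a x.
  by rewrite E; ring.
by apply: (mulIf xy0); rewrite E2; field.
Qed.

(** Division by the elementary function with root [e0], with a multiple of a pure power at
    [e1] as remainder. *)
Lemma span_decomp n f e0 e1 : phi e1 e0 != 0 -> span n.+1 f ->
  exists c g, span n g /\ forall e, f e = c * phi e e1 ^+ n.+1 + phi e e0 * g e.
Proof.
move=> e10; move En : n.+1 => N sf.
have : (if N is N'.+1 then exists c g, span N' g /\
    forall e, f e = c * phi e e1 ^+ N + phi e e0 * g e
    else exists c, forall e, f e = c) : Prop.
  elim: sf => {n N En f} [c|n a f sf IH|n f1 f2 _ IH1 _ IH2|n f1 f2 E _ IH].
  - by exists c.
  - have [p [q pq]] : exists p q, forall e, phi e a = p * phi e e1 + q * phi e e0.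
      by eexists; eexists => e; exact: phi_pencil.
    case: n sf IH => [|n] sf IH.
      have [c fE] := IH; exists (p * c), (fun=> q * c); split; first exact: SpanC.
      by move=> e; rewrite fE pq; ring.
    have [c [g [sg fE]]] := IH; exists (p * c), (fun e => q * f e + p * (phi e e1 * g e)).
    split; first by apply: SpanD; apply: spanZ => //; exact: SpanM.
    by move=> e; rewrite pq mulrDl -mulrA {1}fE [_ ^+ n.+2]exprS; ring.
  - case: n IH1 IH2 => [|n].
      by move=> [c1 E1] [c2 E2]; exists (c1 + c2) => e; rewrite E1 E2.
    move=> [c1 [g1 [s1 E1]]] [c2 [g2 [s2 E2]]].
    exists (c1 + c2), (fun e => g1 e + g2 e); split; first exact: SpanD.
    by move=> e; rewrite E1 E2; ring.
  - case: n IH => [|n]; first by move=> [c E1]; exists c => e; rewrite -E.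
    by move=> [c [g [sg E1]]]; exists c, g; split=> // e; rewrite -E.
by rewrite -En.
Qed.

(** A root can be divided out, as for polynomials; nodes are distinct in the sense that
    the elementary functions separate them. *)
Lemma span_vanish n f (nodes : seq A) : span n f -> size nodes = n.+1 ->
  pairwise (fun x y => phi x y != 0) nodes -> {in nodes, forall x, f x = 0} ->
  forall e, f e = 0.
Proof.
elim: n f nodes => [|n IH] f [|e0 nodes] // sf.
  case: nodes => //= _ _ f0 e.
  have [c fE] : exists c, forall e, f e = c.
    move En : 0%N sf => N sf.
    have : (if N is 0 then exists c, forall e, f e = c else True) : Prop.
      elim: sf => {N En f f0} [c|//|m f1 f2 _ IH1 _ IH2|m f1 f2 E _ IH1]; first by exists c.
        by case: m IH1 IH2 => // -[c1 E1] [c2 E2]; exists (c1 + c2) => x; rewrite E1 E2.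
      by case: m IH1 => // -[c1 E1]; exists c1 => x; rewrite -E.
    by rewrite -En.
  by rewrite fE -(fE e0) f0 ?mem_head.
move=> [sz]; rewrite /= => /andP[/allP h0 hp] f0 e.
case: nodes sz h0 hp f0 => [//|e1 nodes] sz h0 hp f0.
have e01 : phi e0 e1 != 0 by apply: h0; rewrite mem_head.
have e10 : phi e1 e0 != 0 by rewrite phiC oppr_eq0.
have [c [g [sg fE]]] := span_decomp e10 sf.
have c0 : c = 0.
  have := f0 e0 (mem_head _ _); rewrite fE phixx mul0r addr0 => /eqP.
  by rewrite mulf_eq0 expf_eq0 /= (negPf e01) orbF => /eqP.
rewrite fE c0 mul0r add0r (IH g (e1 :: nodes)) ?mulr0 // => x xn.
have := f0 x; rewrite inE xn orbT => /(_ isT); rewrite fE c0 mul0r add0r => /eqP.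
by rewrite mulf_eq0 phiC oppr_eq0 (negPf (h0 x xn)) => /eqP.
Qed.

End Interpolation.
(** The shifted factorial $[a]_k=[a][a+h]\cdots[a+(k-1)h]$. *)
Definition bfac (a : A) (k : nat) : F := \prod_(0 <= j < k) br (a + j%:R * h).

Lemma sh0 a : bfac a 0 = 1. Proof. by rewrite /bfac big_geq. Qed.

Lemma shS a k : bfac a k.+1 = bfac a k * br (a + k%:R * h).
Proof. by rewrite /bfac big_nat_recr. Qed.

Lemma shD a m k : bfac a (m + k) = bfac a m * bfac (a + m%:R * h) k.
Proof.
elim: k => [|k IH]; first by rewrite addn0 sh0 mulr1.
by rewrite addnS !shS IH -mulrA; congr (_ * (_ * br _)); rewrite natrD; ring.
Qed.

Lemma shSl a k : bfac a k.+1 = br a * bfac (a + h) k.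
Proof. by rewrite -add1n shD shS sh0 mul1r !mul0r addr0 mul1r. Qed.

Lemma sh_neq0 a k : (forall j, (j < k)%N -> br (a + j%:R * h) != 0) -> bfac a k != 0.
Proof.
by move=> H; rewrite /bfac big_nat_cond prodf_seq_neq0; apply/allP => j _; apply/implyP => /andP[/andP[_ /H]].
Qed.

Lemma sh_rev a k : bfac (h - a - k%:R * h) k = (-1) ^+ k * bfac a k.
Proof.
elim: k a => [|k IH] a; first by rewrite !sh0 mulr1.
rewrite shSl shS (_ : h - a - k.+1%:R * h + h = h - a - k%:R * h); last by ring.
rewrite IH (_ : h - a - k.+1%:R * h = - (a + k%:R * h)); last by ring.
by rewrite brN exprS; ring.
Qed.

Section Weights.
Variable I : finType.
Implicit Types (S T Y : {set I}) (u : I -> A).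

(** The coefficient of the difference operator attached to [S] inside [Y], as in the
    Ruijsenaars operators. *)
Definition subset_weight u S Y : F :=
  \prod_(i in S) \prod_(j in Y :\: S) (br (u i - u j - h) / br (u i - u j)).

Lemma wt0 u Y : subset_weight u set0 Y = 1.
Proof. by rewrite /subset_weight big_set0. Qed.

Lemma wtYY u Y : subset_weight u Y Y = 1.
Proof. by rewrite /subset_weight big1 // => i _; rewrite setDv big_set0. Qed.

Lemma wt_shift u (t : A) S Y : subset_weight (fun i => u i + t) S Y = subset_weight u S Y.
Proof.
apply: eq_bigr => i _; apply: eq_bigr => j _.
by rewrite (_ : u i + t - (u j + t) = u i - u j) //; ring.
Qed.

Lemma prod_subset_split S T (H : I -> F) : S \subset T ->
  \prod_(i in T) H i = (\prod_(i in S) H i) * \prod_(i in T :\: S) H i.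
Proof. by move=> /setIidPr ST; rewrite (big_setID S) /= ST. Qed.

(** Both sides run over the pairs from [T] to [Y :\: T] and from [S] to [T :\: S], which
    the right side groups by whether the first element lies in [S]. This cocycle
    property makes products of the kernels below into Jackson sums. *)
Lemma wt_chain u S T Y : S \subset T -> T \subset Y ->
  subset_weight u T Y * subset_weight u S T = subset_weight u S Y * subset_weight u (T :\: S) (Y :\: S).
Proof.
move=> ST TY; rewrite /subset_weight.
have TSY : T :\: S \subset Y :\: S by exact: setSD.
have YE : Y :\: S :\: (T :\: S) = Y :\: T.
  apply/setP => i; rewrite !inE; have := subsetP ST i.
  by case: (i \in S) => // /(_ isT) ->.
rewrite YE (prod_subset_split _ ST).
under [X in _ = X * _]eq_bigr => i _ do rewrite (prod_subset_split _ TSY) YE.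
by rewrite big_split /=; ring.
Qed.

Lemma sum_subset_mem (i : I) Y (G : {set I} -> F) : i \in Y ->
  \sum_(S : {set I} | (S \subset Y) && (i \in S)) G S =
  \sum_(S : {set I} | S \subset Y :\ i) G (i |: S).
Proof.
move=> iY; rewrite (reindex_onto (fun S => i |: S) (fun S => S :\ i)) /=; last first.
  by move=> S /andP[_ iS]; rewrite setD1K.
apply: eq_bigl => S; rewrite setU11 andbT subUset sub1set iY /= subsetD1.
have [iS|iS] := boolP (i \in S); last by rewrite setU1K ?eqxx ?andbT.
rewrite andbF; apply/andP => -[_ /eqP E].
by move: iS; rewrite -E !inE eqxx.
Qed.

Section Jackson.
Implicit Types (e f C D s : A).

Definition jackson_term u e f C D Y S : F :=
  (-1) ^+ #|S| * subset_weight u S Y * (bfac e #|S| * bfac f #|S| / (bfac C #|S| * bfac D #|S|))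
  * (\prod_(i in S) (br (u i - C) * br (u i - D) / br (u i + #|S|%:R * h - h)))
  * (\prod_(i in Y :\: S) (br (u i - e) * br (u i - f) / br (u i + #|S|%:R * h))).

Definition jackson_value u e f C D Y : F :=
  (-1) ^+ #|Y| * (bfac (C - e) #|Y| * bfac (C - f) #|Y| / (bfac C #|Y| * bfac D #|Y|))
  * \prod_(i in Y) br (u i - e - f).

Definition jackson_generic u C D s Y :=
  [/\ {in Y &, forall i j, i != j -> br (u i - u j) != 0},
      {in Y, forall i m, (m < #|Y|)%N -> br (u i + m%:R * h) != 0},
      bfac C #|Y| != 0 /\ bfac D #|Y| != 0,
      {in Y, forall i, br (s - u i) != 0} &
      {in Y &, forall i j m, i != j -> (m < #|Y|)%N -> br (s - u i - u j - m%:R * h) != 0}].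

Lemma jackson_term_span u s C D Y S : S \subset Y ->
  span s #|Y| (fun e => jackson_term u e (s - e) C D Y S).
Proof.
move=> SY.
have YE : (#|S| + #|Y :\: S| = #|Y|)%N by rewrite -(cardsID S Y) (setIidPr SY).
have := spanMM (span_prod_nat s #|S| (fun j => - (j%:R * h))) (span_prod s (Y :\: S) u).
rewrite YE => H.
pose c := (-1) ^+ #|S| * subset_weight u S Y / (bfac C #|S| * bfac D #|S|)
  * (\prod_(i in S) (br (u i - C) * br (u i - D) / br (u i + #|S|%:R * h - h)))
  * (\prod_(i in Y :\: S) (br (u i + #|S|%:R * h))^-1).
apply: SpanE (spanZ c H) => e; rewrite /jackson_term /c; cbv beta.
have -> : \prod_(0 <= j < #|S|) pairbr s e (- (j%:R * h)) = bfac e #|S| * bfac (s - e) #|S|.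
  rewrite /bfac -big_split /=; apply: eq_bigr => j _.
  by rewrite /pairbr opprK.
have -> : \prod_(i in Y :\: S) pairbr s e (u i) =
    (\prod_(i in Y :\: S) br (u i - e)) * \prod_(i in Y :\: S) br (u i - (s - e)).
  rewrite -big_split /=; apply: eq_bigr => i _; rewrite /pairbr brB mulNr -mulrN -brN.
  by congr (_ * br _); ring.
rewrite !big_split /=; ring.
Qed.

Lemma jackson_value_span u s C D Y :
  span s #|Y| (fun e => jackson_value u e (s - e) C D Y).
Proof.
pose c := (-1) ^+ #|Y| / (bfac C #|Y| * bfac D #|Y|) * \prod_(i in Y) br (u i - s).
apply: SpanE (spanZ c (span_prod_nat s #|Y| (fun j => C + j%:R * h))) => e.
rewrite /jackson_value /c; cbv beta.
have -> : \prod_(0 <= j < #|Y|) pairbr s e (C + j%:R * h) = bfac (C - e) #|Y| * bfac (C - (s - e)) #|Y|.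
  rewrite /bfac -big_split /=; apply: eq_bigr => j _; rewrite /pairbr brB mulNr -mulrN -brN.
  by congr (br _ * br _); ring.
have -> : \prod_(i in Y) br (u i - e - (s - e)) = \prod_(i in Y) br (u i - s).
  by apply: eq_bigr => i _; congr br; ring.
by ring.
Qed.

(** The factor [bfac 0 #|S|] leaves only the empty set. *)
Lemma jackson_at0 u s C D Y : C + D + #|Y|%:R * h = s + h ->
  {in Y, forall i, br (u i) != 0} -> bfac C #|Y| != 0 -> bfac D #|Y| != 0 ->
  \sum_(S : {set I} | S \subset Y) jackson_term u 0 (s - 0) C D Y S =
  jackson_value u 0 (s - 0) C D Y.
Proof.
move=> bal u0 C0 D0; rewrite subr0 (bigD1 set0) ?sub0set //= big1 => [|S /andP[_ S0]]; last first.
  rewrite /jackson_term; have [k ->] : exists k, #|S| = k.+1.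
    by exists #|S|.-1; rewrite prednK // card_gt0.
  by rewrite shSl br0 !mul0r !mulr0 !mul0r.
rewrite /jackson_term /jackson_value wt0 cards0 !sh0 big_set0 finset.setD0 addr0 expr0 !mulr1 divr1 mul1r.
have -> : C - s = h - D - #|Y|%:R * h by rewrite -[C](addrK (D + #|Y|%:R * h)) addrA bal; ring.
rewrite sh_rev !subr0.
have -> : (-1) ^+ #|Y| * (bfac C #|Y| * ((-1) ^+ #|Y| * bfac D #|Y|) / (bfac C #|Y| * bfac D #|Y|)) =
    (-1) ^+ #|Y| * (-1) ^+ #|Y| by field; rewrite C0 D0.
rewrite -exprMn mulrNN mulr1 expr1n !mul1r; apply: eq_bigr => i iY.
by rewrite !subr0 mul0r addr0 mulrAC divff ?mul1r // u0.
Qed.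

(** The factor [br (u i - u i)] kills the sets that avoid [i]; for the others, the factors
    that involve [i] turn the term into the one of [Y :\ i] with [u], [C] and [D] shifted by [h]. *)
Lemma jackson_node u s C D Y i : C + D + #|Y|%:R * h = s + h -> i \in Y ->
  jackson_generic u C D s Y ->
  \sum_(S : {set I} | S \subset Y) jackson_term u (u i) (s - u i) C D Y S =
  - (br (s - u i) * br (u i - C) * br (u i - D) / (br C * br D)) *
  \sum_(S : {set I} | S \subset Y :\ i)
     jackson_term (fun j => u j + h) (u i) (s - u i + h) (C + h) (D + h) (Y :\ i) S.
Proof.
move=> bal iY [g1 g2 [g3 g3'] g4 g5].
rewrite (bigID (fun S : {set I} => i \in S)) /= [X in _ + X]big1 ?addr0; last first.
  move=> S /andP[_ iS]; rewrite /jackson_term [X in _ * X](bigD1 i) /=; last by rewrite inE iS iY.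
  by rewrite subrr br0 !mul0r !mulr0.
rewrite sum_subset_mem // mulr_sumr; apply: eq_bigr => S SY.
have iS : i \notin S by apply/negP => /(subsetP SY); rewrite !inE eqxx.
have YSE : Y :\: (i |: S) = Y :\ i :\: S.
  by apply/setP => j; rewrite !inE negb_or; case: (j == i); case: (j \in S).
have cE : #|i |: S| = #|S|.+1 by rewrite cardsU1 iS.
have YN : #|Y| = #|Y :\ i|.+1 by rewrite (cardsD1 i) iY.
have SN : (#|S| < #|Y|)%N by rewrite YN ltnS subset_leq_card.
rewrite /jackson_term cE YSE wt_shift.
have -> : subset_weight u (i |: S) Y = subset_weight u S (Y :\ i) *
    \prod_(j in Y :\ i :\: S) (br (u i - u j - h) / br (u i - u j)).
  by rewrite /subset_weight YSE big_setU1 //= mulrC.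
rewrite (shSl (s - u i)) (shSl C) (shSl D) big_setU1 //=.
have -> : u i + #|S|.+1%:R * h - h = u i + #|S|%:R * h by ring.
have -> : \prod_(j in S) (br (u j - C) * br (u j - D) / br (u j + #|S|.+1%:R * h - h)) =
   \prod_(j in S) (br (u j + h - (C + h)) * br (u j + h - (D + h)) / br (u j + h + #|S|%:R * h - h)).
  by apply: eq_bigr => j _; congr (br _ * br _ / br _); ring.
set P1 := \prod_(j in S) _.
have -> : (\prod_(j in Y :\ i :\: S) (br (u j + h - u i) * br (u j + h - (s - u i + h)) / br (u j + h + #|S|%:R * h)))
  = (\prod_(j in Y :\ i :\: S) (br (u i - u j - h) / br (u i - u j))) *
    \prod_(j in Y :\ i :\: S) (br (u j - u i) * br (u j - (s - u i)) / br (u j + #|S|.+1%:R * h)).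
  rewrite -big_split /=; apply: eq_bigr => j; rewrite !inE => /and3P[_ ji jY].
  have nz : br (u i - u j) != 0 by apply: g1 => //; rewrite eq_sym.
  have -> : u j + h - u i = - (u i - u j - h) by ring.
  have -> : u j + h - (s - u i + h) = u j - (s - u i) by ring.
  have -> : u j + h + #|S|%:R * h = u j + #|S|.+1%:R * h by ring.
  by rewrite brN (brB (u j) (u i)) -[LHS]mul1r -(mulVf nz); ring.
set P2 := \prod_(j in Y :\ i :\: S) _; set P3 := \prod_(j in Y :\ i :\: S) _.
have d0 : br (u i + #|S|%:R * h) != 0 by exact: g2.
have -> : bfac (u i) #|S|.+1 = bfac (u i) #|S| * br (u i + #|S|%:R * h) by exact: shS.
have H1 (z : F) : z = br (u i + #|S|%:R * h) / br (u i + #|S|%:R * h) * z.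
  by rewrite mulfV ?mul1r.
by rewrite exprS !invfM [RHS]H1; ring.
Qed.

Lemma jackson_value_node u s C D Y i : C + D + #|Y|%:R * h = s + h -> i \in Y ->
  jackson_value u (u i) (s - u i) C D Y =
  - (br (s - u i) * br (u i - C) * br (u i - D) / (br C * br D)) *
  jackson_value (fun j => u j + h) (u i) (s - u i + h) (C + h) (D + h) (Y :\ i).
Proof.
move=> bal iY; rewrite /jackson_value.
have YN : #|Y| = #|Y :\ i|.+1 by rewrite (cardsD1 i) iY.
rewrite YN in bal *; set n := #|Y :\ i| in bal *.
rewrite (big_setD1 i) //= (shSl C) (shSl D) (shSl (C - u i)) (shS (C - (s - u i))).
have -> : C - (s - u i) + n%:R * h = u i - D.
  by rewrite -[C](addrK (D + n.+1%:R * h)) addrA bal; ring.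
have -> : C + h - (s - u i + h) = C - (s - u i) by ring.
have -> : C + h - u i = C - u i + h by ring.
have -> : \prod_(j in Y :\ i) br (u j + h - u i - (s - u i + h)) = \prod_(j in Y :\ i) br (u j - u i - (s - u i)).
  by apply: eq_bigr => j _; congr br; ring.
have -> : br (u i - u i - (s - u i)) = - br (s - u i) by rewrite -brN; congr br; ring.
by rewrite (brB C (u i)) exprS !invfM; ring.
Qed.

Lemma jackson_generic_node u s C D Y i : i \in Y -> jackson_generic u C D s Y ->
  jackson_generic (fun j => u j + h) (C + h) (D + h) (s + h) (Y :\ i).
Proof.
move=> iY [g1 g2 [g3 g3'] g4 g5].
have YN : #|Y| = #|Y :\ i|.+1 by rewrite (cardsD1 i) iY.
have sub : {subset Y :\ i <= Y} by exact/subsetP/subsetDl.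
split=> [j k /sub jY /sub kY jk|j /sub jY m mY|| j /sub jY|j k /sub jY /sub kY m jk mY].
- by rewrite (_ : _ - _ = u j - u k); [exact: g1 | ring].
- rewrite (_ : _ + _ = u j + m.+1%:R * h); last by ring.
  by apply: g2 => //; rewrite YN.
- by move: g3 g3'; rewrite YN !shSl !mulf_eq0 !negb_or => /andP[_ ->] /andP[_ ->].
- by rewrite (_ : _ - _ = s - u j); [exact: g4 | ring].
rewrite (_ : _ - _ = s - u j - u k - m.+1%:R * h); last by ring.
by apply: g5 => //; rewrite YN.
Qed.

(** Interpolation in [e] along [e + f = s]. The values at the nodes are known by the
    induction hypothesis. *)
Theorem jackson_sum u e f C D Y : C + D + #|Y|%:R * h = e + f + h ->
  jackson_generic u C D (e + f) Y ->
  \sum_(S : {set I} | S \subset Y) jackson_term u e f C D Y S = jackson_value u e f C D Y.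
Proof.
move En : #|Y| => n; elim: n Y u e f C D En => [|n IH] Y u e f C D En.
  move=> _ _; have -> : Y = set0 by apply/eqP; rewrite -cards_eq0 En.
  rewrite (big_pred1 set0) => [|S]; last by rewrite subset0.
  rewrite /jackson_term /jackson_value wt0 cards0 !sh0 finset.setD0 !big_set0.
  by rewrite !mulr1 divr1.
set s := e + f => bal gen.
have {bal} bal : C + D + #|Y|%:R * h = s + h by rewrite En.
have fE : f = s - e by rewrite /s; ring.
(* The difference of the two sides, with e + f = s fixed, is tested at 0 and at the nodes. *)
pose G e := (\sum_(S : {set I} | S \subset Y) jackson_term u e (s - e) C D Y S)
   + (- 1) * jackson_value u e (s - e) C D Y.
suff G0 : G e = 0.
  by move: G0 => /eqP; rewrite /G mulN1r subr_eq0 -fE => /eqP.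
have Gsp : span s n.+1 G.
  rewrite -En; apply: SpanD; last by apply: spanZ; exact: jackson_value_span.
  by apply: span_sum => S SY; exact: jackson_term_span.
have [g1 g2 [g3 g3'] g4 g5] := gen.
have u0 : {in Y, forall i, br (u i) != 0}.
  by move=> i iY; have := g2 i iY 0%N; rewrite En mul0r addr0 => /(_ isT).
apply: (@span_vanish s n.+1 G (0 :: [seq u i | i <- enum Y])) => //.
- by rewrite /= size_map -cardE En.
- rewrite /=; apply/andP; split.
    apply/allP => _ /mapP[i iY ->]; rewrite mem_enum in iY.
    rewrite phiC oppr_eq0 /pairbr !subr0 mulf_neq0 ?u0 ?g4 //.
  rewrite pairwise_map; have : uniq (enum Y) by exact: enum_uniq.
  have : {subset enum Y <= Y} by move=> i; rewrite mem_enum.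
  elim: (enum Y) => //= i r IHr sub /andP[ir ur].
  have iY : i \in Y by apply: sub; rewrite mem_head.
  have subr : {subset r <= Y} by move=> j jr; apply: sub; rewrite inE jr orbT.
  rewrite IHr // andbT; apply/allP => j jr.
  have ij : i != j by apply: contraNneq ir => ->.
  have jY := subr j jr.
  rewrite /= /pairbr mulf_neq0 ?g1 //.
  rewrite (_ : s - u i - u j = s - u i - u j - 0%:R * h); last by ring.
  by apply: g5; rewrite ?En.
move=> x; rewrite inE => /predU1P[->|/mapP[i + ->]].
  by rewrite /G jackson_at0 // mulN1r subrr.
rewrite mem_enum => iY; rewrite /G (jackson_node bal iY gen) (jackson_value_node u bal iY) IH.
- by rewrite mulN1r subrr.
- by move: En; rewrite (cardsD1 i) iY => -[].
- have YN : #|Y| = #|Y :\ i|.+1 by rewrite (cardsD1 i) iY.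
  have nE : n = #|Y :\ i| by move: En; rewrite YN => -[].
  rewrite [RHS](_ : _ = (s + h) + h); last by ring.
  by rewrite -bal YN nE; ring.
have -> : u i + (s - u i + h) = s + h by ring.
exact: jackson_generic_node.
Qed.

End Jackson.
End Weights.
End Bracket.

(** * An inverse pair of subset kernels *)

(** Inverse matrices commute, so the relation [M b = b'] inverts to [b = C b'], which is
    then paired with [a]. *)
Lemma bailey_transform (F : fieldType) (P : finType) (M C : P -> P -> F) (a a' b b' : P -> F) :
  (forall x z, \sum_y M x y * C y z = (x == z)%:R) ->
  (forall x, \sum_y M x y * b y = b' x) ->
  (forall y, \sum_x a x * C x y = a' y) ->
  \sum_x a x * b x = \sum_y a' y * b' y.
Proof.
move=> MC Mb aC; pose mx (G : P -> P -> F) := \matrix_(i < #|P|, j < #|P|) G (enum_val i) (enum_val j).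
have sumE (G : P -> F) : \sum_(i < #|P|) G (enum_val i) = \sum_x G x.
  by rewrite [RHS](reindex (@enum_val P predT)) //; apply: onW_bij; exact: enum_val_bij.
have MC1 : mx M *m mx C = 1%:M.
  apply/matrixP => i j; rewrite !mxE; under eq_bigr do rewrite !mxE.
  by rewrite (sumE (fun y => M (enum_val i) y * C y (enum_val j))) MC (inj_eq enum_val_inj).
have CM x z : \sum_y C x y * M y z = (x == z)%:R.
  have /matrixP/(_ (enum_rank x) (enum_rank z)) := mulmx1C MC1.
  rewrite !mxE (inj_eq enum_rank_inj) => <-; under [RHS]eq_bigr do rewrite !mxE !enum_rankK.
  by rewrite (sumE (fun y => C x y * M y z)).
have bE x : b x = \sum_y C x y * b' y.
  under eq_bigr do rewrite -Mb mulr_sumr.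
  rewrite exchange_big /= (eq_bigr (fun z => (x == z)%:R * b z)) => [|z _]; last first.
    by rewrite -CM mulr_suml; apply: eq_bigr => y _; rewrite mulrA.
  rewrite (bigD1 x) //= eqxx mul1r big1 ?addr0 // => z zx.
  by rewrite eq_sym (negPf zx) mul0r.
under eq_bigr do rewrite bE mulr_sumr.
rewrite exchange_big /=; apply: eq_bigr => y _; rewrite -aC mulr_suml.
by apply: eq_bigr => x _; rewrite mulrA.
Qed.

Section Bailey.
Variables (A : comNzRingType) (F : fieldType) (br : A -> F).
Hypothesis brN : forall x, br (- x) = - br x.
Hypothesis br0 : br 0 = 0.
Hypothesis plucker : forall s x y u v,
  pairbr br s x y * pairbr br s u v - pairbr br s x u * pairbr br s y v
  + pairbr br s x v * pairbr br s y u = 0.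
Variable h : A.
Local Notation sh := (bfac br h).

Variable I : finType.
Local Notation wt := (@subset_weight A F br h I).
Local Notation N := #|I|.
Variables (u : I -> A) (b C D e f : A).
Let lam := C + D - b - h.
Let g := e + f - lam - N%:R * h.

Hypothesis u_distinct : forall i j, i != j -> br (u i - u j) != 0.
Hypothesis u_neq0 : forall i m, (m < N)%N -> br (u i + m%:R * h) != 0.
Hypothesis ub_neq0 : forall i, br (u i - b) != 0.
Hypothesis lam_neq0 : forall m, (m <= N.*2)%N -> br (lam + m%:R * h) != 0.
Hypothesis C_neq0 : sh C N != 0.
Hypothesis D_neq0 : sh D N != 0.
Hypothesis g_neq0 : sh g N != 0.
Hypothesis lame_neq0 : sh (lam + h - e) N != 0.
Hypothesis lamf_neq0 : sh (lam + h - f) N != 0.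
Hypothesis uC_neq0 : forall i m, (m <= N)%N -> br (u i - C + m%:R * h) != 0.
Hypothesis CD1 : forall i m, (m < N)%N -> br (C + D - u i + m%:R * h) != 0.
Hypothesis CD2 : forall i j m, (m < N)%N -> i != j -> br (C + D - u i - u j + m%:R * h) != 0.
Hypothesis CL1 : forall i m, (m <= N)%N -> br (C + lam - u i + m%:R * h) != 0.
Hypothesis CL2 : forall i j m, (m <= N)%N -> i != j -> br (C + lam - u i - u j + m%:R * h) != 0.
Hypothesis EF1 : forall i m, (m <= N)%N -> br (e + f - u i + m%:R * h) != 0.
Hypothesis EF2 : forall i j m, (m < N)%N -> i != j -> br (e + f - u i - u j - m%:R * h) != 0.

Lemma sh_le a m k : (m <= k)%N -> sh a k != 0 -> sh a m != 0.
Proof. by move=> /subnKC <-; rewrite shD mulf_eq0 negb_or => /andP[]. Qed.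

Lemma sh_lam_neq0 j m : (j + m <= N.*2.+1)%N -> sh (lam + j%:R * h) m != 0.
Proof.
move=> jm; apply: sh_neq0 => k km.
rewrite (_ : lam + j%:R * h + k%:R * h = lam + (j + k)%:R * h); last by rewrite natrD; ring.
by apply: lam_neq0; lia.
Qed.

Lemma sh_lam1_neq0 m : (m <= N.*2)%N -> sh (lam + h) m != 0.
Proof.
by move=> mN; rewrite (_ : lam + h = lam + 1%:R * h); [apply: sh_lam_neq0; lia | ring].
Qed.

(** The part of a Jackson term on [T] that does not involve [b], [C] and [D], when the second
    numerator parameter is [lam + #|T| h]. *)
Definition kerM (T S : {set I}) : F :=
  if S \subset T then
  (-1) ^+ #|S| * wt u S T * sh (lam + #|T|%:R * h) #|S|
  * (\prod_(i in S) (br (u i + #|S|%:R * h - h))^-1)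
  * (\prod_(i in T :\: S) (br (u i - lam - #|T|%:R * h) / br (u i + #|S|%:R * h)))
  else 0.

Definition cJ (J : nat) : F := (-1) ^+ J * sh lam J * br (lam + J.*2%:R * h) / br lam.

(** The inverse of [kerM], with the very-well-poised factor [cJ]. *)
Definition kerC (T S : {set I}) : F :=
  if S \subset T then
  cJ #|S| * wt u S T / sh (lam + h) (#|T| + #|S|)
  * (\prod_(i in S) br (u i + #|T|%:R * h - h))
  * (\prod_(i in T :\: S) br (u i - lam - #|S|.+1%:R * h))
  else 0.

Lemma card_le (S : {set I}) : (#|S| <= N)%N. Proof. exact: max_card. Qed.

Lemma card_lt_ex (S : {set I}) i : i \in S -> (0 < #|S|)%N.
Proof. by move=> iS; rewrite card_gt0; apply/set0Pn; exists i. Qed.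

Lemma signMM n : (-1) ^+ n * (-1) ^+ n = 1 :> F.
Proof. by rewrite -exprMn mulrNN mulr1 expr1n. Qed.

(** A Jackson sum on [T]: it is balanced because [lam = C + D - b - h]. *)
Lemma kerM_b T :
  \sum_S kerM T S * (sh b #|S| / (sh C #|S| * sh D #|S|)
      * \prod_(i in S) (br (u i - C) * br (u i - D) / br (u i - b))) =
  sh (C - b) #|T| * sh (D - b) #|T| / (sh C #|T| * sh D #|T|)
      * \prod_(i in T) (br (u i - b - lam - #|T|%:R * h) / br (u i - b)).
Proof.
have TN := card_le T.
have bal : C + D + #|T|%:R * h = b + (lam + #|T|%:R * h) + h by rewrite /lam; ring.
have s1 (x : A) : b + (lam + #|T|%:R * h) - x = C + D - x + #|T|%:R * h - h by rewrite /lam; ring.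
have gen : jackson_generic br h u C D (b + (lam + #|T|%:R * h)) T.
  split=> [i j _ _|i _ m mT||i iT|i j iT _ m ij mT].
  - exact: u_distinct.
  - by apply: u_neq0; lia.
  - by split; [exact: sh_le C_neq0 | exact: sh_le D_neq0].
  - have T0 := card_lt_ex iT.
    rewrite s1 (_ : _ - _ = C + D - u i + #|T|.-1%:R * h); first by apply: CD1; lia.
    by rewrite -{1}(prednK T0); ring.
  have T0 := card_lt_ex iT.
  rewrite s1 (_ : _ - _ = C + D - u i - u j + (#|T|.-1 - m)%:R * h); first by apply: CD2 => //; lia.
  rewrite natrB; last by lia.
  by rewrite -{1}(prednK T0); ring.
have J := jackson_sum brN br0 plucker bal gen.
rewrite (bigID (fun S : {set I} => S \subset T)) /= [X in _ + X]big1 ?addr0; last first.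
  by move=> S ST; rewrite /kerM (negPf ST) mul0r.
have ub0 (S : {set I}) : \prod_(i in S) br (u i - b) != 0 by apply/prodf_neq0 => i _; exact: ub_neq0.
have H (S : {set I}) : S \subset T -> kerM T S * (sh b #|S| / (sh C #|S| * sh D #|S|)
      * \prod_(i in S) (br (u i - C) * br (u i - D) / br (u i - b))) =
   jackson_term br h u b (lam + #|T|%:R * h) C D T S / \prod_(i in T) br (u i - b).
  move=> ST; rewrite /kerM ST /jackson_term !big_split /= !prodfV.
  rewrite (prod_subset_split (fun i => br (u i - b)) ST).
  have -> : \prod_(i in T :\: S) br (u i - (lam + #|T|%:R * h)) = \prod_(i in T :\: S) br (u i - lam - #|T|%:R * h).
    by apply: eq_bigr => i _; congr br; ring.
  rewrite !invfM; have V (x z : F) : x != 0 -> z = x / x * z by move=> x0; rewrite mulfV ?mul1r.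
  rewrite [LHS](V _ _ (ub0 (T :\: S))); ring.
rewrite (eq_bigr _ H) -mulr_suml J.
rewrite /jackson_value big_split /= prodfV.
have -> : \prod_(i in T) br (u i - b - (lam + #|T|%:R * h)) = \prod_(i in T) br (u i - b - lam - #|T|%:R * h).
  by apply: eq_bigr => i _; congr br; ring.
have -> : C - (lam + #|T|%:R * h) = h - (D - b) - #|T|%:R * h + h - h by rewrite /lam; ring.
rewrite addrK sh_rev //; transitivity ((-1) ^+ #|T| * (-1) ^+ #|T| *
  (sh (C - b) #|T| * sh (D - b) #|T| / (sh C #|T| * sh D #|T|)
    * (\prod_(i in T) br (u i - b - lam - #|T|%:R * h) / \prod_(i in T) br (u i - b)))).
  by ring.
by rewrite signMM mul1r.
Qed.

Lemma sum_above (X : {set I}) (G : {set I} -> F) :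
  \sum_(T : {set I} | X \subset T) G T = \sum_(V : {set I} | V \subset ~: X) G (X :|: V).
Proof.
rewrite (reindex_onto (fun V => X :|: V) (fun T => T :\: X)) /=; last first.
  by move=> T XT; rewrite setUC setDE; apply/setP => i; rewrite !inE; have := subsetP XT i; case: (i \in X) => //= [->//|_]; rewrite andbT orbF.
apply: eq_bigl => V; rewrite subsetUl /=; apply/eqP/idP => [<-|VX].
  by apply/subsetP => i; rewrite !inE => /andP[].
apply/setP => i; rewrite !inE; have := subsetP VX i; rewrite inE.
by case: (i \in X); case: (i \in V) => //= /(_ isT).
Qed.

(** By [wt_chain] the sum over the sets between [X] and [Y] is a Jackson sum on [Y :\: X],
    with [e] equal to its own denominator parameter [C]. Its value contains [bfac 0 #|Y :\: X|],
    which vanishes unless [X = Y]. The choice of [C] is immaterial as it cancels. *)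
Lemma kerMC Y X : \sum_T kerM Y T * kerC T X = (Y == X)%:R.
Proof.
have [XY|XY] := boolP (X \subset Y); last first.
  rewrite big1 => [|T _]; first by case: eqP XY => // ->; rewrite subxx.
  rewrite /kerM /kerC; case: ifP => TY; rewrite ?mul0r //; case: ifP => XT; rewrite ?mulr0 //.
  by move: XY; rewrite (subset_trans XT TY).
pose n := #|Y :\: X|; pose J := #|X|.
have YN : (J + n = #|Y|)%N by rewrite /J /n -(cardsID X Y) (setIidPr XY).
have YN' := card_le Y.
pose u' i := u i + J%:R * h; pose D' := lam + J.*2.+1%:R * h; pose f' := lam + (#|Y| + J)%:R * h.
pose P := \prod_(i in Y :\: X) br (u' i - C).
pose c := cJ J * wt u X Y * (-1) ^+ J * sh (lam + #|Y|%:R * h) J / sh (lam + h) J.*2.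
have H T : kerM Y T * kerC T X = if (X \subset T) && (T \subset Y) then
    c / P * jackson_term br h u' C f' C D' (Y :\: X) (T :\: X) else 0.
  rewrite /kerM /kerC; have [TY|_] := boolP (T \subset Y); last by rewrite andbF mul0r.
  have [XT|_] := boolP (X \subset T); last by rewrite mulr0.
  rewrite /=; pose k := #|T :\: X|.
  have kE : #|T| = (J + k)%N by rewrite /J /k -(cardsID X T) (setIidPr XT).
  have kY : (J + k <= #|Y|)%N by rewrite -kE subset_leq_card.
  have YTE : Y :\: X :\: (T :\: X) = Y :\: T.
    by apply/setP => i; rewrite !inE; have := subsetP XT i; case: (i \in X) => // /(_ isT) ->.
  rewrite /jackson_term -/k YTE wt_shift !big_split /= !prodfV kE.
  have P0 : P != 0.
    apply/prodf_neq0 => i _; rewrite (_ : u' i - C = u i - C + J%:R * h); last by rewrite /u'; ring.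
    by apply: uC_neq0; clear -YN YN'; lia.
  have TYX : T :\: X \subset Y :\: X by exact: setSD.
  have PE : P = (\prod_(i in T :\: X) br (u' i - C)) * \prod_(i in Y :\: T) br (u' i - C).
    by rewrite /P (prod_subset_split _ TYX) YTE.
  have C0 : sh C k != 0 by apply: sh_le C_neq0; clear -kY YN'; lia.
  have X0 : \prod_(i in X) br (u i + (J + k)%:R * h - h) != 0.
    apply/prodf_neq0 => i iX; have J0 := card_lt_ex iX.
    rewrite (_ : _ - _ = u i + (J + k).-1%:R * h); first by apply: u_neq0; clear -kY YN' J0; rewrite -/J in J0; lia.
    have -> : (J + k)%N = (J + k).-1.+1 by clear -J0; rewrite -/J in J0; lia.
    by rewrite /= ; ring.
  have -> : sh f' k = sh (lam + #|Y|%:R * h) (J + k) / sh (lam + #|Y|%:R * h) J.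
    rewrite shD mulrC mulKf; last by apply: sh_lam_neq0; clear -kY YN'; lia.
    by congr bfac; rewrite /f' natrD; ring.
  have -> : sh D' k = sh (lam + h) (J + k + J) / sh (lam + h) J.*2.
    have -> : (J + k + J = J.*2 + k)%N by clear; lia.
    rewrite shD mulrC mulKf; first by congr bfac; rewrite /D' -addn1 natrD; ring.
    by apply: sh_lam1_neq0; clear -kY YN'; lia.
  rewrite (prod_subset_split _ XT) PE /c -/J.
  have -> : \prod_(i in T :\: X) br (u' i - D') = \prod_(i in T :\: X) br (u i - lam - J.+1%:R * h).
    by apply: eq_bigr => i _; congr br; rewrite /u' /D' -addnn -addSn natrD; ring.
  have -> : \prod_(i in Y :\: T) br (u' i - f') = \prod_(i in Y :\: T) br (u i - lam - #|Y|%:R * h).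
    by apply: eq_bigr => i _; congr br; rewrite /u' /f' natrD; ring.
  have -> : \prod_(i in T :\: X) br (u' i + k%:R * h - h) = \prod_(i in T :\: X) br (u i + (J + k)%:R * h - h).
    by apply: eq_bigr => i _; congr br; rewrite /u' natrD; ring.
  have -> : \prod_(i in Y :\: T) br (u' i + k%:R * h) = \prod_(i in Y :\: T) br (u i + (J + k)%:R * h).
    by apply: eq_bigr => i _; congr br; rewrite /u' natrD; ring.
  have [Q1 Q2] : \prod_(i in T :\: X) br (u' i - C) != 0 /\ \prod_(i in Y :\: T) br (u' i - C) != 0.
    by move: P0; rewrite PE mulf_eq0 negb_or => /andP[].
  have s1 : sh (lam + #|Y|%:R * h) J != 0 by apply: sh_lam_neq0; clear -kY YN'; lia.
  have s2 : sh (lam + h) J.*2 != 0 by apply: sh_lam1_neq0; clear -kY YN'; lia.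
  have W := wt_chain br h u XT TY.
  set q1 := \prod_(i in T :\: X) br (u' i - C) in Q1 *; set q2 := \prod_(i in Y :\: T) br (u' i - C) in Q2 *.
  set px := \prod_(i in X) _ in X0 *; set p1 := \prod_(i in T :\: X) br (u i + _ - h).
  set p2 := \prod_(i in T :\: X) _; set p3 := \prod_(i in Y :\: T) _; set p4 := \prod_(i in Y :\: T) _.
  set sC := sh C k in C0 *; set r1 := sh (lam + _) J in s1 *; set r2 := sh (lam + h) J.*2 in s2 *.
  set r3 := sh _ (J + k); set r4 := sh _ (J + k + J).
  pose L w := (-1) ^+ J * (-1) ^+ k * w * r3 * (p1^-1 * p4 * p3^-1 * cJ J * r4^-1 * p2).
  transitivity (px / px * L (wt u T Y * wt u X T)); first by rewrite /L !invfM exprD; ring.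
  rewrite W divff // mul1r.
  transitivity ((q1 / q1) * (q2 / q2) * (sC / sC) * (r1 / r1) * (r2 / r2) *
      L (wt u X Y * wt u (T :\: X) (Y :\: X))); first by rewrite !divff // !mul1r.
  by rewrite /L !invfM invrK; ring.
rewrite (eq_bigr _ (fun T _ => H T)) -big_mkcond /=.
have -> : \sum_(T : {set I} | (X \subset T) && (T \subset Y)) c / P * jackson_term br h u' C f' C D' (Y :\: X) (T :\: X)
   = c / P * \sum_(V : {set I} | V \subset Y :\: X) jackson_term br h u' C f' C D' (Y :\: X) V.
  rewrite mulr_sumr big_mkcondr sum_above -big_mkcondr /=.
  have VX (V : {set I}) : V \subset ~: X -> (X :|: V) :\: X = V.
    move=> VX; apply/setP => i; rewrite !inE; have := subsetP VX i; rewrite inE.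
    by case: (i \in X); case: (i \in V) => //= /(_ isT).
  apply: eq_big => [V|V /andP[/VX -> _]] //.
  by rewrite subUset XY /= subsetD disjoints_subset andbC.
have u'E i (m : nat) : u' i + m%:R * h = u i + (J + m)%:R * h by rewrite /u' natrD; ring.
have sE : C + f' = C + lam + (#|Y| + J)%:R * h by rewrite /f'; ring.
have bal : C + D' + n%:R * h = C + f' + h.
  by rewrite /D' /f' -YN !natrD -addnn -addn1 !natrD; ring.
have gen : jackson_generic br h u' C D' (C + f') (Y :\: X).
  split=> [i j _ _ ij|i _ m mn||i _|i j _ _ m ij mn].
  - by rewrite (_ : u' i - u' j = u i - u j); [exact: u_distinct | rewrite /u'; ring].
  - rewrite -/n in mn; rewrite u'E; apply: u_neq0; clear -mn YN YN'; lia.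
  - rewrite -/n; split; first by apply: sh_le C_neq0; clear -YN YN'; lia.
    by apply: sh_lam_neq0; clear -YN YN'; lia.
  - rewrite (_ : C + f' - u' i = C + lam - u i + #|Y|%:R * h); first exact: CL1.
    by rewrite /f' /u' natrD; ring.
  rewrite (_ : C + f' - u' i - u' j - m%:R * h = C + lam - u i - u j + (n - m)%:R * h).
    by apply: CL2 => //; clear -YN YN'; lia.
  rewrite natrB; last by rewrite -/n in mn; exact: ltnW.
  by rewrite /f' /u' -YN !natrD; ring.
have C0 : sh C n != 0 by apply: sh_le C_neq0; clear -YN YN'; lia.
rewrite (jackson_sum brN br0 plucker bal gen) /jackson_value -/n subrr.
have P0 : P != 0.
  apply/prodf_neq0 => i _; rewrite (_ : u' i - C = u i - C + J%:R * h); last by rewrite /u'; ring.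
  by apply: uC_neq0; clear -YN YN'; lia.
case: (posnP n) => [n0|n0]; last first.
  have -> : sh 0 n = 0 by rewrite -(prednK n0) shSl br0 mul0r.
  have /negPf -> : Y != X by apply: contraTneq n0 => YX; rewrite /n YX setDv cards0.
  by rewrite !mul0r mulr0 mul0r mulr0.
have YX : Y = X.
  by apply/eqP; rewrite eqEsubset XY andbT -setD_eq0 -cards_eq0 -/n n0.
have {}YN : #|Y| = J by rewrite /J YX.
rewrite YX eqxx /P YX setDv !big_set0 /= n0 !sh0 !mulr1 invr1 !mulr1 /c YX wtYY -/J.
have d1 : sh (lam + h) J.*2 != 0 by apply: sh_lam1_neq0; rewrite leq_double -YN.
have d2 : br lam != 0 by have := @lam_neq0 0 isT; rewrite mul0r addr0.
have -> : cJ J * 1 * (-1) ^+ J * sh (lam + J%:R * h) J / sh (lam + h) J.*2 =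
  ((-1) ^+ J * (-1) ^+ J) * (sh lam J * sh (lam + J%:R * h) J * br (lam + J.*2%:R * h)) / (br lam * sh (lam + h) J.*2).
  by rewrite /cJ !invfM; ring.
by rewrite signMM mul1r -shD addnn -shS shSl divff // mulf_neq0.
Qed.

Definition seqA (S : {set I}) : F :=
  (-1) ^+ #|S| * wt u S [set: I] * (sh e #|S| * sh f #|S| / sh g #|S|)
  * (\prod_(i in S) (br (u i - g) / br (u i + #|S|%:R * h - h)))
  * (\prod_(i in ~: S) (br (u i - e) * br (u i - f) / br (u i + #|S|%:R * h))).

Definition seqA' (T : {set I}) : F :=
  (-1) ^+ #|T| * cJ #|T| * wt u T [set: I] * (sh e #|T| * sh f #|T|)
  * (sh (lam + h - e) N * sh (lam + h - f) N
     / (sh (lam + h - e) #|T| * sh (lam + h - f) #|T|) / (sh g N * sh (lam + h) (N + #|T|)))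
  * (\prod_(i in T) br (u i - g))
  * (\prod_(i in ~: T) br (e + f + #|T|%:R * h - u i)).

(** The sum over the sets containing [T] is a Jackson sum on the complement of [T], with
    all parameters shifted by [#|T| h]. *)
Lemma kerC_a T : \sum_S seqA S * kerC S T = seqA' T.
Proof.
pose n := #|~: T|; pose J := #|T|.
have YN : (J + n = N)%N by rewrite /J /n cardsC.
pose u' i := u i + J%:R * h; pose D' := lam + J.*2.+1%:R * h.
pose e' := e + J%:R * h; pose f' := f + J%:R * h; pose C' := g + J%:R * h.
pose c := cJ J * wt u T [set: I] * (\prod_(i in T) br (u i - g)) * (-1) ^+ J
   * (sh e J * sh f J / (sh g J * sh (lam + h) J.*2)).
have H S : seqA S * kerC S T = if T \subset S then
    c * jackson_term br h u' e' f' C' D' (~: T) (S :\: T) else 0.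
  rewrite /kerC /seqA; have [TS|_] := boolP (T \subset S); last by rewrite mulr0.
  pose k := #|S :\: T|.
  have kE : #|S| = (J + k)%N by rewrite /J /k -(cardsID T S) (setIidPr TS).
  have kY : (J + k <= N)%N by rewrite -kE max_card.
  have YTE : ~: T :\: (S :\: T) = ~: S.
    by apply/setP => i; rewrite !inE; have := subsetP TS i; case: (i \in T) => [/(_ isT) ->|_] //=; rewrite ?andbT.
  rewrite /jackson_term -/k YTE wt_shift !big_split /= !prodfV kE -/J.
  have g0 : sh g J != 0 by apply: sh_le g_neq0; clear -YN; lia.
  have X0 : \prod_(i in T) br (u i + (J + k)%:R * h - h) != 0.
    apply/prodf_neq0 => i iX; have J0 := card_lt_ex iX; rewrite -/J in J0.
    rewrite (_ : _ - _ = u i + (J + k).-1%:R * h); first by apply: u_neq0; clear -kY J0; lia.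
    have -> : (J + k)%N = (J + k).-1.+1 by clear -J0; lia.
    by rewrite /= ; ring.
  have s2 : sh (lam + h) J.*2 != 0 by apply: sh_lam1_neq0; clear -YN; lia.
  have -> : sh D' k = sh (lam + h) (J + k + J) / sh (lam + h) J.*2.
    have -> : (J + k + J = J.*2 + k)%N by clear; lia.
    by rewrite shD mulrC mulKf //; congr bfac; rewrite /D' -addn1 natrD; ring.
  rewrite !(shD _ _ _ J k) -/e' -/f' -/C' (prod_subset_split (fun i => br (u i + _ - h)) TS)
    (prod_subset_split (fun i => br (u i - g)) TS).
  have -> : \prod_(i in S :\: T) br (u' i - D') = \prod_(i in S :\: T) br (u i - lam - J.+1%:R * h).
    by apply: eq_bigr => i _; congr br; rewrite /u' /D' -addnn -addSn natrD; ring.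
  have -> : \prod_(i in S :\: T) br (u' i - C') = \prod_(i in S :\: T) br (u i - g).
    by apply: eq_bigr => i _; congr br; rewrite /u' /C'; ring.
  have -> : \prod_(i in ~: S) br (u' i - e') = \prod_(i in ~: S) br (u i - e).
    by apply: eq_bigr => i _; congr br; rewrite /u' /e'; ring.
  have -> : \prod_(i in ~: S) br (u' i - f') = \prod_(i in ~: S) br (u i - f).
    by apply: eq_bigr => i _; congr br; rewrite /u' /f'; ring.
  have -> : \prod_(i in S :\: T) br (u' i + k%:R * h - h) = \prod_(i in S :\: T) br (u i + (J + k)%:R * h - h).
    by apply: eq_bigr => i _; congr br; rewrite /u' natrD; ring.
  have -> : \prod_(i in ~: S) br (u' i + k%:R * h) = \prod_(i in ~: S) br (u i + (J + k)%:R * h).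
    by apply: eq_bigr => i _; congr br; rewrite /u' natrD; ring.
  have := wt_chain br h u TS (subsetT S); rewrite [setT :\: T]setTD => W.
  set px := \prod_(i in T) br (u i + _ - h) in X0 *; set r2 := sh (lam + h) J.*2 in s2 *.
  set r4 := sh _ (J + k + J).
  pose L w := (-1) ^+ J * (-1) ^+ k * w * (sh e J * sh e' k * sh f J * sh f' k / sh g J / sh C' k)
   * ((\prod_(i in T) br (u i - g)) * (\prod_(i in S :\: T) br (u i - g))
      / (\prod_(i in S :\: T) br (u i + (J + k)%:R * h - h))
      * (\prod_(i in ~: S) br (u i - e)) * (\prod_(i in ~: S) br (u i - f))
      / (\prod_(i in ~: S) br (u i + (J + k)%:R * h)) * cJ J / r4
      * (\prod_(i in S :\: T) br (u i - lam - J.+1%:R * h))).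
  transitivity (px / px * L (wt u S [set: I] * wt u T S)); first by rewrite /L !invfM exprD; ring.
  rewrite W divff // mul1r.
  transitivity ((r2 / r2) * L (wt u T [set: I] * wt u (S :\: T) (~: T))).
    by rewrite !divff // !mul1r.
  by rewrite /L /c -/r2 !invfM invrK; ring.
rewrite (eq_bigr _ (fun T _ => H T)) -big_mkcond /= -mulr_sumr sum_above.
have VX (V : {set I}) : V \subset ~: T -> (T :|: V) :\: T = V.
  move=> VX; apply/setP => i; rewrite !inE; have := subsetP VX i; rewrite inE.
  by case: (i \in T); case: (i \in V) => //= /(_ isT).
rewrite (eq_bigr (fun V => jackson_term br h u' e' f' C' D' (~: T) V)); last by move=> V /VX ->.
have u'E i (m : nat) : u' i + m%:R * h = u i + (J + m)%:R * h by rewrite /u' natrD; ring.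
have bal : C' + D' + n%:R * h = e' + f' + h.
  by rewrite /C' /D' /e' /f' /g -YN -addnn -addn1 !natrD; ring.
have gen : jackson_generic br h u' C' D' (e' + f') (~: T).
  split=> [i j _ _ ij|i _ m mn||i _|i j _ _ m ij mn].
  - by rewrite (_ : u' i - u' j = u i - u j); [exact: u_distinct | rewrite /u'; ring].
  - rewrite -/n in mn; rewrite u'E; apply: u_neq0; clear -mn YN; lia.
  - rewrite -/n; split; last by apply: sh_lam_neq0; clear -YN; lia.
    by move: g_neq0; rewrite -YN shD mulf_eq0 negb_or => /andP[].
  - rewrite (_ : e' + f' - u' i = e + f - u i + J%:R * h); last by rewrite /e' /f' /u'; ring.
    by apply: EF1; clear -YN; lia.
  rewrite (_ : e' + f' - u' i - u' j - m%:R * h = e + f - u i - u j - m%:R * h).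
    by apply: EF2 => //; rewrite -/n in mn; clear -YN mn; lia.
  by rewrite /e' /f' /u'; ring.
rewrite (jackson_sum brN br0 plucker bal gen) /jackson_value /seqA' -/n -/J /c.
(* By the definition of g, reversing one factorial moves it to base lam + h - y. *)
have rev x y : x + y = e + f -> sh (g - x) n = (-1) ^+ n * sh (lam + h - y + J%:R * h) n.
  move=> xy; rewrite -sh_rev //; congr bfac; rewrite /g -YN natrD -xy; ring.
have -> : C' - e' = g - e by rewrite /C' /e'; ring.
have -> : C' - f' = g - f by rewrite /C' /f'; ring.
rewrite (rev e f) // (rev f e); last by rewrite addrC.
have -> : \prod_(i in ~: T) br (u' i - e' - f') =
    (-1) ^+ n * \prod_(i in ~: T) br (e + f + J%:R * h - u i).
  rewrite -prodrN; apply: eq_bigr => i _; rewrite -brN; congr br; rewrite /u' /e' /f'; ring.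
have -> : sh g N = sh g J * sh C' n by rewrite -YN shD.
have -> : sh (lam + h) (N + J) = sh (lam + h) J.*2 * sh D' n.
  have -> : (N + J = J.*2 + n)%N by clear -YN; lia.
  by rewrite shD; congr (_ * bfac _ _ _ _); rewrite /D' -addn1 natrD; ring.
have f0 : sh (lam + h - f) J != 0 by apply: sh_le lamf_neq0; clear -YN; lia.
have e0 : sh (lam + h - e) J != 0 by apply: sh_le lame_neq0; clear -YN; lia.
have -> : sh (lam + h - e) N = sh (lam + h - e) J * sh (lam + h - e + J%:R * h) n by rewrite -YN shD.
have -> : sh (lam + h - f) N = sh (lam + h - f) J * sh (lam + h - f + J%:R * h) n by rewrite -YN shD.
set x1 := sh _ J in f0 *; set x2 := sh _ J in e0 *.
set y1 := sh _ n; set y2 := sh _ n; set y3 := sh C' n; set y4 := sh D' n.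
set P := \prod_(i in ~: T) _; set Q := \prod_(i in T) _.
pose L := (-1) ^+ J * cJ J * wt u T [set: I] * (sh e J * sh f J) * (y1 * y2) / (sh g J * y3 * (sh (lam + h) J.*2 * y4)) * Q * P.
transitivity (((-1) ^+ n * (-1) ^+ n) * ((-1) ^+ n * (-1) ^+ n) * L); first by rewrite /L !invfM; ring.
rewrite !signMM !mul1r; transitivity (x1 / x1 * (x2 / x2) * L); first by rewrite !divff // !mul1r.
by rewrite /L !invfM; ring.
Qed.

Definition seqB (S : {set I}) : F := sh b #|S| / (sh C #|S| * sh D #|S|)
  * \prod_(i in S) (br (u i - C) * br (u i - D) / br (u i - b)).

Definition seqB' (T : {set I}) : F :=
  sh (C - b) #|T| * sh (D - b) #|T| / (sh C #|T| * sh D #|T|)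
  * \prod_(i in T) (br (u i - b - lam - #|T|%:R * h) / br (u i - b)).

Theorem bailey_subsets :
  \sum_(S : {set I}) seqA S * seqB S = \sum_(T : {set I}) seqA' T * seqB' T.
Proof. exact: bailey_transform kerMC kerM_b kerC_a. Qed.

End Bailey.

(** * Formal logarithms and the theta bracket *)

Section Monomials.
Variables (K : fieldType) (z : nat -> K).
Hypothesis z0 : forall k, z k != 0.

(** The monomial $\prod_k z_k^{f_k}$. A polynomial with integer coefficients serves as
    the formal logarithm of a nonzero number: this allows an additive notation, and square
    roots by taking for the $z_k$ square roots of the numbers of interest. *)
Definition mexp (f : {poly int}) : K := \prod_(k < size f) z k ^ f`_k.

Lemma mexp_widen n (f : {poly int}) : (size f <= n)%N -> mexp f = \prod_(k < n) z k ^ f`_k.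
Proof.
move=> fn; rewrite /mexp (big_ord_widen n (fun k => z k ^ f`_k)) // big_mkcond /=.
apply: eq_bigr => k _; case: ltnP => // fk.
by rewrite nth_default.
Qed.

Lemma mexpD f g : mexp (f + g) = mexp f * mexp g.
Proof.
have h1 := leq_maxl (size f) (size g); have h2 := leq_maxr (size f) (size g).
rewrite (mexp_widen h1) (mexp_widen h2) (mexp_widen (size_polyD f g)) -big_split /=.
by apply: eq_bigr => k _; rewrite coefD expfzDr.
Qed.

Lemma mexp_neq0 f : mexp f != 0.
Proof. by apply/prodf_neq0 => k _; rewrite expfz_neq0. Qed.

Lemma mexp0 : mexp 0 = 1.
Proof. by rewrite /mexp size_poly0 big_ord0. Qed.

Lemma mexpN f : mexp (- f) = (mexp f)^-1.
Proof. by apply: (mulfI (mexp_neq0 f)); rewrite -mexpD subrr mexp0 mulfV ?mexp_neq0. Qed.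

Lemma mexpX k : mexp 'X^k = z k.
Proof.
rewrite (@mexp_widen k.+1) ?size_polyXn // big_ord_recr /= coefXn eqxx expr1z.
by rewrite big1 ?mul1r // => j _; rewrite coefXn ltn_eqF ?expr0z.
Qed.

Lemma mexp_natl n f : mexp (n%:R * f) = mexp f ^+ n.
Proof.
elim: n => [|n IH]; first by rewrite mul0r mexp0.
by rewrite -natr1 mulrDl mul1r mexpD IH exprSr.
Qed.

Lemma mexp_sum (I : finType) (P : pred I) (F : I -> {poly int}) :
  mexp (\sum_(i | P i) F i) = \prod_(i | P i) mexp (F i).
Proof. by apply: big_morph; [exact: mexpD | exact: mexp0]. Qed.

End Monomials.

Lemma thetaE (R : realType) (p z : R[i]) : theta p z = th (K := R[i]) p z.
Proof. by []. Qed.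

Section ThetaBracket.
Variables (R : realType) (p : R[i]).
Hypothesis p1 : `|p| < 1.
Variable z : nat -> R[i].
Hypothesis z0 : forall k, z k != 0.
Local Notation E := (mexp z).

Lemma theta_inv (x : R[i]) : x != 0 -> theta p x^-1 = - theta p x / x.
Proof. exact: (th_inv (@complex_complete R) p1). Qed.

(** $\theta(E^2)/E$ is odd in the logarithm, unlike theta itself. Locked so that
    algebraic tactics treat it as an atom. *)
Definition tbr (f : {poly int}) : R[i] := locked (theta p (E f ^+ 2) / E f).

Lemma tbrE f : theta p (E f ^+ 2) = tbr f * E f.
Proof. by rewrite /tbr -lock divfK ?mexp_neq0. Qed.

Lemma tbr_eq0 f : (tbr f == 0) = (theta p (E f ^+ 2) == 0).
Proof. by rewrite tbrE [RHS]mulf_eq0 (negPf (mexp_neq0 z0 f)) orbF. Qed.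

Lemma tbrN f : tbr (- f) = - tbr f.
Proof.
have f0 := mexp_neq0 z0 f.
rewrite /tbr -!lock mexpN // exprVn theta_inv ?expf_neq0 // invrK.
by field.
Qed.

Lemma tbr0 : tbr 0 = 0.
Proof. by rewrite /tbr -lock mexp0 expr1n [theta p 1](th1 (@complex_complete R) p1) mul0r. Qed.

(** The change of variables that turns the additive three-term relation into the
    multiplicative one. *)
Lemma tbr_pair s x y : pairbr tbr s x y = - thk p (E (x + x - s)) (E (y + y - s)).
Proof.
have e0 := mexp_neq0 z0.
rewrite /pairbr /tbr -!lock /thk -!thetaE.
have -> : E (x + x - s) * E (y + y - s) = (E (s - x - y) ^+ 2)^-1.
  by rewrite !(mexpD z0, mexpN z0); field; rewrite ?e0.
have -> : E (x + x - s) / E (y + y - s) = E (x - y) ^+ 2.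
  by rewrite !(mexpD z0, mexpN z0); field; rewrite ?e0.
rewrite theta_inv ?expf_neq0 //; set t1 := theta p _; set t2 := theta p _.
by rewrite !(mexpD z0, mexpN z0); field; rewrite ?e0.
Qed.

Lemma tbr_plucker s x y u v :
  pairbr tbr s x y * pairbr tbr s u v - pairbr tbr s x u * pairbr tbr s y v
  + pairbr tbr s x v * pairbr tbr s y u = 0.
Proof.
have e0 := mexp_neq0 z0; rewrite !tbr_pair !mulrNN.
exact: (thk_plucker (@complex_complete R) p1).
Qed.

End ThetaBracket.

(** * The transformation for sums over subsets *)

Lemma bin2R (A : comNzRingType) k : 2 * ('C(k, 2))%:R = k%:R * k%:R - k%:R :> A.
Proof.
elim: k => [|k IH]; first by rewrite bin0n !mulr0 subr0.
by rewrite binS bin1 natrD mulrDr IH -addn1 natrD; ring.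
Qed.

Ltac generalize_factors := repeat
  match goal with
  | |- context [@bfac ?A ?F ?b ?h ?a ?k] =>
      let y := fresh "y" in set y := (@bfac A F b h a k); clearbody y
  | |- context [@subset_weight ?A ?F ?b ?h ?I ?u ?S ?Y] =>
      let y := fresh "y" in set y := (@subset_weight A F b h I u S Y); clearbody y
  | |- context [@tbr ?R ?p ?z ?f] =>
      let y := fresh "y" in set y := (@tbr R p z f); clearbody y
  | |- context [@mexp ?K ?z ?f] =>
      let y := fresh "y" in set y := (@mexp K z f); clearbody y
  end.

Section SubsetTransformation.
Variables (R : realType) (p q : R[i]).
Variables (I : finType) (U : I -> R[i]) (b c d e f : R[i]).
Local Notation N := #|I|.
Local Notation th := (theta p).
Local Notation sf a k := (sfac q p a (Posz k)).
Let lam := c * d / (b * q).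
Let g := e * f / (lam * q ^+ N).

(** The multiplicative form of [subset_weight]; the power of [q] comes from passing from
    the odd bracket to theta. *)
Definition swt (S : {set I}) : R[i] := (-1) ^+ #|S| / q ^+ 'C(#|S|, 2)
  * \prod_(i in S) \prod_(j in ~: S) (th (U i / (q * U j)) / th (U i / U j)).

Definition lterm (S : {set I}) : R[i] := swt S
  * (sf b #|S| * sf e #|S| * sf f #|S| / (sf c #|S| * sf d #|S| * sf g #|S|))
  * (\prod_(i in S) (th (U i / c) * th (U i / d) * th (U i / g) /
        (th (U i / b) * th (U i * q ^+ #|S| / q))))
  * (\prod_(i in ~: S) (th (U i / e) * th (U i / f) / th (U i * q ^+ #|S|))).

Definition rterm (S : {set I}) : R[i] := swt S
  * (th (lam * q ^+ (2 * #|S|)) / th lam)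
  * (sf lam #|S| * sf (d / b) #|S| * sf (c / b) #|S| * sf e #|S| * sf f #|S| /
     (sf (lam * q ^+ N.+1) #|S| * sf c #|S| * sf d #|S| * sf (lam * q / e) #|S| * sf (lam * q / f) #|S|))
  * (\prod_(i in S) (th (lam * b * q ^+ #|S| / U i) * th (U i / g) / th (U i / b)))
  * (\prod_(i in ~: S) th (e * f * q ^+ #|S| / U i)).

Hypotheses (p1 : `|p| < 1) (q0 : q != 0).
Hypotheses (b0 : b != 0) (c0 : c != 0) (d0 : d != 0) (e0 : e != 0) (f0 : f != 0).
Hypothesis U0 : forall i, U i != 0.

Hypothesis G1 : forall i j, i != j -> th (U i / U j) != 0.
Hypothesis G2 : forall i m, (m < N)%N -> th (U i * q ^+ m) != 0.
Hypothesis G3 : forall i, th (U i / b) != 0.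
Hypothesis G4 : forall m, (m <= N.*2)%N -> th (lam * q ^+ m) != 0.
Hypotheses (G5c : sf c N != 0) (G5d : sf d N != 0) (G5g : sf g N != 0).
Hypotheses (G5e : sf (lam * q / e) N != 0) (G5f : sf (lam * q / f) N != 0).
Hypothesis G6 : forall i m, (m <= N)%N -> th (U i / c * q ^+ m) != 0.
Hypothesis G7 : forall i m, (m < N)%N -> th (c * d / U i * q ^+ m) != 0.
Hypothesis G7' : forall i j m, (m < N)%N -> i != j -> th (c * d / U i / U j * q ^+ m) != 0.
Hypothesis G8 : forall i m, (m <= N)%N -> th (c * lam / U i * q ^+ m) != 0.
Hypothesis G8' : forall i j m, (m <= N)%N -> i != j -> th (c * lam / U i / U j * q ^+ m) != 0.
Hypothesis G9 : forall i m, (m <= N)%N -> th (e * f / U i * q ^+ m) != 0.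
Hypothesis G9' : forall i j m, (m < N)%N -> i != j -> th (e * f / U i / U j / q ^+ m) != 0.

Section Logs.
Variable z : nat -> R[i].
Hypothesis z0 : forall k, z k != 0.
Local Notation E := (mexp z).
Local Notation br := (tbr p z).
Variables (h lb lc ld le lf : {poly int}) (u : I -> {poly int}).
Hypotheses (qE : q = E h ^+ 2) (bE : b = E lb ^+ 2) (cE : c = E lc ^+ 2) (dE : d = E ld ^+ 2).
Hypotheses (eE : e = E le ^+ 2) (fE : f = E lf ^+ 2) (uE : forall i, U i = E (u i) ^+ 2).
Let ll := lc + ld - lb - h.
Let lg := le + lf - ll - N%:R * h.
Local Notation sh := (bfac br h).

Lemma E2D x y : E (x + y) ^+ 2 = E x ^+ 2 * E y ^+ 2.
Proof. by rewrite mexpD // exprMn. Qed.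
Lemma E2N x : E (- x) ^+ 2 = (E x ^+ 2)^-1.
Proof. by rewrite mexpN // exprVn. Qed.
Lemma E2n n : E (n%:R * h) ^+ 2 = q ^+ n.
Proof. by rewrite mexp_natl // qE -!exprM mulnC. Qed.

Lemma lamE : lam = E ll ^+ 2.
Proof. by rewrite /ll !(E2D, E2N) -cE -dE -bE -qE /lam invfM !mulrA. Qed.

Lemma gE : g = E lg ^+ 2.
Proof.
rewrite /lg /ll !(E2D, E2N, E2n) -eE -fE -cE -dE -bE -qE /g /lam !invfM !invrK; ring.
Qed.

Lemma th_br x y : y = E x ^+ 2 -> th y = br x * E x.
Proof. by move=> ->; exact: tbrE. Qed.

Lemma sf_br x y k : y = E x ^+ 2 -> sf y k = sh x k * E (k%:R * x + 'C(k, 2)%:R * h).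
Proof.
move=> ->; elim: k => [|k IH].
  by rewrite /= big_geq // sh0 bin0n !mul0r addr0 mexp0 mulr1.
rewrite /= big_nat_recr //= in IH *; rewrite IH shS (@th_br (x + k%:R * h)); last first.
  by rewrite E2D E2n.
move: (br (x + k%:R * h)) => B; rewrite -!mulrA; congr (_ * _); rewrite mulrCA; congr (_ * _); rewrite -mexpD //.
by congr E; rewrite binS bin1 natrD; ring.
Qed.

Lemma Eq n : q ^+ n = E ((2 * n)%:R * h).
Proof. by rewrite mexp_natl // qE exprM. Qed.

Lemma cardsI_sum (S : {set I}) : #|S|%:R + #|~: S|%:R = N%:R :> {poly int}.
Proof. by rewrite -natrD cardsC. Qed.

Lemma swt_br S : swt S = (-1) ^+ #|S| * subset_weight br h u S [set: I] *
  E (- (#|S|%:R * #|S|%:R - #|S|%:R) * h - #|S|%:R * #|~: S|%:R * h).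
Proof.
rewrite /swt /subset_weight setTD Eq natrM bin2R -mexpN // -mulrA -[RHS]mulrA; congr (_ * _).
have -> : \prod_(i in S) \prod_(j in ~: S) (th (U i / (q * U j)) / th (U i / U j)) =
   \prod_(i in S) \prod_(j in ~: S) (br (u i - u j - h) / br (u i - u j) * E (- h)).
  apply: eq_bigr => i _; apply: eq_bigr => j _.
  rewrite (@th_br (u i - u j - h)); last by rewrite !(E2D, E2N) -!uE -qE invfM; ring.
  rewrite (@th_br (u i - u j)); last by rewrite !(E2D, E2N) -!uE.
  by rewrite invfM mulrACA -mexpN // -mexpD //; congr (_ * E _); ring.
under eq_bigr do rewrite big_split /= prodr_const.
rewrite big_split /= prodr_const -!mexp_natl //.
rewrite mulrCA -mexpD //; congr (_ * E _); ring.
Qed.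

Let X := E (\sum_i u i - N%:R * (le + lf)).

Lemma lterm_br S : lterm S = X * (seqA br h u lb lc ld le lf S * seqB br h u lb lc ld S).
Proof.
rewrite /lterm swt_br (sf_br _ bE) (sf_br _ eE) (sf_br _ fE) (sf_br _ cE) (sf_br _ dE) (sf_br _ gE).
have H1 : \prod_(i in S) (th (U i / c) * th (U i / d) * th (U i / g) / (th (U i / b) * th (U i * q ^+ #|S| / q)))
  = (\prod_(i in S) (br (u i - lc) * br (u i - ld) * br (u i - lg) / (br (u i - lb) * br (u i + #|S|%:R * h - h))))
    * E (\sum_(i in S) u i + #|S|%:R * (lb + h - lc - ld - lg - #|S|%:R * h)).
  rewrite mexpD // mexp_sum // mexp_natl // -[E _ ^+ _]prodr_const -!big_split /=; apply: eq_bigr => i _.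
  rewrite (@th_br (u i - lc)); last by rewrite !(E2D, E2N) -uE -cE.
  rewrite (@th_br (u i - ld)); last by rewrite !(E2D, E2N) -uE -dE.
  rewrite (@th_br (u i - lg)); last by rewrite E2D E2N -uE -gE.
  rewrite (@th_br (u i - lb)); last by rewrite !(E2D, E2N) -uE -bE.
  rewrite (@th_br (u i + #|S|%:R * h - h)); last by rewrite !(E2D, E2N, E2n) -uE -qE.
  have -> : E (u i) * E (lb + h - lc - ld - lg - #|S|%:R * h) =
     E (u i - lc) * E (u i - ld) * E (u i - lg) / (E (u i - lb) * E (u i + #|S|%:R * h - h)).
    by rewrite -!mexpD // -mexpN // -mexpD //; congr E; ring.
  by rewrite !invfM; ring.
have H2 : \prod_(i in ~: S) (th (U i / e) * th (U i / f) / th (U i * q ^+ #|S|))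
  = (\prod_(i in ~: S) (br (u i - le) * br (u i - lf) / br (u i + #|S|%:R * h)))
    * E (\sum_(i in ~: S) u i + #|~: S|%:R * (- le - lf - #|S|%:R * h)).
  rewrite mexpD // mexp_sum // mexp_natl // -[E _ ^+ _]prodr_const -!big_split /=; apply: eq_bigr => i _.
  rewrite (@th_br (u i - le)); last by rewrite !(E2D, E2N) -uE -eE.
  rewrite (@th_br (u i - lf)); last by rewrite !(E2D, E2N) -uE -fE.
  rewrite (@th_br (u i + #|S|%:R * h)); last by rewrite !(E2D, E2N, E2n) -uE.
  have -> : E (u i) * E (- le - lf - #|S|%:R * h) =
     E (u i - le) * E (u i - lf) / E (u i + #|S|%:R * h).
    by rewrite -!mexpD // -mexpN // -mexpD //; congr E; ring.
  by rewrite !invfM; ring.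
rewrite H1 H2.
have XE : X = E (- (#|S|%:R * #|S|%:R - #|S|%:R) * h - #|S|%:R * #|~: S|%:R * h)
   * (E (#|S|%:R * lb + 'C(#|S|, 2)%:R * h) * E (#|S|%:R * le + 'C(#|S|, 2)%:R * h) * E (#|S|%:R * lf + 'C(#|S|, 2)%:R * h)
     / (E (#|S|%:R * lc + 'C(#|S|, 2)%:R * h) * E (#|S|%:R * ld + 'C(#|S|, 2)%:R * h) * E (#|S|%:R * lg + 'C(#|S|, 2)%:R * h)))
   * E (\sum_(i in S) u i + #|S|%:R * (lb + h - lc - ld - lg - #|S|%:R * h))
   * E (\sum_(i in ~: S) u i + #|~: S|%:R * (- le - lf - #|S|%:R * h)).
  rewrite -!mexpD // -mexpN // -!mexpD // /X; congr E.
  have -> : \sum_i u i = \sum_(i in S) u i + \sum_(i in ~: S) u i.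
    by rewrite (bigID (mem S)) /=; congr (_ + _); apply: eq_bigl => i; rewrite inE.
  by rewrite /lg /ll -(cardsI_sum S); ring.
rewrite XE /seqA /seqB -/ll -/lg !big_split /= !prodfV !big_split /= !invfM; ring.
Qed.

Let rbr (S : {set I}) : R[i] := (-1) ^+ #|S| * subset_weight br h u S [set: I]
  * (br (ll + (2 * #|S|)%:R * h) / br ll)
  * (sh ll #|S| * sh (ld - lb) #|S| * sh (lc - lb) #|S| * sh le #|S| * sh lf #|S| /
     (sh (ll + N.+1%:R * h) #|S| * sh lc #|S| * sh ld #|S| * sh (ll + h - le) #|S| * sh (ll + h - lf) #|S|))
  * (\prod_(i in S) (br (ll + lb + #|S|%:R * h - u i) * br (u i - lg) / br (u i - lb)))
  * (\prod_(i in ~: S) br (le + lf + #|S|%:R * h - u i)).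

Lemma rterm_br S : rterm S = X^-1 * rbr S.
Proof.
rewrite /rterm swt_br (sf_br _ lamE) (sf_br _ eE) (sf_br _ fE) (sf_br _ cE) (sf_br _ dE).
rewrite (@sf_br (ld - lb) (d / b)); last by rewrite !(E2D, E2N) -bE -dE.
rewrite (@sf_br (lc - lb) (c / b)); last by rewrite !(E2D, E2N) -bE -cE.
rewrite (@sf_br (ll + N.+1%:R * h) (lam * q ^+ N.+1)); last by rewrite E2D E2n -lamE.
rewrite (@sf_br (ll + h - le) (lam * q / e)); last by rewrite E2D E2N (E2D ll) -lamE -eE -qE.
rewrite (@sf_br (ll + h - lf) (lam * q / f)); last by rewrite E2D E2N (E2D ll) -lamE -fE -qE.
rewrite (@th_br (ll + (2 * #|S|)%:R * h) (lam * q ^+ (2 * #|S|))); last by rewrite E2D E2n -lamE.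
rewrite (th_br lamE).
have H1 : \prod_(i in S) (th (lam * b * q ^+ #|S| / U i) * th (U i / g) / th (U i / b))
  = (\prod_(i in S) (br (ll + lb + #|S|%:R * h - u i) * br (u i - lg) / br (u i - lb)))
    * E (- (\sum_(i in S) u i) + #|S|%:R * (ll + lb + #|S|%:R * h - lg + lb)).
  rewrite mexpD // -sumrN mexp_sum // mexp_natl // -[E _ ^+ _]prodr_const -!big_split /=; apply: eq_bigr => i _.
  rewrite (@th_br (u i - lg) (U i / g)); last by rewrite E2D E2N -uE -gE.
  rewrite (@th_br (u i - lb) (U i / b)); last by rewrite !(E2D, E2N) -uE -bE.
  rewrite (@th_br (ll + lb + #|S|%:R * h - u i)); last first.
    by rewrite E2D E2N -uE E2D E2n (E2D ll) -lamE -bE.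
  have -> : E (- u i) * E (ll + lb + #|S|%:R * h - lg + lb) =
     E (ll + lb + #|S|%:R * h - u i) * E (u i - lg) / E (u i - lb).
    by rewrite -!mexpD // -mexpN // -mexpD //; congr E; ring.
  by rewrite !invfM; ring.
have H2 : \prod_(i in ~: S) th (e * f * q ^+ #|S| / U i)
  = (\prod_(i in ~: S) br (le + lf + #|S|%:R * h - u i))
    * E (- (\sum_(i in ~: S) u i) + #|~: S|%:R * (le + lf + #|S|%:R * h)).
  rewrite mexpD // -sumrN mexp_sum // mexp_natl // -[E _ ^+ _]prodr_const -!big_split /=; apply: eq_bigr => i _.
  rewrite (@th_br (le + lf + #|S|%:R * h - u i)); last first.
    by rewrite E2D E2N -uE !E2D E2n -eE -fE.
  by rewrite -mexpD //; congr (_ * E _); ring.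
rewrite H1 H2.
have XE : X^-1 = E (- (#|S|%:R * #|S|%:R - #|S|%:R) * h - #|S|%:R * #|~: S|%:R * h)
   * (E (ll + (2 * #|S|)%:R * h) / E ll)
   * (E (#|S|%:R * ll + 'C(#|S|, 2)%:R * h) * E (#|S|%:R * (ld - lb) + 'C(#|S|, 2)%:R * h)
      * E (#|S|%:R * (lc - lb) + 'C(#|S|, 2)%:R * h)
      * E (#|S|%:R * le + 'C(#|S|, 2)%:R * h) * E (#|S|%:R * lf + 'C(#|S|, 2)%:R * h)
     / (E (#|S|%:R * (ll + N.+1%:R * h) + 'C(#|S|, 2)%:R * h)
      * E (#|S|%:R * lc + 'C(#|S|, 2)%:R * h) * E (#|S|%:R * ld + 'C(#|S|, 2)%:R * h)
      * E (#|S|%:R * (ll + h - le) + 'C(#|S|, 2)%:R * h)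
      * E (#|S|%:R * (ll + h - lf) + 'C(#|S|, 2)%:R * h)))
   * E (- (\sum_(i in S) u i) + #|S|%:R * (ll + lb + #|S|%:R * h - lg + lb))
   * E (- (\sum_(i in ~: S) u i) + #|~: S|%:R * (le + lf + #|S|%:R * h)).
  rewrite -!mexpD // -!mexpN // -!mexpD // /X; congr E.
  have -> : \sum_i u i = \sum_(i in S) u i + \sum_(i in ~: S) u i.
    by rewrite (bigID (mem S)) /=; congr (_ + _); apply: eq_bigl => i; rewrite inE.
  have -> : N.+1%:R = #|S|%:R + #|~: S|%:R + 1 :> {poly int} by rewrite cardsI_sum natr1.
  by rewrite /lg /ll -(cardsI_sum S); ring.
by rewrite XE /rbr !invfM; ring.
Qed.

Let pref := sh (ll + h - le) N * sh (ll + h - lf) N / (sh (ll + h) N * sh lg N).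

(** The dual sequences multiply to the well-poised terms, up to a factor that does not
    depend on [S]. *)
Lemma seq_rbr S : seqA' br h u lb lc ld le lf S * seqB' br h u lb lc ld S = pref * rbr S.
Proof.
rewrite /seqA' /seqB' /rbr /pref /cJ -/ll -/lg.
rewrite (shD br h (ll + h)) (_ : ll + h + N%:R * h = ll + N.+1%:R * h); last by ring.
have -> : \prod_(i in S) (br (u i - lb - ll - #|S|%:R * h) / br (u i - lb)) =
   (-1) ^+ #|S| * \prod_(i in S) (br (ll + lb + #|S|%:R * h - u i) / br (u i - lb)).
  rewrite -prodrN; apply: eq_bigr => i _; rewrite -[RHS]mulNr -tbrN //.
  by congr (br _ / _); ring.
rewrite mul2n !big_split /= !invfM.
have sg : (-1) ^+ #|S| * (-1) ^+ #|S| = 1 :> R[i] by rewrite -exprMn mulrNN mulr1 expr1n.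
have V (x : R[i]) : x = (-1) ^+ #|S| * (-1) ^+ #|S| * x by rewrite sg mul1r.
rewrite [RHS]V; move: (\prod_(i in S) _) (\prod_(i in S) _) (\prod_(i in S) _) (\prod_(i in ~: S) _).
by move=> P1 P2 P3 Q; generalize_factors; ring.
Qed.

Lemma pref_th : (-1) ^+ N * (\prod_i (U i / (e * f))) * (sf (lam * q / e) N * sf (lam * q / f) N
     / (sf (lam * q) N * sf (lam * q / (e * f)) N)) = X * X * pref.
Proof.
rewrite (@sf_br (ll + h - le) (lam * q / e)); last by rewrite E2D E2N (E2D ll) -lamE -eE -qE.
rewrite (@sf_br (ll + h - lf) (lam * q / f)); last by rewrite E2D E2N (E2D ll) -lamE -fE -qE.
rewrite (@sf_br (ll + h) (lam * q)); last by rewrite E2D -lamE -qE.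
rewrite (@sf_br (ll + h - le - lf) (lam * q / (e * f))); last first.
  by rewrite E2D E2N (E2D (ll + h)) E2N (E2D ll) -lamE -fE -qE -eE invfM mulrA.
have -> : \prod_i (U i / (e * f)) = X * X.
  have -> : X = \prod_i E (u i - le - lf).
    rewrite -mexp_sum //; congr E; rewrite big_split sumrN /= big_split /= sumrN !sumr_const /=.
    ring.
  rewrite -big_split /=; apply: eq_bigr => i _.
  by rewrite -expr2 E2D E2N E2D E2N -uE -eE -fE invfM mulrA.
have -> : ll + h - le - lf = h - lg - N%:R * h by rewrite /lg; ring.
rewrite sh_rev; last exact: tbrN.
have M : E (N%:R * (ll + h - le) + 'C(N, 2)%:R * h) * E (N%:R * (ll + h - lf) + 'C(N, 2)%:R * h)
   / (E (N%:R * (ll + h) + 'C(N, 2)%:R * h) * E (N%:R * (h - lg - N%:R * h) + 'C(N, 2)%:R * h)) = 1.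
  rewrite -!mexpD // -mexpN // -mexpD // -(mexp0 z); congr E; rewrite /lg; ring.
have sg : (-1) ^+ N / (-1) ^+ N = 1 :> R[i] by rewrite divff // signr_eq0.
rewrite -[RHS]mulr1 -[X in _ = _ * X]M -[RHS]mulr1 -[X in _ = _ * X]sg /pref !invfM.
move: (X * X) => X2; generalize_factors; ring.
Qed.

Lemma br_neq0 x y : y = E x ^+ 2 -> th y != 0 -> br x != 0.
Proof. by move=> ->; rewrite tbr_eq0. Qed.

Lemma sh_neq0_sf x y k : y = E x ^+ 2 -> sf y k != 0 -> sh x k != 0.
Proof. by move=> yE; rewrite (sf_br _ yE) mulf_eq0 negb_or => /andP[]. Qed.

Lemma subset_transformation_logs :
  \sum_S lterm S = (-1) ^+ N * (\prod_i (U i / (e * f))) * (sf (lam * q / e) N * sf (lam * q / f) N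
     / (sf (lam * q) N * sf (lam * q / (e * f)) N)) * \sum_S rterm S.
Proof.
have cdE : lc + ld = ll + lb + h by rewrite /ll; ring.
rewrite pref_th (eq_bigr _ (fun S _ => rterm_br S)) (eq_bigr _ (fun S _ => lterm_br S)).
have X0 : X != 0 by exact: mexp_neq0.
have -> : X * X * pref * (\sum_S X^-1 * rbr S) = X * \sum_S pref * rbr S.
  by rewrite -!mulr_sumr; field.
have <- : \sum_S seqA' br h u lb lc ld le lf S * seqB' br h u lb lc ld S = \sum_S pref * rbr S.
  by apply: eq_bigr => S _; exact: seq_rbr.
rewrite -mulr_sumr; congr (_ * _).
apply: bailey_subsets.
- exact: tbrN.
- exact: tbr0.
- exact: tbr_plucker.
- move=> i j ij; apply: br_neq0 (G1 ij); by rewrite E2D E2N -!uE.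
- move=> i m mN; apply: br_neq0 (G2 i mN); by rewrite E2D E2n -uE.
- move=> i; apply: br_neq0 (G3 i); by rewrite E2D E2N -uE -bE.
- move=> m mN; apply: br_neq0 (G4 mN); by rewrite E2D E2n -lamE.
- exact: sh_neq0_sf cE G5c.
- exact: sh_neq0_sf dE G5d.
- exact: sh_neq0_sf gE G5g.
- apply: sh_neq0_sf G5e; by rewrite E2D E2N (E2D ll) -lamE -eE -qE.
- apply: sh_neq0_sf G5f; by rewrite E2D E2N (E2D ll) -lamE -fE -qE.
- move=> i m mN; apply: br_neq0 (G6 i mN); by rewrite E2D E2n E2D E2N -uE -cE.
- move=> i m mN; apply: br_neq0 (G7 i mN); by rewrite E2D E2n E2D E2N -uE E2D -cE -dE.
- move=> i j m mN ij; apply: br_neq0 (G7' mN ij).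
  by rewrite E2D E2n E2D E2N -uE E2D E2N -uE E2D -cE -dE.
- move=> i m mN; apply: br_neq0 (G8 i mN); by rewrite E2D E2n E2D E2N -uE E2D -cE -lamE.
- move=> i j m mN ij; apply: br_neq0 (G8' mN ij).
  by rewrite E2D E2n E2D E2N -uE E2D E2N -uE E2D -cE -lamE.
- move=> i m mN; apply: br_neq0 (G9 i mN); by rewrite E2D E2n E2D E2N -uE E2D -eE -fE.
move=> i j m mN ij; apply: br_neq0 (G9' mN ij).
by rewrite E2D E2N E2n E2D E2N -uE E2D E2N -uE E2D -eE -fE.
Qed.

End Logs.

(** A square root of every parameter makes the formal logarithms available. *)
Theorem subset_transformation :
  \sum_S lterm S = (-1) ^+ N * (\prod_i (U i / (e * f))) * (sf (lam * q / e) N * sf (lam * q / f) N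
     / (sf (lam * q) N * sf (lam * q / (e * f)) N)) * \sum_S rterm S.
Proof.
(* One formal variable for a square root of each parameter and each node. *)
pose ws := [:: q; b; c; d; e; f] ++ [seq U i | i <- enum I].
pose z k := sqrtc (nth 1 ws k).
have z0 k : z k != 0.
  rewrite sqrtc_eq0; case: (ltnP k (size ws)) => [kw|wk]; last by rewrite nth_default ?oner_neq0.
  have : all (fun w => w != 0) ws.
    by rewrite /ws all_cat /= q0 b0 c0 d0 e0 f0 /=; apply/allP => _ /mapP[i _ ->].
  by move/allP; apply; exact: mem_nth.
have zE k : mexp z 'X^k ^+ 2 = nth 1 ws k by rewrite mexpX // sqr_sqrtc.
apply: (@subset_transformation_logs z z0 'X^0 'X^1 'X^2 'X^3 'X^4 'X^5 (fun i => 'X^(6 + index i (enum I)))).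
- by rewrite zE.
- by rewrite zE.
- by rewrite zE.
- by rewrite zE.
- by rewrite zE.
- by rewrite zE.
move=> i; rewrite zE.
have -> : nth 1 ws (6 + index i (enum I)) = nth 1 [seq U j | j <- enum I] (index i (enum I)) by [].
by rewrite (nth_map i) ?index_mem ?mem_enum // nth_index ?mem_enum.
Qed.
End SubsetTransformation.

(** * Boxes of multi-indices as families of initial segments *)

Lemma big_square_split (T : Type) (idx : T) (op : Monoid.com_law idx) n (F : 'I_n -> 'I_n -> T) :
  \big[op/idx]_(r < n) \big[op/idx]_(s < n) F r s =
  op (\big[op/idx]_(r < n) F r r)
     (\big[op/idx]_(r < n) \big[op/idx]_(s < n | (r < s)%N) op (F r s) (F s r)).
Proof.
have -> : \big[op/idx]_(r < n) \big[op/idx]_(s < n | (r < s)%N) op (F r s) (F s r) =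
   op (\big[op/idx]_(r < n) \big[op/idx]_(s < n | (r < s)%N) F r s)
      (\big[op/idx]_(r < n) \big[op/idx]_(s < n | (s < r)%N) F r s).
  rewrite (exchange_big_dep xpredT (P := xpredT) (Q := fun r s : 'I_n => (s < r)%N)) //= -big_split /=.
  by apply: eq_bigr => r _; rewrite -big_split.
rewrite -!big_split /=; apply: eq_bigr => r _.
rewrite (bigD1 r) //=; congr (op _ _).
rewrite (bigID (fun s : 'I_n => (r < s)%N)) /=; congr (op _ _); apply: eq_bigl => s.
  by rewrite -(inj_eq val_inj) /=; lia.
by rewrite -(inj_eq val_inj) /=; lia.
Qed.

Section Segments.
Variables (n : nat) (N : 'I_n -> nat).
Local Notation I := {r : 'I_n & 'I_(N r)}.

Lemma card_nodes : #|{: I}| = msum N.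
Proof.
by rewrite card_tagged sumnE big_map big_enum /=; apply: eq_bigr => r _; rewrite card_ord.
Qed.

Definition segment (k : 'I_n -> nat) : {set I} := [set i : I | (tagged i < k (tag i))%N].

Section Products.
Variables (T : Type) (idx : T) (op : Monoid.com_law idx) (k : 'I_n -> nat).
Hypothesis kN : forall r, (k r <= N r)%N.
Variable F : 'I_n -> nat -> T.

Lemma big_segment : \big[op/idx]_(i in segment k) F (tag i) (tagged i) =
  \big[op/idx]_(r < n) \big[op/idx]_(0 <= j < k r) F r j.
Proof.
transitivity (\big[op/idx]_(r < n) \big[op/idx]_(j : 'I_(N r) | (j < k r)%N) F r j).
  rewrite (@sig_big_dep _ _ op _ (fun r => 'I_(N r)) xpredT (fun r (j : 'I_(N r)) => (j < k r)%N) (fun r (j : 'I_(N r)) => F r j)).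
  by apply: eq_bigl => i; rewrite inE.
by apply: eq_bigr => r _; rewrite big_mkord -(big_ord_widen _ (F r)).
Qed.

Lemma big_segmentC : \big[op/idx]_(i in ~: segment k) F (tag i) (tagged i) =
  \big[op/idx]_(r < n) \big[op/idx]_(k r <= j < N r) F r j.
Proof.
transitivity (\big[op/idx]_(r < n) \big[op/idx]_(j : 'I_(N r) | (k r <= j)%N) F r j).
  rewrite (@sig_big_dep _ _ op _ (fun r => 'I_(N r)) xpredT (fun r (j : 'I_(N r)) => (k r <= j)%N) (fun r (j : 'I_(N r)) => F r j)).
  by apply: eq_bigl => i; rewrite !inE -leqNgt.
by apply: eq_bigr => r _; rewrite big_geq_mkord.
Qed.

Lemma big_nodes : \big[op/idx]_(i : I) F (tag i) (tagged i) =
  \big[op/idx]_(r < n) \big[op/idx]_(0 <= j < N r) F r j.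
Proof.
transitivity (\big[op/idx]_(r < n) \big[op/idx]_(j : 'I_(N r)) F r j).
  by rewrite (@sig_big_dep _ _ op _ (fun r => 'I_(N r)) xpredT (fun _ => xpredT) (fun r (j : 'I_(N r)) => F r j)).
by apply: eq_bigr => r _; rewrite big_mkord.
Qed.

End Products.

Lemma card_segment k : (forall r, (k r <= N r)%N) -> #|segment k| = msum k.
Proof.
move=> kN; rewrite -sum1_card (big_segment _ kN (fun _ _ => 1%N)).
by apply: eq_bigr => r _; rewrite sum_nat_const_nat muln1 subn0.
Qed.

Definition in_string (S : {set I}) r j := [exists o : 'I_(N r), (val o == j) && (Tagged (fun r => 'I_(N r)) o \in S)].

Lemma in_stringE S (i : I) : in_string S (tag i) (tagged i) = (i \in S).
Proof.
case: i => r j; apply/existsP/idP => [[o /andP[/eqP/val_inj -> //]]|iS].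
by exists j; rewrite eqxx.
Qed.

Definition heights (S : {set I}) r : nat := find (fun j => ~~ in_string S r j) (iota 0 (N r)).

Lemma heights_le S r : (heights S r <= N r)%N.
Proof. by rewrite -[X in (_ <= X)%N](size_iota 0) find_size. Qed.

Lemma before_heights S r j : (j < heights S r)%N -> in_string S r j.
Proof.
move=> jh; have := before_find 0%N jh; rewrite nth_iota ?(leq_trans jh) ?heights_le //.
by move/negbFE.
Qed.

Lemma at_heights S r : (heights S r < N r)%N -> ~~ in_string S r (heights S r).
Proof.
move=> hN; have := hN; rewrite -{1}(size_iota 0 (N r)) -has_find => /(nth_find 0%N).
by rewrite nth_iota.
Qed.

Lemma heights_segment k : (forall r, (k r <= N r)%N) -> heights (segment k) =1 k.
Proof.
move=> kN r.
have E j : (j < N r)%N -> in_string (segment k) r j = (j < k r)%N.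
  by move=> jN; have := in_stringE (segment k) (Tagged (fun r => 'I_(N r)) (Ordinal jN)); rewrite inE.
apply/eqP; rewrite eqn_leq; apply/andP; split; rewrite leqNgt; apply/negP => lt.
  have := before_heights lt; rewrite E ?ltnn //.
  exact: leq_trans lt (heights_le _ _).
have hN := leq_trans lt (kN r).
by have := at_heights hN; rewrite E // lt.
Qed.

(** Some string has an element of [S] above a gap; descending from it, one reaches a place
    where [S] stops exactly one step below. *)
Lemma not_segment S : S != segment (heights S) ->
  exists i j : I, [/\ i \in S, j \notin S, tag i = tag j & (tagged i = (tagged j).+1 :> nat)].
Proof.
move=> SN.
have [i iS ih] : exists2 i : I, i \in S & (heights S (tag i) <= tagged i)%N.
  have sub : segment (heights S) \subset S.
    by apply/subsetP => i; rewrite inE -in_stringE; exact: before_heights.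
  have : ~~ (S \subset segment (heights S)) by apply: contra SN => sub2; rewrite eqEsubset sub2.
  by case/subsetPn => i iS; rewrite inE -leqNgt => h; exists i.
case: i iS ih => r [j jN] /= iS ih.
elim: j jN iS ih => [|j IH] jN iS ih.
  have h0 : heights S r = 0%N by move: ih; rewrite /= leqn0 => /eqP.
  have := @at_heights S r; rewrite h0 => /(_ jN).
  by rewrite (in_stringE S (Tagged (fun r => 'I_(N r)) (Ordinal jN))) iS.
have jN' : (j < N r)%N by exact: ltnW.
have [jS|jS] := boolP (Tagged (fun r => 'I_(N r)) (Ordinal jN') \in S); last first.
  by exists (Tagged (fun r => 'I_(N r)) (Ordinal jN)), (Tagged (fun r => 'I_(N r)) (Ordinal jN')).
apply: (IH jN' jS); move: ih; rewrite /= leq_eqVlt => /predU1P[hE|//].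
have := @at_heights S r; rewrite hE => /(_ jN).
by rewrite (in_stringE S (Tagged (fun r => 'I_(N r)) (Ordinal jN))) iS.
Qed.

Lemma sum_segments (V : nmodType) (G : {set I} -> V) :
  (forall S, S != segment (heights S) -> G S = 0) ->
  \sum_S G S = \sum_(k : {dffun forall r : 'I_n, 'I_(N r).+1}) G (segment (fun r => k r)).
Proof.
move=> G0; rewrite (bigID (fun S => S == segment (heights S))) /= [X in _ + X]big1 ?addr0 //.
pose hd S : {dffun forall r : 'I_n, 'I_(N r).+1} :=
  [ffun r => Ordinal (heights_le S r : (heights S r < (N r).+1)%N)].
rewrite (reindex_onto (fun k : {dffun forall r : 'I_n, 'I_(N r).+1} => segment (fun r => k r)) hd) /=.
  apply: eq_bigl => k.
  have kN r : (k r <= N r)%N by rewrite -ltnS.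
  have hk : hd (segment (fun r => k r)) = k.
    by apply/ffunP => r; apply: val_inj; rewrite ffunE /= heights_segment.
  rewrite hk eqxx andbT; apply/eqP; congr segment; apply: boolp.funext => r.
  by rewrite heights_segment.
move=> S /eqP {2}->; congr segment; apply: boolp.funext => r; by rewrite ffunE.
Qed.

End Segments.

(** * Theta shifted factorials *)

Lemma telescope_prod_div (F : fieldType) (t : nat -> F) m k : (m <= k)%N ->
  (forall j, (m <= j <= k)%N -> t j != 0) -> \prod_(m <= j < k) (t j.+1 / t j) = t k / t m.
Proof.
move=> /subnKC <-; elim: (k - m)%N => [|d IH] t0.
  by rewrite addn0 big_geq // divff // t0 // addn0 leqnn.
rewrite addnS big_nat_recr ?leq_addr //= IH; last first.
  by move=> j /andP[mj jd]; rewrite t0 // mj addnS leqW.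
rewrite mulrC mulrA divfK // t0 // leq_addr addnS leqnSn //.
Qed.

(** Both sides agree after doubling, when the square of [msum k] is expanded. *)
Lemma sum_pairs_exponent n (k : 'I_n -> nat) :
  (\sum_(r < n) 'C((k r).+1, 2) + \sum_(r < n) \sum_(s < n | (r < s)%N) k s * (k r).+1
   = 'C(msum k, 2) + \sum_(r < n) r.+1 * k r)%N.
Proof.
pose P := (\sum_(r < n) \sum_(s < n | (r < s)%N) k s * k r)%N.
pose Q := (\sum_(r < n) k r * k r)%N.
pose L := (\sum_(r < n) r * k r)%N.
have H1 : (\sum_(r < n) \sum_(s < n | (r < s)%N) k s * (k r).+1 = P + L)%N.
  have -> : L = (\sum_(r < n) \sum_(s < n | (r < s)%N) k s)%N.
    rewrite (exchange_big_dep xpredT) //=; apply: eq_bigr => s _.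
    by rewrite -(big_ord_widen _ (fun=> k s)) ?sum_nat_const ?card_ord // ltnW.
  rewrite /P -big_split /=; apply: eq_bigr => r _; rewrite -big_split /=.
  by apply: eq_bigr => s _; rewrite mulnS addnC.
have H2 : (msum k * msum k = Q + P.*2)%N.
  rewrite {1}/msum big_distrlr /= (big_square_split _ (fun r s => k r * k s)%N) /=.
  congr (_ + _)%N; rewrite -muln2 big_distrl; apply: eq_bigr => r _; rewrite big_distrl.
  by apply: eq_bigr => s _ /=; lia.
have H3 : (\sum_(r < n) 'C((k r).+1, 2)).*2 = (Q + msum k)%N.
  rewrite -muln2 big_distrl /Q /msum -big_split /=; apply: eq_bigr => r _.
  by have := mul_bin_diag (k r).+1 1; rewrite bin1; nia.
have H4 : (('C(msum k, 2)).*2 + msum k = msum k * msum k)%N.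
  by case: (msum k) => [|m]; rewrite ?bin0n //; have := mul_bin_diag m.+1 1; rewrite bin1; nia.
have H5 : (\sum_(r < n) r.+1 * k r = L + msum k)%N.
  by rewrite /L /msum -big_split /=; apply: eq_bigr => r _; rewrite mulSn addnC.
rewrite H1 H5; lia.
Qed.

Section ShiftedFactorials.
Variables (R : realType) (p q : R[i]).
Hypotheses (p1 : `|p| < 1) (q0 : q != 0).
Local Notation th := (theta p).
Local Notation sf a k := (sfac q p a (Posz k)).

Lemma sfE a k : sf a k = \prod_(0 <= j < k) th (a * q ^+ j).
Proof. by []. Qed.

Lemma sf_interval w m k : \prod_(m <= j < m + k) th (w * q ^+ j) = sf (w * q ^+ m) k.
Proof.
rewrite sfE -{1}[m]add0n big_addn addKn; apply: eq_big_nat => j _.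
by rewrite exprD mulrA mulrAC.
Qed.

Lemma th_swap w : w != 0 -> th w^-1 = - w^-1 * th w.
Proof. by move=> w0; rewrite (theta_inv p1) // mulrC mulNr mulrN. Qed.

Lemma sf_diag k : (forall j, (1 <= j <= k)%N -> th (q ^+ j) != 0) ->
  sf q k / sf (q ^- k) k = (-1) ^+ k * q ^+ 'C(k.+1, 2).
Proof.
move=> H.
have -> : sf (q ^- k) k = (\prod_(0 <= j < k) (- q ^- j.+1)) * sf q k.
  rewrite sfE big_nat_rev /= add0n -big_split /=; apply: eq_big_nat => j /andP[_ jk].
  have -> : q ^- k * q ^+ (k - j.+1) = (q ^+ j.+1)^-1.
    by rewrite -[in q ^- k](subnK jk) exprD invfM mulrC mulrA mulfV ?mul1r // expf_neq0.
  by rewrite th_swap ?expf_neq0 // -exprS.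
have s0 : sf q k != 0.
  rewrite sfE prodf_seq_neq0; apply/allP => j; rewrite mem_index_iota => /andP[_ jk].
  by rewrite -exprS /=; apply: H.
rewrite invfM mulrA mulrAC divff // mul1r.
elim: k {H s0} => [|k IH]; first by rewrite big_geq // invr1 mulr1.
have -> : 'C(k.+2, 2) = ('C(k.+1, 2) + k.+1)%N by rewrite [LHS]binS bin1.
rewrite big_nat_recr //= invfM IH invrN invrK exprD [(-1) ^+ k.+1]exprS; ring.
Qed.

(** With [v = w / q ^+ l], the two numerators and [th w] on one side, and the two denominators
    and the remaining theta function on the other, each make up the full product of
    [th (v * q ^+ j)] for [j <= k + l]; reflections of theta account for the power of [q]. *)
Lemma sf_pair w k l : w != 0 ->
  (forall j, (j <= k + l)%N -> th (w / q ^+ l * q ^+ j) != 0) ->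
  sf (q * w) k * sf (q / w) l / (sf (q ^- l * w) k * sf (q ^- k / w) l) =
  q ^+ (l * k.+1) * (th (w * q ^+ k / q ^+ l) / th w).
Proof.
move=> w0 H; pose v := w / q ^+ l; have ql : q ^+ l != 0 by rewrite expf_neq0.
(* Every factor is a product over an interval of the string through v. *)
pose T m n := \prod_(m <= j < n) th (v * q ^+ j).
have T0 m n : (n <= (k + l).+1)%N -> T m n != 0.
  move=> nkl; rewrite prodf_seq_neq0; apply/allP => j; rewrite mem_index_iota => /andP[_ jn].
  by apply: H; lia.
have Tcat m1 m2 m3 : (m1 <= m2)%N -> (m2 <= m3)%N -> T m1 m3 = T m1 m2 * T m2 m3.
  by move=> h1 h2; rewrite /T (big_cat_nat h1 h2).
have T1 m : T m m.+1 = th (v * q ^+ m) by rewrite /T big_nat1.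
have e1 : sf (q * w) k = T l.+1 (l.+1 + k)%N.
  by rewrite /T sf_interval; congr sfac; rewrite /v exprS; field.
have e2 : sf (q ^- l * w) k = T 0%N k.
  by rewrite /T -[k in LHS]/k sfE; apply: eq_bigr => j _; rewrite /v mulrC [q ^- l * w]mulrC mulrC.
have flip j : th (q ^+ j.+1 / w) = - (q ^+ j.+1 / w) * th (w / q ^+ j.+1).
  by rewrite -[q ^+ j.+1 / w]invf_div th_swap // mulf_neq0 ?invr_eq0 ?expf_neq0.
have e3 : sf (q / w) l = (\prod_(0 <= j < l) (- (q ^+ j.+1 / w))) * T 0%N l.
  rewrite /T [X in _ = _ * X]big_nat_rev /= add0n -big_split /=; apply: eq_big_nat => j /andP[_ jl].
  have -> : q / w * q ^+ j = q ^+ j.+1 / w by rewrite exprS; ring.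
  rewrite flip; congr (_ * th _).
  by rewrite /v -{1}(subnK jl) exprD; field; rewrite !expf_neq0.
have e4 : sf (q ^- k / w) l = (\prod_(0 <= j < l) (- (q ^+ j / q ^+ k / w))) * T k.+1 (k.+1 + l)%N.
  rewrite /T sf_interval sfE [X in _ = _ * X]big_nat_rev /= add0n -big_split /=; apply: eq_big_nat => j /andP[_ jl].
  have -> : q ^- k / w * q ^+ j = (w * q ^+ k / q ^+ j)^-1 by field; rewrite !expf_neq0 ?w0.
  rewrite th_swap; last by rewrite !mulf_neq0 ?invr_eq0 ?expf_neq0.
  congr (_ * th _); first by congr (- _); field; rewrite !expf_neq0 ?w0.
  have E : q ^+ l = q ^+ (l - j.+1) * (q * q ^+ j) by rewrite -exprS -exprD subnK.
  by rewrite /v E exprS; field; rewrite ?q0 !expf_neq0.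
rewrite e1 e2 e3 e4.
have -> : \prod_(0 <= j < l) (- (q ^+ j.+1 / w)) = q ^+ (l * k.+1) * \prod_(0 <= j < l) (- (q ^+ j / q ^+ k / w)).
  have -> : q ^+ (l * k.+1) = \prod_(0 <= j < l) q ^+ k.+1.
    by rewrite prodr_const_nat subn0 mulnC exprM.
  rewrite -big_split /=; apply: eq_bigr => j _; rewrite !exprS; field; rewrite !expf_neq0 ?w0 //.
set Z := \prod_(0 <= j < l) _.
have Z0 : Z != 0.
  rewrite prodf_seq_neq0; apply/allP => j _ /=.
  by rewrite oppr_eq0 !mulf_neq0 ?invr_eq0 ?expf_neq0.
have -> : th (w * q ^+ k / q ^+ l) = T k k.+1 by rewrite T1; congr th; rewrite /v; field.
have -> : th w = T l l.+1 by rewrite T1; congr th; rewrite /v; field.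
have full1 : T 0%N (l.+1 + k)%N = T 0%N l * T l l.+1 * T l.+1 (l.+1 + k)%N.
  by rewrite -!Tcat // ?leq_addr // addSn ltnW // ltnS leq_addr.
have full2 : T 0%N (k.+1 + l)%N = T 0%N k * T k k.+1 * T k.+1 (k.+1 + l)%N.
  by rewrite -!Tcat // ?leq_addr // addSn ltnW // ltnS leq_addr.
have full : T 0%N l * T l l.+1 * T l.+1 (l.+1 + k)%N = T 0%N k * T k k.+1 * T k.+1 (k.+1 + l)%N.
  by rewrite -full1 -full2 !addSn addnC.
have n1 : T l l.+1 != 0 by apply: T0; rewrite ltnS leq_addl.
have n2 : T 0%N k != 0 by apply: T0; rewrite leqW ?leq_addr.
have n3 : T k.+1 (k.+1 + l)%N != 0 by apply: T0; rewrite addSn.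
have V : T 0%N l * T l.+1 (l.+1 + k)%N / (T 0%N k * T k.+1 (k.+1 + l)%N) = T k k.+1 / T l l.+1.
  apply/eqP; rewrite eqr_div ?mulf_neq0 //.
  by apply/eqP; rewrite mulrAC full; ring.
by rewrite -V; field; rewrite ?n3 ?n2 ?n1 ?Z0.
Qed.

End ShiftedFactorials.

(** * Nodes in geometric strings *)

Section Strings.
Variables (R : realType) (p q : R[i]).
Hypotheses (p1 : `|p| < 1) (q0 : q != 0).
Local Notation th := (theta p).
Local Notation sf a k := (sfac q p a (Posz k)).
Variables (n : nat) (N : 'I_n -> nat) (x : 'I_n -> R[i]) (a : R[i]).
Hypotheses (a0 : a != 0) (x0 : forall r, x r != 0).
Hypothesis hxx : forall r s : 'I_n, (r < s)%N -> th (x r / x s) != 0.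
Hypothesis hqx : forall r s, sf (q * x r / x s) (N r) != 0.
Local Notation I := {r : 'I_n & 'I_(N r)}.

Definition node_at (r : 'I_n) (j : nat) : R[i] := a * x r * q ^+ j.+1.
Definition node (i : I) : R[i] := node_at (tag i) (tagged i).

Lemma node_neq0 i : node i != 0.
Proof. by rewrite /node /node_at !mulf_neq0 ?expf_neq0. Qed.

Lemma ratio_neq0 r s : x r / x s != 0.
Proof. by rewrite mulf_neq0 ?invr_eq0. Qed.

Lemma th_ratio_shift r s j : (0 < j <= N r)%N -> th (x r / x s * q ^+ j) != 0.
Proof.
case: j => // j jN; have := hqx r s; rewrite sfE prodf_seq_neq0 => /allP /(_ j).
rewrite mem_index_iota /= => /(_ jN); rewrite exprS.
by congr (th _ != 0); rewrite -!mulrA; ring.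
Qed.

Lemma th_ratio_neq0 r s i m : (i <= N r)%N -> (m <= N s)%N -> (r != s) || (i != m) ->
  th (x r / x s * q ^+ i / q ^+ m) != 0.
Proof.
move=> iN mN; have e0 k : q ^+ k != 0 by rewrite expf_neq0.
have flip t u k : th (x t / x u * q ^+ k) != 0 -> th (x u / x t / q ^+ k) != 0.
  have -> : x u / x t / q ^+ k = (x t / x u * q ^+ k)^-1 by field; rewrite !x0 e0.
  by move=> H; rewrite th_swap // ?mulf_neq0 ?oppr_eq0 ?invr_eq0 ?mulf_neq0 ?invr_eq0.
case: (ltngtP i m) => [im _|mi _|-> ].
- have -> : x r / x s * q ^+ i / q ^+ m = x r / x s / q ^+ (m - i).
    by rewrite -{1}(subnK (ltnW im)) exprD; field; rewrite !x0 !e0.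
  by apply: flip; apply: th_ratio_shift; lia.
- have -> : x r / x s * q ^+ i / q ^+ m = x r / x s * q ^+ (i - m).
    by rewrite -{1}(subnK (ltnW mi)) exprD; field; rewrite !x0 !e0.
  by apply: th_ratio_shift; lia.
rewrite orbF mulfK // => rs; have := rs; rewrite -(inj_eq val_inj) neq_ltn => /orP[lt|lt].
  exact: hxx.
by have := flip s r 0%N; rewrite expr0 mulr1 divr1; apply; exact: hxx.
Qed.

Lemma th_nodes_neq0 (i j : I) : i != j -> th (node i / node j) != 0.
Proof.
case: i => r i; case: j => s j ij; rewrite /node /node_at /=.
have e0 k : q ^+ k != 0 by rewrite expf_neq0.
have -> : a * x r * q ^+ i.+1 / (a * x s * q ^+ j.+1) = x r / x s * q ^+ i / q ^+ j.
  by rewrite !exprS; field; rewrite ?q0 ?x0 ?a0 ?e0.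
apply: th_ratio_neq0; [exact: ltnW | exact: ltnW |].
case: (eqVneq r s) ij => //= rs; move: i j; rewrite rs => i j ij.
by apply: contraNneq ij => /val_inj ->.
Qed.

Section Heights.
Variable k : 'I_n -> nat.
Hypothesis kN : forall r, (k r <= N r)%N.
Local Notation K := (msum k).

Definition string_weight : R[i] :=
  (\prod_(r < n) \prod_(s < n | (r < s)%N)
        (th (q ^ ((k r)%:Z - (k s)%:Z) * x r / x s) / th (x r / x s)))
  * (\prod_(r < n) \prod_(s < n)
        (sf (q ^- (N s) * x r / x s) (k r) / sf (q * x r / x s) (k r)))
  * q ^+ (\sum_(r < n) r.+1 * k r)%N.

(** For a fixed first node, the ratios telescope over the second one along its string. *)
Lemma swt_segment_prod : \prod_(i in segment N k) \prod_(j in ~: segment N k)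
    (th (node i / (q * node j)) / th (node i / node j)) =
  \prod_(r < n) \prod_(s < n) (sf (q ^- (N s) * x r / x s) (k r) / sf (q ^- (k s) * x r / x s) (k r)).
Proof.
have e0 j : q ^+ j != 0 by rewrite expf_neq0.
pose G r i := \prod_(s < n) \prod_(k s <= j < N s)
   (th (x r / x s * q ^+ i / q ^+ j.+1) / th (x r / x s * q ^+ i / q ^+ j)).
have -> : \prod_(i in segment N k) \prod_(j in ~: segment N k)
    (th (node i / (q * node j)) / th (node i / node j)) = \prod_(i in segment N k) G (tag i) (tagged i).
  apply: eq_bigr => i _; rewrite /G -(big_segmentC N _ k (fun s j =>
     th (x (tag i) / x s * q ^+ (tagged i) / q ^+ j.+1) / th (x (tag i) / x s * q ^+ (tagged i) / q ^+ j))).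
  apply: eq_bigr => j _; rewrite /node /node_at.
  by congr (th _ / th _); rewrite !exprS; field; rewrite ?q0 ?x0 ?a0 ?e0.
rewrite (big_segment _ kN G); apply: eq_bigr => r _; rewrite /G exchange_big /=.
apply: eq_bigr => s _; rewrite -prodf_div; apply: eq_big_nat => i /andP[_ ik].
have iN : (i < N r)%N := leq_trans ik (kN r).
rewrite (@telescope_prod_div _ (fun j => th (x r / x s * q ^+ i / q ^+ j))) //; last first.
  move=> j /andP[kj jN]; apply: th_ratio_neq0 => //; first exact: ltnW.
  case: (eqVneq r s) => //= rs; rewrite -rs in kj.
  by rewrite neq_ltn (leq_trans ik kj).
by congr (th _ / th _); field; rewrite ?x0 ?e0.
Qed.

Lemma swt_segment : swt p q node (segment N k) = string_weight.
Proof.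
rewrite /swt (card_segment kN) swt_segment_prod /string_weight.
have e0 j : q ^+ j != 0 by rewrite expf_neq0.
have nz r s : sf (q * x r / x s) (k r) != 0.
  have := hqx r s; rewrite !sfE !prodf_seq_neq0 => /allP H; apply/allP => j.
  rewrite !mem_index_iota => /andP[_ jk]; apply: H; rewrite mem_index_iota /=.
  exact: leq_trans jk (kN r).
have -> : \prod_(r < n) \prod_(s < n) (sf (q ^- (N s) * x r / x s) (k r) / sf (q ^- (k s) * x r / x s) (k r)) =
  (\prod_(r < n) \prod_(s < n) (sf (q ^- (N s) * x r / x s) (k r) / sf (q * x r / x s) (k r))) *
  \prod_(r < n) \prod_(s < n) (sf (q * x r / x s) (k r) / sf (q ^- (k s) * x r / x s) (k r)).
  rewrite -big_split /=; apply: eq_bigr => r _; rewrite -big_split /=; apply: eq_bigr => s _.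
  by rewrite mulrA divfK; last exact: nz.
set P := \prod_(r < n) \prod_(s < n) (_ / sf (q * _ / _) _).
have -> : \prod_(r < n) \prod_(s < n) (sf (q * x r / x s) (k r) / sf (q ^- (k s) * x r / x s) (k r)) =
   (-1) ^+ K * q ^+ 'C(K, 2) * q ^+ (\sum_(r < n) r.+1 * k r)%N *
   \prod_(r < n) \prod_(s < n | (r < s)%N)
        (th (q ^ ((k r)%:Z - (k s)%:Z) * x r / x s) / th (x r / x s)).
  rewrite big_square_split.
  have -> : \prod_(r < n) (sf (q * x r / x r) (k r) / sf (q ^- (k r) * x r / x r) (k r)) =
     \prod_(r < n) ((-1) ^+ k r * q ^+ 'C((k r).+1, 2)).
    apply: eq_bigr => r _; rewrite !mulfK // sf_diag // => j /andP[j0 jk].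
    have := @th_ratio_shift r r j; rewrite divff // mul1r; apply.
    by rewrite j0 (leq_trans jk).
  have -> : \prod_(r < n) \prod_(s < n | (r < s)%N)
       (sf (q * x r / x s) (k r) / sf (q ^- (k s) * x r / x s) (k r) *
        (sf (q * x s / x r) (k s) / sf (q ^- (k r) * x s / x r) (k s))) =
    \prod_(r < n) \prod_(s < n | (r < s)%N) (q ^+ (k s * (k r).+1) *
        (th (q ^ ((k r)%:Z - (k s)%:Z) * x r / x s) / th (x r / x s))).
    apply: eq_bigr => r _; apply: eq_bigr => s rs.
    have rs' : r != s by rewrite -(inj_eq val_inj) neq_ltn rs.
    have := @sf_pair _ p q p1 q0 (x r / x s) (k r) (k s) (ratio_neq0 r s).
    have -> : q ^ ((k r)%:Z - (k s)%:Z) * x r / x s = x r / x s * q ^+ k r / q ^+ k s.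
      by rewrite expfzDr // -exprnN -exprnP; ring.
    rewrite !invf_div !mulrA => <-; last first.
      move=> j jk; rewrite mulrAC; case: (leqP j (k r)) => [jr|rj].
        by apply: th_ratio_neq0; rewrite ?rs' // (leq_trans jr, kN).
      have -> : x r / x s * q ^+ j / q ^+ k s = x r / x s * q ^+ k r / q ^+ (k s + k r - j).
        have -> : q ^+ k s = q ^+ (k s + k r - j) * q ^+ (j - k r) by rewrite -exprD; congr (_ ^+ _); lia.
        have -> : q ^+ j = q ^+ k r * q ^+ (j - k r) by rewrite -exprD; congr (_ ^+ _); lia.
        by field; rewrite ?x0 ?e0.
      apply: th_ratio_neq0; rewrite ?rs' ?kN //.
      by apply: leq_trans (kN s); lia.
    by rewrite !invfM; ring.
  have -> : \prod_(r < n) \prod_(s < n | (r < s)%N) (q ^+ (k s * (k r).+1) *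
        (th (q ^ ((k r)%:Z - (k s)%:Z) * x r / x s) / th (x r / x s))) =
     q ^+ (\sum_(r < n) \sum_(s < n | (r < s)%N) k s * (k r).+1)%N *
     \prod_(r < n) \prod_(s < n | (r < s)%N)
        (th (q ^ ((k r)%:Z - (k s)%:Z) * x r / x s) / th (x r / x s)).
    rewrite expr_sum -big_split /=; apply: eq_bigr => r _.
    by rewrite expr_sum -big_split.
  rewrite big_split /= !prodrXr mulrA; congr (_ * _).
  by rewrite -!mulrA -!exprD sum_pairs_exponent.
set X := \prod_(r < n) \prod_(s < n | _) _.

have s2 : (-1) ^+ K * (-1) ^+ K = 1 :> R[i] by rewrite -exprMn mulrNN mulr1 expr1n.
move: s2; set sg := (-1) ^+ K => s2.
have c0 := e0 'C(K, 2); move: c0; set qc := q ^+ 'C(K, 2) => c0.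
set qs := q ^+ _; clearbody X P sg qc qs.
transitivity (sg * sg * (X * P * qs)); first by field.
by rewrite s2 mul1r.
Qed.

(** A node of [S] is [q] times a node outside [S]. *)
Lemma swt_not_segment S : S != segment N (heights S) -> swt p q node S = 0.
Proof.
case/not_segment => i [j [iS jS tE hE]]; rewrite /swt (bigD1 i) //= (bigD1 j) ?inE //=.
have -> : node i / (q * node j) = 1.
  have -> : node i = q * node j.
    by rewrite /node /node_at hE; move: (tag i) tE => r ->; rewrite [q ^+ _.+2]exprS mulrCA.
  by rewrite divff // mulf_neq0 ?node_neq0.
have t1 : th 1 = 0 := th1 (@complex_complete R) p1.
by rewrite t1 !(mul0r, mulr0).
Qed.

End Heights.
End Strings.

(** * Telescoping along a string *)

Section StringProducts.
Variables (R : realType) (p q : R[i]).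
Hypothesis q0 : q != 0.
Local Notation th := (theta p).
Local Notation sf a k := (sfac q p a (Posz k)).

Lemma sf_neq0W a k m : (k <= m)%N -> sf a m != 0 -> sf a k != 0.
Proof.
move=> km; rewrite !sfE !prodf_seq_neq0 => /allP H; apply/allP => j.
rewrite !mem_index_iota => /andP[_ jk]; apply: H; rewrite mem_index_iota /=.
exact: leq_trans jk km.
Qed.

Lemma sf_neq0P a k : reflect (forall j, (j < k)%N -> th (a * q ^+ j) != 0) (sf a k != 0).
Proof.
rewrite sfE prodf_seq_neq0; apply: (iffP allP) => H j.
  by move=> jk; apply: (H j); rewrite mem_index_iota.
by rewrite mem_index_iota => /andP[_]; exact: H.
Qed.

Lemma sf_cat w m k : sf w (m + k) = sf w m * sf (w * q ^+ m) k.
Proof.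
by rewrite -sf_interval !sfE (big_cat_nat (leq0n m) (leq_addr k m)).
Qed.

Lemma sf_split w k m : (k <= m)%N -> sf w m = sf w k * \prod_(k <= j < m) th (w * q ^+ j).
Proof. by move=> km; rewrite !sfE (big_cat_nat (leq0n k) km). Qed.

(** After cross multiplication both sides are the product of [th (y * q ^+ j)] for
    [j <= N + K]. *)
Lemma left_string y k N K : (k <= N)%N ->
  (forall j, (j <= N + K)%N -> th (y * q ^+ j) != 0) ->
  th (y * q ^+ (k + K)) / th y * (sf y K / sf (y * q ^+ (1 + N)) K) =
  sf (y * q) N / (\prod_(0 <= j < k) th (y * q ^+ j.+1 * q ^+ K / q) *
                  \prod_(k <= j < N) th (y * q ^+ j.+1 * q ^+ K)).
Proof.
move=> kN T0.
pose T m n := \prod_(m <= j < n) th (y * q ^+ j).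
have Tcat m1 m2 m3 : (m1 <= m2)%N -> (m2 <= m3)%N -> T m1 m3 = T m1 m2 * T m2 m3.
  by move=> h1 h2; rewrite /T (big_cat_nat h1 h2).
have Tn0 m1 m2 : (m2 <= (N + K).+1)%N -> T m1 m2 != 0.
  move=> m2N; rewrite prodf_seq_neq0; apply/allP => j; rewrite mem_index_iota => /andP[_ jm].
  by apply: T0; rewrite -ltnS (leq_trans jm).
have e1 : th (y * q ^+ (k + K)) = T (k + K)%N (k + K).+1 by rewrite /T big_nat1.
have e2 : th y = T 0%N 1%N by rewrite /T big_nat1 expr0 mulr1.
have e3 : sf y K = T 0%N K by [].
have e4 : sf (y * q ^+ (1 + N)) K = T (1 + N)%N (1 + N + K)%N by rewrite /T sf_interval.
have e5 : sf (y * q) N = T 1%N (1 + N)%N by rewrite /T sf_interval expr1.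
have e6 : \prod_(0 <= j < k) th (y * q ^+ j.+1 * q ^+ K / q) = T K (k + K)%N.
  rewrite /T addnC sf_interval sfE; apply: eq_bigr => j _; congr th.
  by rewrite exprS; field.
have e7 : \prod_(k <= j < N) th (y * q ^+ j.+1 * q ^+ K) = T (k + K).+1 (N + K).+1.
  rewrite /T -!addnS big_addn addnK; apply: eq_bigr => j _.
  by rewrite addnS -addSn exprD mulrA.
rewrite e1 e2 e3 e4 e5 e6 e7 mulf_div; apply/eqP.
rewrite eqr_div ?mulf_neq0 ?Tn0 ?add1n ?addSn ?ltnS ?leq_add2r ?leqnn ?leq_addr // ; last by lia.
have F1 : T 0%N (N + K).+1 = T 0%N K * T K (k + K)%N * T (k + K)%N (k + K).+1 * T (k + K).+1 (N + K).+1.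
  by rewrite -!Tcat ?ltnS ?leq_add2r // ?leqW ?leq_addl.
have F2 : T 0%N (N + K).+1 = T 0%N 1%N * T 1%N N.+1 * T N.+1 (N + K).+1.
  by rewrite -!Tcat ?ltnS ?leq_addr.
apply/eqP; transitivity (T 0%N (N + K).+1); [rewrite F1 | rewrite F2]; ring.
Qed.

Lemma right_string_in w y k K : y != 0 -> (k <= K)%N -> sf (w / y) (K - k) != 0 ->
  \prod_(0 <= j < k) th (w * q ^+ K / (y * q ^+ j.+1)) = sf (w / y) K / sf (w / y) (K - k).
Proof.
move=> y0 kK nz; rewrite -[in sf _ K](subnK kK) sf_cat mulrAC divff // mul1r sfE big_nat_rev /=.
apply: eq_big_nat => j /andP[_ jk]; rewrite add0n; congr th.
have E : q ^+ K = q ^+ (K - k) * (q ^+ j * (q * q ^+ (k - j.+1))).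
  by rewrite -exprS -!exprD; congr (_ ^+ _); lia.
by rewrite E exprS; field; rewrite y0 ?q0 !expf_neq0.
Qed.

(** Both sides come from cutting the same product of [N + K - k] factors at [N] or
    at [K]. *)
Lemma right_string_out w y k N K : y != 0 -> (k <= K)%N -> (k <= N)%N ->
  sf (w * q ^- N / y) K != 0 ->
  \prod_(k <= j < N) th (w * q ^+ K / (y * q ^+ j.+1)) =
  sf (w / y) (K - k) / sf (w * q ^- N / y) K * sf (w * q ^- N / y) N.
Proof.
move=> y0 kK kN nz.
have -> : w / y = w * q ^- N / y * q ^+ N by field; rewrite y0 expf_neq0.
have cat : sf (w * q ^- N / y) (N + (K - k)) = sf (w * q ^- N / y) (K + (N - k)).
  by congr sfac; congr Posz; lia.
rewrite mulrAC [_ * sf _ N]mulrC -sf_cat cat sf_cat mulrAC divff // mul1r.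
rewrite -{1}[k]add0n big_addn sfE big_nat_rev /=; apply: eq_big_nat => j /andP[_ jk].
rewrite add0n; congr th.
have E : q ^+ N = q ^+ j * q ^+ (N - k - j.+1 + k).+1.
  by rewrite -!exprD; congr (_ ^+ _); lia.
by rewrite E; field; rewrite y0 !expf_neq0.
Qed.
End StringProducts.

(** * Terms of the two multiple sums *)

Local Arguments sfac : simpl never.

Section Terms.
Variables (R : realType) (p q : R[i]).
Hypotheses (p1 : `|p| < 1) (q0 : q != 0).
Local Notation th := (theta p).
Local Notation sf a k := (sfac q p a (Posz k)).
Variables (n : nat) (N : 'I_n -> nat) (a b c d e f lam : R[i]).
Hypothesis hlam : lam = q * a ^+ 2 / (b * c * d).
Hypotheses (a0 : a != 0) (b0 : b != 0) (c0 : c != 0) (d0 : d != 0) (e0 : e != 0) (f0 : f != 0).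
Local Notation h x := (lam * a * x * q ^+ (msum N + 1) / (e * f)).

Definition left_factor (x : 'I_n -> R[i]) (k : 'I_n -> nat) : R[i] :=
  let K := msum k in
    (\prod_(r < n) (th (a * x r * q ^+ (k r + K)) / th (a * x r)))
  * (\prod_(r < n) (sf (a * x r) K / sf (a * x r * q ^+ (1 + N r)) K))
  * (\prod_(r < n)
        (sfacs q p [:: c * x r; d * x r; h (x r)] (k r)
         / sfacs q p [:: a * x r * q / b; a * x r * q / e; a * x r * q / f] (k r)))
  * (sfacs q p [:: b; e; f] K
        / sfacs q p [:: a * q / c; a * q / d; e * f * q ^- (msum N) / lam] K).

Definition right_factor (x : 'I_n -> R[i]) (k : 'I_n -> nat) : R[i] :=
  let K := msum k in
    (th (lam * q ^+ (2 * K)) / th lam)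
  * (sfacs q p [:: lam; lam * c / a; lam * d / a; e; f] K
        / sfacs q p [:: lam * q ^+ (msum N + 1); a * q / c; a * q / d; lam * q / e; lam * q / f] K)
  * (\prod_(r < n)
        ((sf (lam * b / (a * x r)) K * sf (h (x r)) (k r))
         / (sf (e * f * q ^- (N r) / (a * x r)) K * sf (a * x r * q / b) (k r))))
  * (\prod_(r < n)
        (sfac q p (e * f / (a * x r)) (K%:Z - (k r)%:Z)
         / sfac q p (lam * b / (a * x r)) (K%:Z - (k r)%:Z))).

(** The part of the prefactor that changes when [x] is dilated. *)
Definition box_factor (x : 'I_n -> R[i]) : R[i] := \prod_(r < n)
  (sfacs q p [:: a * x r * q; a * x r * q / (e * f)] (N r)
   / sfacs q p [:: a * x r * q / e; a * x r * q / f] (N r)).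

Variable x : 'I_n -> R[i].
Hypothesis x0 : forall r, x r != 0.
Hypothesis hxx : forall r s : 'I_n, (r < s)%N -> th (x r / x s) != 0.
Hypothesis hqx : forall r s, sf (q * x r / x s) (N r) != 0.

Local Notation U := (node q (N := N) x a).

(** The subset identity is applied with [c] and [d] replaced by [a * q / c] and
    [a * q / d], and its [lam] is the one of the theorem. *)
Lemma lam_subset : a * q / c * (a * q / d) / (b * q) = lam.
Proof. by rewrite hlam; field; rewrite b0 q0 c0 d0. Qed.

Lemma lam_neq0 : lam != 0.
Proof. by rewrite hlam !(mulf_neq0, invr_eq0, expf_neq0). Qed.

Section SegmentTerms.
Variable k : 'I_n -> nat.
Hypothesis kN : forall r, (k r <= N r)%N.
Local Notation K := (msum k).

(** The last product is the same for every [k], so it leaves the sum over the box. *)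
Lemma lterm_segment :
  (forall r j, (j <= N r + K)%N -> th (a * x r * q ^+ j) != 0) ->
  (forall r, sf (a * x r * q / e) (N r) != 0) ->
  (forall r, sf (a * x r * q / f) (N r) != 0) ->
  lterm p q U b (a * q / c) (a * q / d) e f (segment N k) =
  string_weight p q N x k * left_factor x k *
  \prod_(r < n) (sf (a * x r * q / e) (N r) * sf (a * x r * q / f) (N r) / sf (a * x r * q) (N r)).
Proof.
move=> T0 E0 F0; have l0 := lam_neq0; have qe m : q ^+ m != 0 by rewrite expf_neq0.
rewrite /lterm (card_segment kN) swt_segment // card_nodes lam_subset.
have y0 r : a * x r != 0 by rewrite mulf_neq0.
pose P r := \prod_(0 <= j < k r) th (a * x r * q ^+ j.+1 * q ^+ K / q).
pose Q r := \prod_(k r <= j < N r) th (a * x r * q ^+ j.+1 * q ^+ K).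
have -> : \prod_(i in segment N k) (th (U i / (a * q / c)) * th (U i / (a * q / d)) *
      th (U i / (e * f / (lam * q ^+ msum N))) / (th (U i / b) * th (U i * q ^+ K / q))) =
    \prod_(r < n) (sf (c * x r) (k r) * sf (d * x r) (k r) * sf (h (x r)) (k r) /
      (sf (a * x r * q / b) (k r) * P r)).
  rewrite (big_segment _ kN (fun r j => th (node_at q x a r j / (a * q / c)) *
    th (node_at q x a r j / (a * q / d)) * th (node_at q x a r j / (e * f / (lam * q ^+ msum N))) /
    (th (node_at q x a r j / b) * th (node_at q x a r j * q ^+ K / q)))).
  apply: eq_bigr => r _; rewrite prodf_div !big_split /= !sfE /P /node_at.
  by congr (_ * _ * _ / (_ * _)); apply: eq_bigr => j _; congr th;
    rewrite ?addn1 !exprS; field; rewrite ?q0 ?a0 ?b0 ?c0 ?d0 ?e0 ?f0 ?l0 ?qe.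
have -> : \prod_(i in ~: segment N k) (th (U i / e) * th (U i / f) / th (U i * q ^+ K)) =
    \prod_(r < n) (sf (a * x r * q / e) (N r) / sf (a * x r * q / e) (k r) *
      (sf (a * x r * q / f) (N r) / sf (a * x r * q / f) (k r)) / Q r).
  rewrite (big_segmentC N _ k (fun r j => th (node_at q x a r j / e) * th (node_at q x a r j / f) /
    th (node_at q x a r j * q ^+ K))).
  apply: eq_bigr => r _; rewrite prodf_div !big_split /=.
  have part w : sf (a * x r * q / w) (N r) != 0 -> w != 0 ->
      \prod_(k r <= j < N r) th (node_at q x a r j / w) = sf (a * x r * q / w) (N r) / sf (a * x r * q / w) (k r).
    move=> nz w0; rewrite (sf_split _ _ _ (kN r)) mulrAC divff ?mul1r; last first.
      exact: sf_neq0W (kN r) nz.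
    by apply: eq_bigr => j _; congr th; rewrite /node_at exprS; field.
  by rewrite (part e (E0 r) e0) (part f (F0 r) f0).
set W := string_weight _ _ _ _ _.
set A := sf b K * _ * _ / _.
have -> : A = sfacs q p [:: b; e; f] K / sfacs q p [:: a * q / c; a * q / d; e * f * q ^- msum N / lam] K.
  rewrite /A /sfacs !big_cons !big_nil !mulr1 !mulrA; congr (_ / (_ * sf _ _)).
  by field; rewrite l0 qe.
rewrite /left_factor; move: (_ / sfacs _ _ _ K) => {}A.
rewrite -[LHS]mulrA -[LHS]mulrA -[RHS]mulrA; congr (W * _).
rewrite [in RHS]mulrAC [RHS]mulrC.
congr (A * _).
rewrite -!big_split /=; apply: eq_bigr => r _.
rewrite left_string //; last exact: T0.
have nq : sf (a * x r * q) (N r) != 0.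
  apply/sf_neq0P => j jN; rewrite -mulrA -exprS; apply: T0.
  exact: leq_trans jN (leq_addr _ _).
rewrite /sfacs !big_cons !big_nil !mulr1 -/(P r) -/(Q r) !invfM.
move: (P r)^-1 (Q r)^-1 (sf (a * x r * q / b) _)^-1 (sf (a * x r * q / e) (k r))^-1
  (sf (a * x r * q / f) (k r))^-1 nq => iP iQ iB iE iF.
by move: (sf (a * x r * q) _) => Y Y0; field.
Qed.

Lemma sf_natB m w : (m <= K)%N -> sfac q p w (K%:Z - m%:Z) = sf w (K - m).
Proof. by move=> mK; rewrite subzn. Qed.

Lemma rterm_segment :
  (forall r, sf (e * f * q ^- N r / (a * x r)) K != 0) ->
  (forall r, sf (lam * b / (a * x r)) (K - k r) != 0) ->
  rterm p q U b (a * q / c) (a * q / d) e f (segment N k) =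
  string_weight p q N x k * right_factor x k *
  \prod_(r < n) sf (e * f * q ^- N r / (a * x r)) (N r).
Proof.
move=> B0 L0; have l0 := lam_neq0; have qe m : q ^+ m != 0 by rewrite expf_neq0.
have y0 r : a * x r != 0 by rewrite mulf_neq0.
have kK r : (k r <= K)%N by rewrite /msum (bigD1 r) //= leq_addr.
rewrite /rterm (card_segment kN) swt_segment // card_nodes lam_subset.
have -> : \prod_(i in segment N k) (th (lam * b * q ^+ K / U i) * th (U i / (e * f / (lam * q ^+ msum N))) / th (U i / b)) =
    \prod_(r < n) (sf (lam * b / (a * x r)) K / sf (lam * b / (a * x r)) (K - k r) * sf (h (x r)) (k r) /
      sf (a * x r * q / b) (k r)).
  rewrite (big_segment _ kN (fun r j => th (lam * b * q ^+ K / node_at q x a r j) *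
    th (node_at q x a r j / (e * f / (lam * q ^+ msum N))) / th (node_at q x a r j / b))).
  apply: eq_bigr => r _; rewrite prodf_div !big_split /= right_string_in // !sfE.
  by congr (_ / _ * _ / _); apply: eq_bigr => j _; congr th;
    rewrite /node_at ?addn1 !exprS; field; rewrite ?q0 ?a0 ?b0 ?c0 ?d0 ?e0 ?f0 ?l0 ?qe.
have -> : \prod_(i in ~: segment N k) th (e * f * q ^+ K / U i) =
    \prod_(r < n) (sf (e * f / (a * x r)) (K - k r) / sf (e * f * q ^- N r / (a * x r)) K *
       sf (e * f * q ^- N r / (a * x r)) (N r)).
  rewrite (big_segmentC N _ k (fun r j => th (e * f * q ^+ K / node_at q x a r j))).
  by apply: eq_bigr => r _; rewrite right_string_out.
set W := string_weight _ _ _ _ _.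
set A := sf lam K * _ * _ * _ * _ / _.
have -> : A = sfacs q p [:: lam; lam * c / a; lam * d / a; e; f] K
        / sfacs q p [:: lam * q ^+ (msum N + 1); a * q / c; a * q / d; lam * q / e; lam * q / f] K.
  rewrite /A /sfacs !big_cons !big_nil !mulr1 !mulrA addn1.
  congr (_ * sf _ _ * sf _ _ * _ * _ / _); rewrite hlam; field; rewrite ?q0 ?a0 ?b0 ?c0 ?d0 //.
rewrite /right_factor; move: (_ / sfacs _ _ _ K) (_ / th lam) => {}A B.
rewrite -[LHS]mulrA -[LHS]mulrA -[LHS]mulrA -[RHS]mulrA; congr (W * _).
rewrite -[RHS]mulrA -[RHS]mulrA -[RHS]mulrA; congr (B * (A * _)).
rewrite -!big_split /=; apply: eq_bigr => r _; rewrite !sf_natB // !invfM.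
by ring.
Qed.
End SegmentTerms.
End Terms.

(** * The transformation for generic parameters *)

Section Generic.
Variables (R : realType) (p q : R[i]).
Hypotheses (p1 : `|p| < 1) (q0 : q != 0).
Local Notation th := (theta p).
Local Notation sf a k := (sfac q p a (Posz k)).
Variables (n : nat) (N : 'I_n -> nat) (a b c d e f lam : R[i]).
Hypothesis hlam : lam = q * a ^+ 2 / (b * c * d).
Hypotheses (a0 : a != 0) (b0 : b != 0) (c0 : c != 0) (d0 : d != 0) (e0 : e != 0) (f0 : f != 0).
Local Notation M := (msum N).
Local Notation nodes := (node q (N := N)).
Local Notation c1 := (a * q / c).
Local Notation d1 := (a * q / d).

(** The nonvanishing conditions that serve only in the proof of the subset identity. *)
Definition generic_pair (u v : R[i]) m : bool :=
  [&& th (u / c1 * q ^+ m) != 0,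
      th (c1 * d1 / u * q ^+ m) != 0, th (c1 * d1 / u / v * q ^+ m) != 0,
      th (c1 * lam / u * q ^+ m) != 0, th (c1 * lam / u / v * q ^+ m) != 0,
      th (e * f / u * q ^+ m) != 0 & th (e * f / u / v / q ^+ m) != 0].

(** Denominators that depend on [x r], at the largest index that occurs. *)
Definition box_regular (x : 'I_n -> R[i]) r : bool :=
  [&& sf (a * x r * q / b) (N r) != 0, sf (a * x r * q / e) (N r) != 0,
      sf (a * x r * q / f) (N r) != 0,
      sf (e * f * q ^- N r / (a * x r)) M != 0 &
      sf (lam * b / (a * x r)) (M - N r) != 0].

Hypothesis lamN : forall m, (m <= M.*2)%N -> th (lam * q ^+ m) != 0.
Hypotheses (c1N : sf c1 M != 0) (d1N : sf d1 M != 0) (gN : sf (e * f * q ^- M / lam) M != 0).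
Hypotheses (eN : sf (lam * q / e) M != 0) (fN : sf (lam * q / f) M != 0).

Variable x : 'I_n -> R[i].
Hypothesis x0 : forall r, x r != 0.
Hypothesis hxx : forall r s : 'I_n, (r < s)%N -> th (x r / x s) != 0.
Hypothesis hqx : forall r s, sf (q * x r / x s) (N r) != 0.
Hypothesis reg : forall r, box_regular x r.
Hypothesis axq0 : forall r m, (m <= M.*2)%N -> th (a * x r * q ^+ m) != 0.
Hypothesis gen : forall (i j : {r : 'I_n & 'I_(N r)}) m, (m <= M)%N ->
  generic_pair (nodes x a i) (nodes x a j) m.

Lemma msum_ge (k : 'I_n -> nat) r : (k r <= msum k)%N.
Proof. by rewrite /msum (bigD1 r) //= leq_addr. Qed.

Lemma msum_le (k : 'I_n -> nat) : (forall r, (k r <= N r)%N) -> (msum k <= M)%N.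
Proof. by move=> kN; apply: leq_sum. Qed.

Lemma msum_sub_le (k : 'I_n -> nat) r : (forall r, (k r <= N r)%N) -> (msum k - k r <= M - N r)%N.
Proof.
move=> kN; rewrite /msum (bigD1 r) //= addKn [X in (_ <= X - _)%N](bigD1 r) //= addKn.
exact: leq_sum.
Qed.

Lemma box_factorE r :
  (-1) ^+ N r * (\prod_(0 <= j < N r) (a * x r * q ^+ j.+1 / (e * f))) * sf (e * f * q ^- N r / (a * x r)) (N r) =
  sf (a * x r * q / (e * f)) (N r).
Proof.
have y0 : a * x r != 0 by rewrite mulf_neq0.
have -> : (-1) ^+ N r = \prod_(0 <= j < N r) (-1) :> R[i] by rewrite prodr_const_nat subn0.
rewrite [sf (_ * q ^- _ / _) _]sfE [X in _ * X]big_nat_rev /= add0n -!big_split sfE /=.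
apply: eq_big_nat => j /andP[_ jN]; set w := a * x r * q ^+ j.+1 / (e * f).
have w0 : w != 0 by rewrite /w !mulf_neq0 ?invr_eq0 ?expf_neq0 ?mulf_neq0.
have -> : e * f * q ^- N r / (a * x r) * q ^+ (N r - j.+1) = w^-1.
  rewrite -{1}(subnK jN) exprD /w; field; rewrite ?e0 ?f0 ?q0 ?a0 ?x0 ?expf_neq0 //.
have -> : a * x r * q / (e * f) * q ^+ j = w by rewrite /w exprS; ring.
by rewrite (th_swap p1) //; field.
Qed.

(** Only segments contribute to the sums over subsets, and the two products left over by their
    terms combine with the monomial prefactor into [box_factor]. *)
Lemma generic_transformation :
  \sum_(k : {dffun forall r : 'I_n, 'I_(N r).+1})
     string_weight p q N x (fun r => k r) * left_factor p q N a b c d e f lam x (fun r => k r) =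
  sf (lam * q / e) M * sf (lam * q / f) M / (sf (lam * q) M * sf (lam * q / (e * f)) M)
  * box_factor p q N a e f x
  * \sum_(k : {dffun forall r : 'I_n, 'I_(N r).+1})
     string_weight p q N x (fun r => k r) * right_factor p q N a b c d e f lam x (fun r => k r).
Proof.
have l0 := lam_neq0 q0 hlam a0 b0 c0 d0.
have lamE := lam_subset q0 hlam b0 c0 d0.
have NM r : (N r <= M)%N := msum_ge N r.
have nodeE (i : {r : 'I_n & 'I_(N r)}) m :
    nodes x a i * q ^+ m = a * x (tag i) * q ^+ ((tagged i).+1 + m).
  by rewrite /node /node_at exprD mulrA.
have := @subset_transformation R p q {r : 'I_n & 'I_(N r)} (nodes x a) b c1 d1 e f p1 q0 b0.
rewrite !card_nodes lamE => T.
have regE r : [/\ sf (a * x r * q / b) (N r) != 0, sf (a * x r * q / e) (N r) != 0,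
      sf (a * x r * q / f) (N r) != 0,
      sf (e * f * q ^- N r / (a * x r)) M != 0 &
      sf (lam * b / (a * x r)) (M - N r) != 0] := and5P (reg r).
have {}T : \sum_S lterm p q (nodes x a) b c1 d1 e f S =
    (-1) ^+ M * \prod_i (nodes x a i / (e * f)) *
    (sf (lam * q / e) M * sf (lam * q / f) M /
     (sf (lam * q) M * sf (lam * q / (e * f)) M)) *
    \sum_S rterm p q (nodes x a) b c1 d1 e f S.
  apply: T => //.
  - by rewrite !mulf_neq0 ?invr_eq0.
  - by rewrite !mulf_neq0 ?invr_eq0.
  - exact: node_neq0.
  - exact: th_nodes_neq0.
  - move=> i m mM; rewrite nodeE axq0 // -addnn leq_add ?(ltnW mM) //.
    exact: leq_trans (ltn_ord _) (NM _).
  - case=> r j; have [/sf_neq0P/(_ j (ltn_ord j)) bj _ _ _ _] := regE r.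
    by apply: contraNneq bj => <-; rewrite /node /node_at /= exprS; apply/eqP; congr th; ring.
  - by move: gN; congr (sf _ _ != 0); field; rewrite l0 expf_neq0.
  - by move=> i m mM; have /and5P[] := gen i i mM.
  - by move=> i m /ltnW mM; have /and5P[] := gen i i mM.
  - by move=> i j m /ltnW mM _; have /and5P[] := gen i j mM.
  - by move=> i m mM; have /and5P[] := gen i i mM.
  - by move=> i j m mM _; have /and5P[_ _ _ _ /and3P[]] := gen i j mM.
  - by move=> i m mM; have /and5P[_ _ _ _ /and3P[]] := gen i i mM.
  - by move=> i j m /ltnW mM _; have /and5P[_ _ _ _ /and3P[]] := gen i j mM.
rewrite (sum_segments (G := lterm p q (nodes x a) b c1 d1 e f)) in T; last first.
  by move=> S SN; rewrite /lterm (swt_not_segment p1 q0 a0 x0 SN) !mul0r.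
rewrite (sum_segments (G := rterm p q (nodes x a) b c1 d1 e f)) in T; last first.
  by move=> S SN; rewrite /rterm (swt_not_segment p1 q0 a0 x0 SN) !mul0r.
have kN (k : {dffun forall r : 'I_n, 'I_(N r).+1}) r : (k r <= N r)%N by rewrite -ltnS.
pose Z := \prod_(r < n) (sf (a * x r * q / e) (N r) * sf (a * x r * q / f) (N r) / sf (a * x r * q) (N r)).
pose Z' := \prod_(r < n) sf (e * f * q ^- N r / (a * x r)) (N r).
have TL : \sum_(k : {dffun forall r : 'I_n, 'I_(N r).+1}) lterm p q (nodes x a) b c1 d1 e f (segment N (fun r => k r)) =
   (\sum_(k : {dffun forall r : 'I_n, 'I_(N r).+1})
     string_weight p q N x (fun r => k r) * left_factor p q N a b c d e f lam x (fun r => k r)) * Z.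
  rewrite mulr_suml; apply: eq_bigr => k _; apply: lterm_segment => //.
  - move=> r j jK; apply: axq0; apply: leq_trans jK _.
    by rewrite -addnn leq_add // msum_le.
  - by move=> r; have [] := regE r.
  - by move=> r; have [] := regE r.
have TR : \sum_(k : {dffun forall r : 'I_n, 'I_(N r).+1}) rterm p q (nodes x a) b c1 d1 e f (segment N (fun r => k r)) =
   (\sum_(k : {dffun forall r : 'I_n, 'I_(N r).+1})
     string_weight p q N x (fun r => k r) * right_factor p q N a b c d e f lam x (fun r => k r)) * Z'.
  rewrite mulr_suml; apply: eq_bigr => k _; apply: rterm_segment => // r; have [_ _ _ B L] := regE r.
    exact: sf_neq0W (msum_le (kN k)) B.
  exact: sf_neq0W (msum_sub_le r (kN k)) L.
(* The monomial prefactor reflects th (e f / U) into th (U / (e f)). *)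
have BZ : (-1) ^+ M * (\prod_i (nodes x a i / (e * f))) * Z' = box_factor p q N a e f x * Z.
  rewrite (big_nodes N _ (fun r j => node_at q x a r j / (e * f))).
  have -> : (-1) ^+ M = \prod_(r < n) (-1) ^+ N r :> R[i] by rewrite prodrXr.
  rewrite -!big_split /=; apply: eq_bigr => r _; rewrite box_factorE.
  rewrite /sfacs !big_cons !big_nil !mulr1; have [_ E0 F0 _ _] := regE r.
  have Y0 : sf (a * x r * q) (N r) != 0.
    apply/sf_neq0P => j jN; rewrite -mulrA -exprS; apply: axq0.
    by rewrite -addnn (leq_trans jN) // (leq_trans (NM r)) ?leq_addr.
  move: (sf _ _) Y0 (sf _ _) E0 (sf _ _) F0 (sf _ _) => Y Y0 E E0 F F0 X.
  by field; rewrite E0 F0 Y0.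
have Z0 : Z != 0.
  rewrite prodf_seq_neq0; apply/allP => r _ /=; have [_ E0 F0 _ _] := regE r.
  rewrite !mulf_neq0 ?invr_eq0 //; apply/sf_neq0P => j jN; rewrite -mulrA -exprS; apply: axq0.
  by rewrite -addnn (leq_trans jN) // (leq_trans (NM r)) ?leq_addr.
apply: (mulIf Z0); rewrite -TL T TR.
move: (\sum_k _) (_ / (_ * _)) => SR pr.
transitivity (pr * SR * ((-1) ^+ M * \prod_i (nodes x a i / (e * f)) * Z')); first by ring.
by rewrite BZ; ring.
Qed.
End Generic.

(** * Removing genericity by dilation *)

Section Dilation.
Local Open Scope classical_set_scope.
Variable K : numFieldType.
Hypothesis K_complete : geometrically_complete K.
Variable p : K.
Hypothesis p1 : `|p| < 1.

Lemma cvg_prod_seq (T : Type) (F : set_system T) (FF : Filter F) (J : Type) (s : seq J)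
    (P : pred J) (f : J -> T -> K) (l : J -> K) :
  (forall j, P j -> f j @ F --> l j) ->
  (fun t => \prod_(j <- s | P j) f j t) @ F --> \prod_(j <- s | P j) l j.
Proof.
move=> fl; elim: s => [|j s IH].
  by rewrite big_nil; under eq_fun do rewrite big_nil; exact: cvg_cst.
rewrite big_cons; under eq_fun do rewrite big_cons.
by case: ifP => // Pj; apply: cvgM => //; exact: fl.
Qed.

Lemma cvg_sum_seq (T : Type) (F : set_system T) (FF : Filter F) (J : Type) (s : seq J)
    (f : J -> T -> K) (l : J -> K) :
  (forall j, f j @ F --> l j) ->
  (fun t => \sum_(j <- s) f j t) @ F --> \sum_(j <- s) l j.
Proof.
move=> fl; elim: s => [|j s IH].
  by rewrite big_nil; under eq_fun do rewrite big_nil; exact: cvg_cst.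
by rewrite big_cons; under eq_fun do rewrite big_cons; apply: cvgD.
Qed.

Lemma cvg_div (T : Type) (F : set_system T) (FF : Filter F) (f g : T -> K) (l m : K) :
  m != 0 -> f @ F --> l -> g @ F --> m -> (fun t => f t / g t) @ F --> l / m.
Proof. by move=> m0 fl gm; apply: cvgM => //; exact: cvgV. Qed.

Lemma cvg_dilation (z : K) : (fun t => z * t) @ (1 : K)^' --> z.
Proof. by rewrite -[X in _ --> X]mulr1; apply: cvgMr; apply: cvg_within. Qed.

Lemma cvg_contraction (z : K) : (fun t => z / t) @ (1 : K)^' --> z.
Proof.
rewrite -[X in _ --> X]divr1; apply: cvg_div; [exact: oner_neq0 | exact: cvg_cst|].
exact: cvg_within.
Qed.

Lemma near_neq0 (T : Type) (F : set_system T) (FF : Filter F) (f : T -> K) (l : K) :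
  l != 0 -> f @ F --> l -> \forall t \near F, f t != 0.
Proof.
move=> l0 fl; have t0 : 0 < `|l| by rewrite normr_gt0.
have /cvgrPdist_lt/(_ _ t0) := fl; apply: filterS => t; apply: contraTneq => ->.
by rewrite subr0 ltxx.
Qed.

Lemma near_dilation_neq0 : \forall t \near (1 : K)^', t != 0.
Proof. by apply: (@near_neq0 _ _ _ _ 1); [exact: oner_neq0 | exact: cvg_within]. Qed.

(** The isolation of zeros along a curve through [1]. *)
Lemma th_isolated_comp (g : K -> K) (z : K) : z != 0 -> g @ (1 : K)^' --> (1 : K) ->
  (\forall t \near (1 : K)^', g t != 1) -> \forall t \near (1 : K)^', th p (z * g t) != 0.
Proof.
move=> z0 g1 gN; have H := th_isolated K_complete p1 z0.
have H' : \forall w \near (1 : K), w != 1 -> th p (z * w) != 0 by exact: H.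
have /= {}H' := g1 _ H'.
by apply: filterS2 gN H' => t tN; apply.
Qed.

(** All conditions on the nodes involve [t], its inverse or the square of its inverse. *)
Lemma near_th_neq0 (z : K) : z != 0 -> \forall t \near (1 : K)^',
  [/\ th p (z * t) != 0, th p (z / t) != 0 & th p (z / t / t) != 0].
Proof.
move=> z0.
have n1 : \forall t \near (1 : K)^', t != 1 by exact: nbhs_dnbhs_neq.
have n0 := near_dilation_neq0.
have inv1 : (fun t => t^-1) @ (1 : K)^' --> (1 : K).
  by rewrite -[X in _ --> X]invr1; apply: cvgV; [exact: oner_neq0 | exact: cvg_within].
have H1 := th_isolated K_complete p1 z0.
have H2 : \forall t \near (1 : K)^', th p (z / t) != 0.
  apply: th_isolated_comp => //; apply: filterS n1 => t; apply: contra_neq => h.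
  by rewrite -[t]invrK h invr1.
have H3 : \forall t \near (1 : K)^', th p (z * (t^-1 * t^-1)) != 0.
  apply: th_isolated_comp => //.
    by rewrite -[X in _ --> X]mulr1; apply: cvgM.
  have nN : \forall t \near (1 : K)^', t + 1 != 0.
    apply: (@near_neq0 _ _ _ _ (1 + 1)); first by rewrite -mulr2n pnatr_eq0.
    by apply: cvgD; [exact: cvg_within | exact: cvg_cst].
  apply: filterS3 n0 n1 nN => t t0 tN1 tN2; apply/eqP => h.
  have : (t - 1) * (t + 1) = 0.
    have tt : t * t = 1 by apply: invr_inj; rewrite invfM h invr1.
    by rewrite -[RHS](subrr 1) -{3}tt; ring.
  by move/eqP; rewrite mulf_eq0 subr_eq0 (negPf tN1) (negPf tN2).
by apply: filterS3 H1 H2 H3 => t h1 h2; rewrite mulrA.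
Qed.

Lemma dilation_limits_eq (f g : K -> K) (l m : K) :
  (\forall t \near (1 : K)^', f t = g t) -> f @ (1 : K)^' --> l -> g @ (1 : K)^' --> m -> l = m.
Proof.
move=> fg fl gm; have fm : f @ (1 : K)^' --> m.
  by apply: cvg_trans gm; apply: near_eq_cvg; apply: filterS fg => t ->.
exact: cvg_unique fl fm.
Qed.

End Dilation.

Ltac nonzero := by rewrite !(mulf_neq0, invr_eq0, expf_neq0).

Section Perturbation.
Local Open Scope classical_set_scope.
Variables (R : realType) (p q : R[i]).
Hypotheses (p1 : `|p| < 1) (q0 : q != 0).
Local Notation th := (theta p).
Local Notation sf a k := (sfac q p a (Posz k)).
Let K : numFieldType := R[i].
Local Notation near1 := ((1 : K)^').
Let Kc : geometrically_complete K := @complex_complete R.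

Lemma cvg_dil (g : K -> K) (z : K) : (forall t, g t = z * t) -> g @ near1 --> z.
Proof. by move=> /funext ->; exact: cvg_dilation. Qed.

Lemma cvg_con (g : K -> K) (z : K) : (forall t, g t = z / t) -> g @ near1 --> z.
Proof. by move=> /funext ->; exact: cvg_contraction. Qed.

Lemma sf_cvg (g : K -> K) (z : K) k : z != 0 -> g @ near1 --> z ->
  (fun t => sf (g t) k : K) @ near1 --> (sf z k : K).
Proof.
move=> z0 gz; apply: cvg_prod_seq => j _.
apply: (@th_continuous K Kc p p1 _ _ _ (fun t => g t * q ^+ j)).
  by rewrite mulf_neq0 ?expf_neq0.
by apply: cvgMl.
Qed.

Lemma sfacs_cvg_nil k : (fun t : K => sfacs q p [::] k : K) @ near1 --> (sfacs q p [::] k : K).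
Proof. exact: cvg_cst. Qed.

Lemma sfacs_cvg_cons (g : K -> K) (z : K) gs zs k : z != 0 -> g @ near1 --> z ->
  (fun t => sfacs q p (gs t) (Posz k) : K) @ near1 --> (sfacs q p zs (Posz k) : K) ->
  (fun t => sfacs q p (g t :: gs t) (Posz k) : K) @ near1 --> (sfacs q p (z :: zs) (Posz k) : K).
Proof.
move=> z0 gz IH; rewrite /sfacs big_cons; under eq_fun do rewrite big_cons.
apply: (@cvgM K).
  exact: sf_cvg.
exact: IH.
Qed.

Variables (n : nat) (N : 'I_n -> nat) (a b c d e f lam : R[i]).
Hypothesis hlam : lam = q * a ^+ 2 / (b * c * d).
Hypotheses (a0 : a != 0) (b0 : b != 0) (c0 : c != 0) (d0 : d != 0) (e0 : e != 0) (f0 : f != 0).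
Local Notation M := (msum N).
Variable x : 'I_n -> R[i].
Hypothesis x0 : forall r, x r != 0.
Local Notation dil t := (fun r => t * x r).

(** The weight depends on the ratios [x r / x s] only. *)
Lemma string_weight_dilation t k : t != 0 ->
  string_weight p q N (dil t) k = string_weight p q N x k.
Proof.
move=> t0; have E w r s : w * (t * x r) / (t * x s) = w * x r / x s.
  by field; rewrite t0 x0.
have E1 r s : t * x r / (t * x s) = x r / x s by have := E 1 r s; rewrite !mul1r.
rewrite /string_weight; congr (_ * _ * _); apply: eq_bigr => r _; apply: eq_bigr => s _.
  by rewrite E E1.
by rewrite !E.
Qed.

Let l0 : lam != 0 := lam_neq0 q0 hlam a0 b0 c0 d0.

Lemma box_factor_cvg :
  (forall r, sfacs q p [:: a * x r * q / e; a * x r * q / f] (N r) != 0) ->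
  (fun t : K => box_factor p q N a e f (dil t) : K) @ near1 --> (box_factor p q N a e f x : K).
Proof.
move=> nz; apply: cvg_prod_seq => r _; apply: cvg_div; first exact: nz.
  apply: sfacs_cvg_cons; [nonzero | by apply: cvg_dil => t; ring |].
  apply: sfacs_cvg_cons; [nonzero | by apply: cvg_dil => t; ring | exact: sfacs_cvg_nil].
apply: sfacs_cvg_cons; [nonzero | by apply: cvg_dil => t; ring |].
apply: sfacs_cvg_cons; [nonzero | by apply: cvg_dil => t; ring | exact: sfacs_cvg_nil].
Qed.

Section Limits.
Variable k : 'I_n -> nat.
Local Notation kK := (msum k).

Lemma left_factor_cvg :
  (forall r, th (a * x r) != 0) ->
  (forall r, sf (a * x r * q ^+ (1 + N r)) kK != 0) ->
  (forall r, sfacs q p [:: a * x r * q / b; a * x r * q / e; a * x r * q / f] (k r) != 0) ->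
  (fun t : K => left_factor p q N a b c d e f lam (dil t) k : K) @ near1 -->
  (left_factor p q N a b c d e f lam x k : K).
Proof.
move=> T0 S0 V0; apply: (@cvgM K); last exact: cvg_cst.
apply: (@cvgM K).
  apply: (@cvgM K); apply: cvg_prod_seq => r _; apply: cvg_div.
  - exact: T0.
  - apply: (th_continuous Kc p1); first by nonzero.
    by apply: cvg_dil => t; ring.
  - apply: (th_continuous Kc p1); first by nonzero.
    by apply: cvg_dil => t; ring.
  - exact: S0.
  - by apply: sf_cvg; [nonzero | apply: cvg_dil => t; ring].
  - by apply: sf_cvg; [nonzero | apply: cvg_dil => t; ring].
apply: cvg_prod_seq => r _; apply: cvg_div; first exact: V0.
  apply: sfacs_cvg_cons; [nonzero | by apply: cvg_dil => t; ring |].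
  apply: sfacs_cvg_cons; [nonzero | by apply: cvg_dil => t; ring |].
  apply: sfacs_cvg_cons; [nonzero | by apply: cvg_dil => t; ring | exact: sfacs_cvg_nil].
apply: sfacs_cvg_cons; [nonzero | by apply: cvg_dil => t; ring |].
apply: sfacs_cvg_cons; [nonzero | by apply: cvg_dil => t; ring |].
apply: sfacs_cvg_cons; [nonzero | by apply: cvg_dil => t; ring | exact: sfacs_cvg_nil].
Qed.

Lemma right_factor_cvg :
  (forall r, sf (e * f * q ^- N r / (a * x r)) kK != 0) ->
  (forall r, sf (a * x r * q / b) (k r) != 0) ->
  (forall r, sfac q p (lam * b / (a * x r)) (kK%:Z - (k r)%:Z) != 0) ->
  (fun t : K => right_factor p q N a b c d e f lam (dil t) k : K) @ near1 -->
  (right_factor p q N a b c d e f lam x k : K).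
Proof.
move=> B0 V0 L0; apply: (@cvgM K).
  apply: (@cvgM K); first exact: cvg_cst.
  apply: cvg_prod_seq => r _; apply: cvg_div.
  - by apply: mulf_neq0; [exact: B0 | exact: V0].
  - apply: (@cvgM K); apply: sf_cvg.
    + by nonzero.
    + by apply: cvg_con => t; rewrite !invfM; ring.
    + by nonzero.
    + by apply: cvg_dil => t; ring.
  - apply: (@cvgM K); apply: sf_cvg.
    + by nonzero.
    + by apply: cvg_con => t; rewrite !invfM; ring.
    + by nonzero.
    + by apply: cvg_dil => t; ring.
apply: cvg_prod_seq => r _; have := L0 r; rewrite !subzn ?msum_ge // => {}L0.
apply: cvg_div; first exact: L0.
  by apply: sf_cvg; [nonzero | apply: cvg_con => t; rewrite !invfM; ring].
by apply: sf_cvg; [nonzero | apply: cvg_con => t; rewrite !invfM; ring].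
Qed.
End Limits.

Lemma near_sf_neq0 (z : K) k : z != 0 ->
  \forall t \near near1, sf (z * t) k != 0 /\ sf (z / t) k != 0.
Proof.
move=> z0.
have H (j : 'I_k) : \forall t \near near1, th (z * t * q ^+ j) != 0 /\ th (z / t * q ^+ j) != 0.
  have : \forall t \near near1, [/\ th (z * q ^+ j * t) != 0, th (z * q ^+ j / t) != 0
      & th (z * q ^+ j / t / t) != 0].
    by apply: (near_th_neq0 Kc p1); nonzero.
  by apply: filterS => t [h1 h2 _]; rewrite mulrAC [z / t * _]mulrAC.
apply: filterS (filter_forall _ H) => t {}H.
by split; apply/sf_neq0P => j jk; have [] := H (Ordinal jk).
Qed.

Lemma near_box_regular r :
  \forall t \near near1, box_regular p q N a b e f lam (dil t) r.
Proof.
have H1 := @near_sf_neq0 (a * x r * q / b) (N r) ltac:(nonzero).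
have H2 := @near_sf_neq0 (a * x r * q / e) (N r) ltac:(nonzero).
have H3 := @near_sf_neq0 (a * x r * q / f) (N r) ltac:(nonzero).
have H4 := @near_sf_neq0 (e * f * q ^- N r / (a * x r)) M ltac:(nonzero).
have H5 := @near_sf_neq0 (lam * b / (a * x r)) (M - N r) ltac:(nonzero).
apply: filterS3 (filterI H1 H2) (filterI H3 H4) H5 => t [[h1 _] [h2 _]] [[h3 _] [_ h4]] [_ h5].
have E z : a * (t * x r) * q / z = a * x r * q / z * t by ring.
have E' z : z / (a * (t * x r)) = z / (a * x r) / t by rewrite !invfM; ring.
by rewrite /box_regular !E !E' h1 h2 h3 h4 h5.
Qed.

Lemma near_axis_neq0 r m : \forall t \near near1, th (a * (t * x r) * q ^+ m) != 0.
Proof.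
have := near_th_neq0 Kc p1 (ltac:(nonzero) : a * x r * q ^+ m != 0).
apply: filterS => t [h _ _].
by have -> : a * (t * x r) * q ^+ m = a * x r * q ^+ m * t by ring.
Qed.

Lemma near_generic_pair (i j : {r : 'I_n & 'I_(N r)}) m :
  \forall t \near near1, generic_pair p q a c d e f lam
    (node q (dil t) a i) (node q (dil t) a j) m.
Proof.
pose u := node q x a i; pose v := node q x a j.
have u0 : u != 0 by exact: node_neq0.
have v0 : v != 0 by exact: node_neq0.
have near z (z0 : z != 0) := near_th_neq0 Kc p1 z0.
have nodeE (l : {r : 'I_n & 'I_(N r)}) t : node q (dil t) a l = node q x a l * t.
  by rewrite /node /node_at; ring.
have H1 := near (u / (a * q / c) * q ^+ m) ltac:(nonzero).
have H2 := near (a * q / c * (a * q / d) / u * q ^+ m) ltac:(nonzero).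
have H3 := near (a * q / c * (a * q / d) / u / v * q ^+ m) ltac:(nonzero).
have H4 := near (a * q / c * lam / u * q ^+ m) ltac:(nonzero).
have H5 := near (a * q / c * lam / u / v * q ^+ m) ltac:(nonzero).
have H6 := near (e * f / u * q ^+ m) ltac:(nonzero).
have H7 := near (e * f / u / v / q ^+ m) ltac:(nonzero).
apply: filterS3 (filterI H1 H2) (filterI H3 H4) (filterI H5 (filterI H6 H7)).
move=> t [[h1 _ _] [_ h2 _]] [[_ _ h3] [_ h4 _]] [[_ _ h5] [[_ h6 _] [_ _ h7]]].
rewrite /generic_pair !nodeE -/u -/v.
have E1 z : u * t / z * q ^+ m = u / z * q ^+ m * t by ring.
have E2 z : z / (u * t) * q ^+ m = z / u * q ^+ m / t by rewrite invfM; ring.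
have E3 z w : z / (u * t) / (v * t) * w = z / u / v * w / t / t by rewrite !invfM; ring.
by rewrite !E3 E1 !E2 h1 h2 h3 h4 h5 h6 h7.
Qed.

End Perturbation.

(** * The transformation of multiple elliptic hypergeometric series *)

Unset Implicit Arguments.
Set Strict Implicit.

Theorem theorem5p2 (R : realType) (q p : R[i]) (hq : q != 0) (hp : `|p| < 1)
  (n : nat) (hn : (1 <= n)%N) (N : 'I_n -> nat)
  (a b c d e f : R[i]) (x : 'I_n -> R[i]) (lam : R[i])
  (hlam : lam = q * a ^+ 2 / (b * c * d))
  (ha : a != 0) (hb : b != 0) (hc : c != 0) (hd : d != 0) (he : e != 0) (hf : f != 0)
  (hx : forall r, x r != 0)
  (* no denominator vanishes: factors common to both sums *)
  (hxx : forall r s : 'I_n, (r < s)%N -> theta p (x r / x s) != 0)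
  (hqxx : forall k : 'I_n -> nat, (forall r, (k r <= N r)%N) ->
     forall r s, sfac q p (q * x r / x s) (k r) != 0)
  (* left-hand sum *)
  (hL1 : forall r, theta p (a * x r) != 0)
  (hL2 : forall k : 'I_n -> nat, (forall r, (k r <= N r)%N) ->
     forall r, sfac q p (a * x r * q ^+ (1 + N r)) (msum k) != 0)
  (hL3 : forall k : 'I_n -> nat, (forall r, (k r <= N r)%N) ->
     forall r, sfacs q p [:: a * x r * q / b; a * x r * q / e; a * x r * q / f] (k r) != 0)
  (hL4 : forall k : 'I_n -> nat, (forall r, (k r <= N r)%N) ->
     sfacs q p [:: a * q / c; a * q / d; e * f * q ^- (msum N) / lam] (msum k) != 0)
  (* right-hand prefactor *)
  (hP1 : sfacs q p [:: lam * q; lam * q / (e * f)] (msum N) != 0)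
  (hP2 : forall r, sfacs q p [:: a * x r * q / e; a * x r * q / f] (N r) != 0)
  (* right-hand sum *)
  (hR1 : theta p lam != 0)
  (hR2 : forall k : 'I_n -> nat, (forall r, (k r <= N r)%N) ->
     sfacs q p [:: lam * q ^+ (msum N + 1); a * q / c; a * q / d; lam * q / e; lam * q / f]
       (msum k) != 0)
  (hR3 : forall k : 'I_n -> nat, (forall r, (k r <= N r)%N) ->
     forall r, sfac q p (e * f * q ^- (N r) / (a * x r)) (msum k) != 0)
  (hR4 : forall k : 'I_n -> nat, (forall r, (k r <= N r)%N) ->
     forall r, sfac q p (a * x r * q / b) (k r) != 0)
  (hR5 : forall k : 'I_n -> nat, (forall r, (k r <= N r)%N) ->
     forall r, sfac q p (lam * b / (a * x r)) ((msum k)%:Z - (k r)%:Z) != 0) :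
  \sum_(k : {dffun forall r : 'I_n, 'I_(N r).+1})
    (let K := msum (fun r => k r) in
     (\prod_(r < n) \prod_(s < n | (r < s)%N)
        (theta p (q ^ ((k r)%:Z - (k s)%:Z) * x r / x s) / theta p (x r / x s)))
     * (\prod_(r < n) \prod_(s < n)
        (sfac q p (q ^- (N s) * x r / x s) (k r) / sfac q p (q * x r / x s) (k r)))
     * (\prod_(r < n)
        (theta p (a * x r * q ^+ (k r + K)) / theta p (a * x r)))
     * (\prod_(r < n)
        (sfac q p (a * x r) K / sfac q p (a * x r * q ^+ (1 + N r)) K))
     * (\prod_(r < n)
        (sfacs q p [:: c * x r; d * x r; lam * a * x r * q ^+ (msum N + 1) / (e * f)] (k r)
         / sfacs q p [:: a * x r * q / b; a * x r * q / e; a * x r * q / f] (k r)))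
     * (sfacs q p [:: b; e; f] K
        / sfacs q p [:: a * q / c; a * q / d; e * f * q ^- (msum N) / lam] K)
     * q ^+ (\sum_(r < n) r.+1 * k r)%N)
  =
  (sfacs q p [:: lam * q / e; lam * q / f] (msum N)
   / sfacs q p [:: lam * q; lam * q / (e * f)] (msum N))
  * (\prod_(r < n)
      (sfacs q p [:: a * x r * q; a * x r * q / (e * f)] (N r)
       / sfacs q p [:: a * x r * q / e; a * x r * q / f] (N r)))
  * \sum_(k : {dffun forall r : 'I_n, 'I_(N r).+1})
    (let K := msum (fun r => k r) in
     (\prod_(r < n) \prod_(s < n | (r < s)%N)
        (theta p (q ^ ((k r)%:Z - (k s)%:Z) * x r / x s) / theta p (x r / x s)))
     * (\prod_(r < n) \prod_(s < n)
        (sfac q p (q ^- (N s) * x r / x s) (k r) / sfac q p (q * x r / x s) (k r)))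
     * (theta p (lam * q ^+ (2 * K)) / theta p lam)
     * (sfacs q p [:: lam; lam * c / a; lam * d / a; e; f] K
        / sfacs q p [:: lam * q ^+ (msum N + 1); a * q / c; a * q / d; lam * q / e; lam * q / f] K)
     * (\prod_(r < n)
        ((sfac q p (lam * b / (a * x r)) K
          * sfac q p (lam * a * x r * q ^+ (msum N + 1) / (e * f)) (k r))
         / (sfac q p (e * f * q ^- (N r) / (a * x r)) K
            * sfac q p (a * x r * q / b) (k r))))
     * (\prod_(r < n)
        (sfac q p (e * f / (a * x r)) (K%:Z - (k r)%:Z)
         / sfac q p (lam * b / (a * x r)) (K%:Z - (k r)%:Z)))
     * q ^+ (\sum_(r < n) r.+1 * k r)%N).
Proof.
have NN r : (N r <= N r)%N by [].
have [hc1 hd1 hg] : [/\ sfac q p (a * q / c) (msum N) != 0, sfac q p (a * q / d) (msum N) != 0 &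
    sfac q p (e * f * q ^- (msum N) / lam) (msum N) != 0].
  by have := hL4 _ NN; rewrite /sfacs !big_cons big_nil !mulf_eq0 !negb_or => /and4P[].
have [hl2 he1 hf1] : [/\ sfac q p (lam * q ^+ (msum N + 1)) (msum N) != 0,
    sfac q p (lam * q / e) (msum N) != 0 & sfac q p (lam * q / f) (msum N) != 0].
  by have := hR2 _ NN; rewrite /sfacs !big_cons big_nil !mulf_eq0 !negb_or => /and5P[? _ _ ? /andP[? _]].
have hl1 : sfac q p (lam * q) (msum N) != 0.
  by move: hP1; rewrite /sfacs !big_cons big_nil !mulf_eq0 !negb_or => /and3P[].
have lamN m : (m <= (msum N).*2)%N -> theta p (lam * q ^+ m) != 0.
  case: m => [|m] mM; first by rewrite expr0 mulr1.
  have [mN|Nm] := ltnP m (msum N).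
    by rewrite exprS mulrA; have /sf_neq0P := hl1; apply.
  have -> : lam * q ^+ m.+1 = lam * q ^+ (msum N + 1) * q ^+ (m - msum N).
    by rewrite -mulrA -exprD addn1 addSn subnKC.
  by have /sf_neq0P := hl2; apply; rewrite ltn_subLR // addnn.
pose K : numFieldType := R[i].
(* Only the factors that depend on x through more than its ratios are dilated. *)
pose W (y : 'I_n -> R[i]) (F : ('I_n -> R[i]) -> ('I_n -> nat) -> R[i]) :=
  \sum_(k : {dffun forall r : 'I_n, 'I_(N r).+1})
     string_weight p q N x (fun r => k r) * F y (fun r => k r).
pose L y := W y (left_factor p q N a b c d e f lam).
pose Rs y := W y (right_factor p q N a b c d e f lam).
pose P := sfacs q p [:: lam * q / e; lam * q / f] (msum N)
   / sfacs q p [:: lam * q; lam * q / (e * f)] (msum N).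
have kN (k : {dffun forall r : 'I_n, 'I_(N r).+1}) r : (k r <= N r)%N by rewrite -ltnS.
have main : L x = P * box_factor p q N a e f x * Rs x.
  apply: (@dilation_limits_eq K (fun t => L (fun r => t * x r))
     (fun t => P * box_factor p q N a e f (fun r => t * x r) * Rs (fun r => t * x r))).
  - have H1 : (\forall t \near (1 : K)^', t != 0)%classic by exact: near_dilation_neq0.
    have H2 : (\forall t \near (1 : K)^', forall r, box_regular p q N a b e f lam (fun r => t * x r) r)%classic.
      by apply: filter_forall => r; apply: (near_box_regular hp hq N hlam).
    have H3 : (\forall t \near (1 : K)^', forall r (m : 'I_(msum N).*2.+1),
        theta p (a * (t * x r) * q ^+ m) != 0)%classic.
      by apply: filter_forall => r; apply: filter_forall => m; exact: near_axis_neq0.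
    have H4 : (\forall t \near (1 : K)^', forall (i j : {r : 'I_n & 'I_(N r)}) (m : 'I_(msum N).+1),
        generic_pair p q a c d e f lam (node q (fun r => t * x r) a i)
          (node q (fun r => t * x r) a j) m)%classic.
      apply: (@filter_forall _ {r : 'I_n & 'I_(N r)}) => i.
      apply: (@filter_forall _ {r : 'I_n & 'I_(N r)}) => j; apply: filter_forall => m.
      by apply: (near_generic_pair hp hq hlam).
    apply: filterS3 (filterI H1 H2) H3 H4 => t [t0 h2] h3 h4.
    have E F : W (fun r => t * x r) F = \sum_(k : {dffun forall r : 'I_n, 'I_(N r).+1})
          string_weight p q N (fun r => t * x r) (fun r => k r) * F (fun r => t * x r) (fun r => k r).
      by apply: eq_bigr => k _; rewrite string_weight_dilation.
    rewrite /L /Rs !E /P /sfacs !big_cons !big_nil !mulr1.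
    have Ex r s : t * x r / (t * x s) = x r / x s by field; rewrite t0 hx.
    apply: generic_transformation => //.
    + by move=> r; rewrite mulf_neq0.
    + by move=> r s rs; rewrite Ex; exact: hxx.
    + by move=> r s; rewrite -mulrA Ex mulrA; exact: hqxx.
    + by move=> r m mM; exact: (h3 r (Ordinal (mM : (m < (msum N).*2.+1)%N))).
    + by move=> i j m mM; exact: (h4 i j (Ordinal (mM : (m < (msum N).+1)%N))).
  - apply: cvg_sum_seq => k; apply: (@cvgM K); first exact: cvg_cst.
    apply: left_factor_cvg => //.
    + exact: hL2 (kN k).
    + exact: hL3 (kN k).
  - apply: (@cvgM K).
      apply: (@cvgM K); first exact: cvg_cst.
      exact: box_factor_cvg.
    apply: cvg_sum_seq => k; apply: (@cvgM K); first exact: cvg_cst.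
    apply: (right_factor_cvg hp hq hlam) => //.
    + exact: hR3 (kN k).
    + exact: hR4 (kN k).
    + exact: hR5 (kN k).
have reorder (A B C1 C2 C3 C4 Q : R[i]) :
    A * B * C1 * C2 * C3 * C4 * Q = A * B * Q * (C1 * C2 * C3 * C4) by ring.
transitivity (L x); first by apply: eq_bigr => k _; exact: reorder.
by rewrite main; congr (_ * _); apply: eq_bigr => k _; rewrite -reorder.
Qed.
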